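(* Fix $n\ge 1$ and $t\in(0,1)$, and let $f$ be a bounded measurable function of $n$ replicas $(\vec\sigma^1,\dots,\vec\sigma^n)\in S_N^n$. Then \begin{align*} \nu_t'(f) &= \frac{h}{2}\sum_{l\le n}\nu_t\big(f a_l(\hat R_l-r)\big) - n\frac{h}{2}\nu_t\big(f a_{n+1}(\hat R_{n+1}-r)\big)\\ &\quad + 2\beta^2\sum_{1\le l<l'\le n}\nu_t\big(f a_{l,l'}(\hat R_{l,l'}-q)\big) - 2n\beta^2\sum_{l\le n}\nu_t\big(f a_{l,n+1}(\hat R_{l,n+1}-q)\big)\\ &\quad + n(n+1)\beta^2\,\nu_t\big(f a_{n+1,n+2}(\hat R_{n+1,n+2}-q)\big) + \nu_t(f\mathcal R), \end{align*} where $\nu_t'(f)=\frac{d}{dt}\nu_t(f)$ and the remainder $\mathcal R$ is a function of the replicas $\vec\sigma^1,\dots,\vec\sigma^{n+2}$ satisfying $$|\mathcal R|\le \frac{L}{N}(\beta^2+h)\Big(1+\sum_{l\le n+2}\varepsilon_l^4\Big) + L\beta^2\sum_{1\le l\ne l'\le n+2}(1+\varepsilon_l^2)(\hat R_{l,l'}-q)^2,$$ with $L$ a constant not depending on $N$ or $t$.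
   Context: Let $N\ge2$, $S_N=\{\vec\sigma\in\mathbb R^N:|\vec\sigma|=\sqrt N\}$ and $\lambda_N$ the uniform probability measure on $S_N$. Let $\xi$ be three times continuously differentiable, and $H_N$ a centered Gaussian process on $S_N$ with $\frac1N\mathbb E H_N(\vec\sigma^1)H_N(\vec\sigma^2)=\xi(R_{1,2})$, $R_{1,2}=N^{-1}\sum_{i\le N}\sigma^1_i\sigma^2_i$. Let $\beta>0$, $h\ne0$, and let $q\in[0,1)$ be the (assumed unique) solution of $h^2+\beta^2\xi'(q)=q/(1-q)^2$ (with $\xi'(q)\ge0$). Put $r=h(1-q)$, $b=h^2(1-q)+\beta^2(1-q)\xi'(q)$. Let $z$ be a standard Gaussian variable. For $\vec\sigma\in S_N$ write $\varepsilon=\sigma_N$ and $\hat\sigma_i=\sigma_i/\sqrt{(N-\varepsilon^2)/(N-1)}$ for $i\le N-1$, so $\hat{\vec\sigma}=(\hat\sigma_1,\dots,\hat\sigma_{N-1})\in S_{N-1}$. Let $H_{N-1}$ be a centered Gaussian process on $S_{N-1}$ with $\frac1{N-1}\mathbb E H_{N-1}(\hat{\vec\sigma}^1)H_{N-1}(\hat{\vec\sigma}^2)=\xi(\hat R_{1,2})$, $\hat R_{1,2}=(N-1)^{-1}\sum_{i\le N-1}\hat\sigma^1_i\hat\sigma^2_i$; $H_N,H_{N-1},z$ are independent. For $t\in[0,1]$ define $$H_t(\vec\sigma)=\sqrt t\beta H_N(\vec\sigma)+\sqrt{1-t}\beta H_{N-1}(\hat{\vec\sigma})+h\sum_{i\le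 N-1}\hat\sigma_i\Big(1+t\Big(\sqrt{\tfrac{N-\varepsilon^2}{N-1}}-1\Big)\Big)+h\varepsilon+\sqrt{1-t}\,\varepsilon z\beta\sqrt{\xi'(q)}-\tfrac12(1-t)\varepsilon^2 b.$$ For a function $f$ of $n$ replicas, $\langle f\rangle_t=Z_t^{-n}\int_{S_N^n}f\exp\sum_{l\le n}H_t(\vec\sigma^l)\,d\lambda_N^n$ with $Z_t=\int_{S_N}\exp H_t\,d\lambda_N$, and $\nu_t(f)=\mathbb E\langle f\rangle_t$ (expectation over $H_N,H_{N-1},z$). For replica $l$: $\varepsilon_l=\sigma^l_N$, $\hat R_l=(N-1)^{-1}\sum_{i\le N-1}\hat\sigma^l_i$, $\hat R_{l,l'}=(N-1)^{-1}\sum_{i\le N-1}\hat\sigma^l_i\hat\sigma^{l'}_i$, $a_l=1-\varepsilon_l^2$, and $2a_{l,l'}=\xi'(q)-\frac12(\varepsilon_l^2+\varepsilon_{l'}^2)(q\xi''(q)+\xi'(q))+\varepsilon_l\varepsilon_{l'}\xi''(q)$.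
   Formalization: The factor (β²+h) in the bound on 𝓡 is replaced by (β²+|h|), since h may be negative and the literal bound fails for h<−β² (e.g. ξ=0, β=1, h=−2); H_N and H_{N−1} are taken with continuous sample paths so that the Gibbs integrals are defined. *)

(* Defs.v *)
From HB Require Import structures.
From mathcomp Require Import all_boot all_order all_algebra.
From mathcomp Require Import all_classical all_reals all_analysis.
Set Implicit Arguments.
Unset Strict Implicit.
Unset Printing Implicit Defensive.
Import Order.TTheory GRing.Theory Num.Theory.
Import numFieldNormedType.Exports.
Local Open Scope classical_set_scope.
Local Open Scope ring_scope.

Section SK.
Variable R : realType.

(* Points of R^M are M-tuples (product sigma-algebra of the library). *)
Definition coord (M : nat) (x : M.-tuple R) (i : nat) : R := nth 0 x i.

Definition sph (M : nat) : set (M.-tuple R) :=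
  [set x | \sum_(i < M) coord x i ^+ 2 = M%:R].
Arguments sph : clear implicits.

Definition overlap (M : nat) (x y : M.-tuple R) : R :=
  M%:R^-1 * \sum_(i < M) coord x i * coord y i.

Definition mx_act (M : nat) (O : 'M[R]_M) (x : M.-tuple R) : M.-tuple R :=
  mktuple (fun i : 'I_M => \sum_(j < M) O i j * coord x j).

Definition uniform_on_sphere (M : nat)
    (lam : probability (M.-tuple R) R) : Prop :=
  measurable (sph M) /\ lam (~` sph M) = 0%E /\
  forall O : 'M[R]_M, O^T *m O = 1%:M ->
    forall A, measurable A -> lam (mx_act O @^-1` A) = lam A.

Definition gauss_law (v : R) : set R -> \bar R :=
  if v == 0 then @dirac _ R 0 R else normal_prob 0 (Num.sqrt v).

Section ProbSpace.
Context {d : measure_display} {Omega : measurableType d}.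
Variable P : probability Omega R.

Definition has_law (Y : Omega -> R) (mu : set R -> \bar R) : Prop :=
  measurable_fun setT Y /\
  forall A : set R, measurable A -> P (Y @^-1` A) = mu A.

(* X is a centered Gaussian process on S_M with
   (1/M) E X(x) X(y) = xi (overlap x y):
   all finite linear combinations are centered Gaussian with the
   corresponding variance. *)
Definition gauss_process (M : nat) (X : Omega -> M.-tuple R -> R)
    (xi : R -> R) : Prop :=
  forall (k : nat) (x : 'I_k -> M.-tuple R) (c : 'I_k -> R),
    (forall j, sph M (x j)) ->
    has_law (fun w => \sum_(j < k) c j * X w (x j))
      (gauss_law (\sum_(j < k) \sum_(j' < k)
                     c j * c j' * (M%:R * xi (overlap (x j) (x j'))))).

Definition cont_on_sph (M : nat) (g : M.-tuple R -> R) : Prop :=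
  forall x, sph M x -> forall e : R, 0 < e -> exists2 del : R, 0 < del &
    forall y, sph M y -> \sum_(i < M) (coord x i - coord y i) ^+ 2 < del ->
      `|g x - g y| < e.

Definition gen_sigma (I : Type) (D : set I) (X : I -> Omega -> R)
    : set (set Omega) :=
  <<s \bigcup_(i in D) [set X i @^-1` A | A in (@measurable _ R)] >>.

Definition indep3 (F1 F2 F3 : set (set Omega)) : Prop :=
  forall A B C, F1 A -> F2 B -> F3 C ->
    P (A `&` B `&` C) = (P A * P B * P C)%E.

End ProbSpace.

Definition C3 (xi : R -> R) : Prop :=
  (forall x, derivable xi x 1) /\
  (forall x, derivable (derive1n 1 xi) x 1) /\
  (forall x, derivable (derive1n 2 xi) x 1) /\
  continuous (derive1n 3 xi).

Definition eps (N : nat) (x : N.-tuple R) : R := coord x N.-1.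

Definition hat (N : nat) (x : N.-tuple R) : N.-1.-tuple R :=
  mktuple (fun i : 'I_N.-1 =>
    coord x i / Num.sqrt ((N%:R - eps x ^+ 2) / (N.-1)%:R)).

Definition Rhat1 (N : nat) (x : N.-tuple R) : R :=
  (N.-1)%:R^-1 * \sum_(i < N.-1) coord (hat x) i.

Definition Rhat2 (N : nat) (x y : N.-tuple R) : R :=
  overlap (hat x) (hat y).

(* configurations of k replicas are k-tuples of points; replica number l
   (counting from 0) of s is [rep s l]. *)
Definition rep (N k : nat) (s : k.-tuple (N.-tuple R)) (l : nat)
    : N.-tuple R := nth (nseq_tuple N 0) s l.

Definition firstn (N n k : nat) (s : k.-tuple (N.-tuple R))
    : n.-tuple (N.-tuple R) := mktuple (fun i : 'I_n => rep s i).

(* integration of a function of k replicas against lam^{(x) k} over S_N^k,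
   written as an iterated integral *)
Fixpoint iint (N : nat) (lam : probability (N.-tuple R) R) (k : nat)
  : (k.-tuple (N.-tuple R) -> R) -> R :=
  match k with
  | 0 => fun G => G [tuple]
  | k'.+1 => fun G =>
      Rintegral lam (sph N)
        (fun x => iint lam (fun s : k'.-tuple (N.-tuple R) => G (cons_tuple x s)))
  end.

Section Interpolation.
Context {d : measure_display} {Omega : measurableType d}.
Variables (P : probability Omega R) (N : nat) (lam : probability (N.-tuple R) R).
Variables (xi : R -> R) (beta h q : R).
Variables (HN : Omega -> N.-tuple R -> R) (HM : Omega -> N.-1.-tuple R -> R)
          (z : Omega -> R).

Definition b_const : R :=
  h ^+ 2 * (1 - q) + beta ^+ 2 * (1 - q) * derive1n 1 xi q.

Definition Ht (t : R) (w : Omega) (x : N.-tuple R) : R :=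
  Num.sqrt t * beta * HN w x + Num.sqrt (1 - t) * beta * HM w (hat x)
  + h * \sum_(i < N.-1) coord (hat x) i *
        (1 + t * (Num.sqrt ((N%:R - eps x ^+ 2) / (N.-1)%:R) - 1))
  + h * eps x
  + Num.sqrt (1 - t) * eps x * z w * beta * Num.sqrt (derive1n 1 xi q)
  - 2^-1 * (1 - t) * eps x ^+ 2 * b_const.

Definition Zt (t : R) (w : Omega) : R :=
  Rintegral lam (sph N) (fun x => expR (Ht t w x)).

Definition gibbs (k : nat) (t : R) (w : Omega)
    (G : k.-tuple (N.-tuple R) -> R) : R :=
  (Zt t w ^+ k)^-1 *
  iint lam (fun s => G s * expR (\sum_(l < k) Ht t w (rep s l))).

Definition nu (k : nat) (t : R) (G : k.-tuple (N.-tuple R) -> R) : R :=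
  Rintegral P setT (fun w => gibbs t w G).

End Interpolation.

End SK.
Arguments sph {R} M.

Section Coefs.
Variable R : realType.
Definition a1 (N : nat) (x : N.-tuple R) : R := 1 - eps x ^+ 2.
Definition a2 (xi : R -> R) (q : R) (N : nat) (x y : N.-tuple R) : R :=
  2^-1 * (derive1n 1 xi q
          - 2^-1 * (eps x ^+ 2 + eps y ^+ 2) * (q * derive1n 2 xi q + derive1n 1 xi q)
          + eps x * eps y * derive1n 2 xi q).
End Coefs.

(* Main.v *)
From Pilot Require Import Defs.
From HB Require Import structures.
From mathcomp Require Import all_boot all_order all_algebra.
From mathcomp Require Import all_classical all_reals all_analysis.
From mathcomp Require Import measurable_realfun.
From mathcomp Require Import ring lra.
Set Implicit Arguments.
Unset Strict Implicit.
Unset Printing Implicit Defensive.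
Import Order.TTheory GRing.Theory Num.Theory.
Import numFieldNormedType.Exports.
Local Open Scope classical_set_scope.
Local Open Scope ring_scope.

(* Gaussian integration by parts is replaced by Fourier analysis.  The hypotheses give
   E cos(c + sum_j c_j H_t(x_j)) in closed form, whence d/dt E F(H_t) = E (L F)(H_t) for the heat
   operator L and every trigonometric polynomial F of the field.  Replacing exp by
   (1 + sin(x/M)/M)^(M^2) and z^-n by polynomials in z, a replica average is a limit of integrals
   of such F, along which the derivatives converge locally uniformly in t; this gives nu_t'(f)
   in terms of the kernel d/dt Cov(H_t)/2 and of d/dt E H_t.

   Those two are expanded at overlap q.  Off the null set |sigma_N| = sqrt N, the last coordinate
   perturbs the overlap by O(1/N), and by the choice of b the terms carrying only
   second powers of last coordinates reduce to a multiple of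
   epsilon_(n+2)^2 - epsilon_(n+1)^2, whose average vanishes by symmetry. *)

(** The hypotheses control only finite linear combinations of Gaussian values, whereas a Gibbs
    average involves a whole path. Cosines of such combinations are bounded with an explicit mean,
    so no moment of the supremum of the field is needed. Two features make the limit possible. With
    M = k + 2 the exponent M^2 compensates the two factors 1/M, and the approximating weight has
    logarithmic derivatives bounded uniformly in k, although the weight itself is only confined to
    an interval growing with k. The polynomials replacing z^-n are therefore chosen stage by stage,
    with errors relative to z^-n, z^(-n-1) and z^(-n-2): each quantity they multiply is bounded by
    the matching power of z, so the resulting bounds depend neither on the partition function nor on
    the disorder. The other obstacle is the pair of poles of the sphere: there the normalised vector
    is the origin, where nothing is known of H_(N-1). Fields, kernels and remainder therefore carry
    the indicator of the complement of the poles. *)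

Local Notation coord := Pilot.Defs.coord.

(** * Bounded measurable functions and their integrals against probability measures *)

Section BoundedMeasurable.
Context (R : realType) d (T : measurableType d).
Implicit Types f g : T -> R.

(** A class closed under the algebra, composition and partial integration used below, on which
    integrability against every probability measure is automatic. *)
Definition bm f := measurable_fun setT f /\ exists C, forall x, `|f x| <= C.

Lemma bm_cst (c : R) : bm (fun _ => c).
Proof. by split; [exact: measurable_cst | exists `|c|]. Qed.

Lemma bmD f g : bm f -> bm g -> bm (fun x => f x + g x).
Proof.
move=> [mf [C fC]] [mg [D gD]]; split; first exact: measurable_funD.
by exists (C + D) => x; rewrite (le_trans (ler_normD _ _))// lerD.
Qed.

Lemma bmN f : bm f -> bm (fun x => - f x).
Proof.
by move=> [mf [C fC]]; split; [exact: measurableT_comp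
  | exists C => x; rewrite normrN].
Qed.

Lemma bmB f g : bm f -> bm g -> bm (fun x => f x - g x).
Proof. by move=> bf bg; apply: bmD => //; exact: bmN. Qed.

Lemma bmM f g : bm f -> bm g -> bm (fun x => f x * g x).
Proof.
move=> [mf [C fC]] [mg [D gD]]; split; first exact: measurable_funM.
by exists (C * D) => x; rewrite normrM ler_pM.
Qed.

Lemma bmZ (c : R) f : bm f -> bm (fun x => c * f x).
Proof. by apply: bmM; exact: bm_cst. Qed.

Lemma bmX f k : bm f -> bm (fun x => f x ^+ k).
Proof.
move=> bf; elim: k => [|k ih]; first exact: bm_cst.
by under eq_fun do rewrite exprS; exact: bmM.
Qed.

Lemma bm_sum (I : Type) (r : seq I) (P : pred I) (F : I -> T -> R) :
  (forall i, bm (F i)) -> bm (fun x => \sum_(i <- r | P i) F i x).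
Proof.
move=> bF; elim: r => [|i r ih].
  by under eq_fun do rewrite big_nil; exact: bm_cst.
under eq_fun do rewrite big_cons.
by case: (P i) => //; exact: bmD.
Qed.

Lemma bm_prod (I : Type) (r : seq I) (P : pred I) (F : I -> T -> R) :
  (forall i, bm (F i)) -> bm (fun x => \prod_(i <- r | P i) F i x).
Proof.
move=> bF; elim: r => [|i r ih].
  by under eq_fun do rewrite big_nil; exact: bm_cst.
under eq_fun do rewrite big_cons.
by case: (P i) => //; exact: bmM.
Qed.

Lemma bm_indic (A : set T) : measurable A -> bm (\1_A).
Proof.
move=> mA; split; first exact: measurable_indic.
by exists 1 => x; rewrite indicE; case: (_ \in _); rewrite ?normr1 ?normr0.
Qed.

End BoundedMeasurable.

Lemma bm_comp (R : realType) d (T : measurableType d) d' (T' : measurableType d')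
    (f : T -> R) (g : T' -> T) :
  bm f -> measurable_fun setT g -> bm (fun x => f (g x)).
Proof.
move=> [mf [C fC]] mg; split; first exact: measurableT_comp.
by exists C => x; exact: fC.
Qed.

Section Expectation.
Context (R : realType) d (T : measurableType d) (mu : probability T R).
Implicit Types f g : T -> R.

Lemma bm_integrable f : bm f -> mu.-integrable setT (EFin \o f).
Proof.
move=> [mf [C fC]]; apply: measurable_bounded_integrable => //.
  by rewrite -ge0_fin_numE// fin_num_measure.
exists C; split; first by rewrite num_real.
by move=> x Cx y _ /=; rewrite (le_trans (fC y))// ltW.
Qed.

Lemma ED f g : bm f -> bm g ->
  \int[mu]_x (f x + g x) = \int[mu]_x f x + \int[mu]_x g x.
Proof. by move=> bf bg; apply: RintegralD => //; exact: bm_integrable. Qed.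

Lemma EB f g : bm f -> bm g ->
  \int[mu]_x (f x - g x) = \int[mu]_x f x - \int[mu]_x g x.
Proof. by move=> bf bg; apply: RintegralB => //; exact: bm_integrable. Qed.

Lemma EZl (c : R) f : bm f -> \int[mu]_x (c * f x) = c * \int[mu]_x f x.
Proof. by move=> bf; apply: RintegralZl => //; exact: bm_integrable. Qed.

Lemma EZr (c : R) f : bm f -> \int[mu]_x (f x * c) = \int[mu]_x f x * c.
Proof. by move=> bf; apply: RintegralZr => //; exact: bm_integrable. Qed.

Lemma E_cst (c : R) : \int[mu]_x c = c.
Proof.
rewrite Rintegral_cst//.
set m := (X in fine X); have -> : m = 1%E by exact: probability_setT.
by rewrite /= mulr1.
Qed.

Lemma E_sum (I : Type) (r : seq I) (P : pred I) (F : I -> T -> R) :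
  (forall i, bm (F i)) ->
  \int[mu]_x (\sum_(i <- r | P i) F i x) = \sum_(i <- r | P i) \int[mu]_x F i x.
Proof.
move=> bF; elim: r => [|i r ih].
  by under eq_Rintegral do rewrite big_nil; rewrite E_cst big_nil.
under eq_Rintegral do rewrite big_cons.
rewrite big_cons; case: (P i) => //.
by rewrite ED ?ih//; exact: bm_sum.
Qed.

Lemma E_le f g : bm f -> bm g -> (forall x, f x <= g x) ->
  \int[mu]_x f x <= \int[mu]_x g x.
Proof. by move=> bf bg fg; apply: le_Rintegral => //; exact: bm_integrable. Qed.

Lemma E_norm_le f g : bm f -> bm g -> (forall x, `|f x| <= g x) ->
  `|\int[mu]_x f x| <= \int[mu]_x g x.
Proof.
move=> bf bg fg; rewrite ler_norml -mulN1r -EZl// !E_le//.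
- by move=> x; have := fg x; rewrite ler_norml => /andP[].
- exact: bmZ.
- by move=> x; have := fg x; rewrite ler_norml mulN1r => /andP[].
Qed.

Lemma E_bound f (C : R) : bm f -> (forall x, `|f x| <= C) ->
  `|\int[mu]_x f x| <= C.
Proof.
by move=> bf fC; rewrite -[leRHS](E_cst C) E_norm_le//; exact: bm_cst.
Qed.

Lemma E_cvg (f_ : nat -> T -> R) f (C : R) :
  (forall n, measurable_fun setT (f_ n)) ->
  (forall n x, `|f_ n x| <= C) -> (forall x, f_ ^~ x @ \oo --> f x) ->
  (\int[mu]_x f_ n x) @[n --> \oo] --> \int[mu]_x f x.
Proof.
move=> mf_ f_C f_f.
have mf : measurable_fun setT f by apply: measurable_fun_cvg mf_ _ => x _.
have bC x : `|f x| <= C.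
  apply: (closed_cvg (fun y => y <= C) _ _ _ (cvg_norm (f_f x))).
    exact: closed_le.
  by apply: nearW => n; exact: f_C.
have [_ _ h] := @dominated_convergence _ T R mu setT measurableT
  (fun n x => (f_ n x)%:E) (EFin \o f) (cst C%:E)
  (fun n => measurableT_comp (@EFin_measurable R setT) (mf_ n))
  (measurableT_comp (@EFin_measurable R setT) mf)
  (aeW mu (fun x _ => @cvg_EFin _ _ _ _ (fun n => (f_ n x)%:E) _
    (nearW _ (fun n => isT)) (f_f x)))
  (bm_integrable (bm_cst _ C))
  (aeW mu (fun x n _ => f_C n x)).
apply: fine_cvg; rewrite fineK//.
apply: integrable_fin_num => //; apply: bm_integrable.
by split => //; exists C.
Qed.

Lemma E_derive (f df : R -> T -> R) (u v C : R) : u < v ->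
  (forall t, u < t < v -> bm (f t)) ->
  (forall t x, u < t < v -> is_derive t 1 (f ^~ x) (df t x)) ->
  (forall t x, u < t < v -> `|df t x| <= C) ->
  forall t, u < t < v ->
  is_derive t 1 (fun s => \int[mu]_x f s x) (\int[mu]_x df t x).
Proof.
move=> uv bf fdf dfC t tuv.
have dE s x : u < s < v -> partial1of2 f s x = df s x.
  by move=> suv; rewrite partial1of2E; have [_ ->] := fdf s x suv.
have tI : `]u, v[%classic t by rewrite /= in_itv.
have h1 s : `]u, v[%classic s -> mu.-integrable setT (EFin \o f s).
  by rewrite /= in_itv /= => suv; exact/bm_integrable/bf.
have h2 s x : `]u, v[%classic s -> setT x -> derivable (f ^~ x) s 1.
  by rewrite /= in_itv /= => suv _; have [] := fdf s x suv.
have h3 s x : `]u, v[%classic s -> setT x -> `|partial1of2 f s x| <= cst `|C| x.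
  by rewrite /= in_itv /= => suv _; rewrite dE// (le_trans (dfC _ _ suv))// ler_norm.
have D := @derivable_under_integral R _ T mu f setT measurableT t u v tI h1 h2
  (cst `|C|) (fun _ => normr_ge0 C) (bm_integrable (bm_cst _ _)) h3.
apply: DeriveDef => //.
rewrite -derive1E.
rewrite (differentiation_under_integral measurableT tI h1 h2
  (fun _ => normr_ge0 C) (bm_integrable (bm_cst _ _)) h3).
by apply: eq_Rintegral => x _; rewrite dE.
Qed.

End Expectation.

Section FubiniBounded.
Context (R : realType) d1 (T1 : measurableType d1) d2 (T2 : measurableType d2).
Context (m1 : probability T1 R) (m2 : probability T2 R).
Implicit Types f : T1 * T2 -> R.

Lemma bm_fst f x : bm f -> bm (fun y => f (x, y)).
Proof. by move=> bf; apply: bm_comp bf _; exact: pair1_measurable. Qed.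

Lemma bm_snd f y : bm f -> bm (fun x => f (x, y)).
Proof. by move=> bf; apply: bm_comp bf _; exact: pair2_measurable. Qed.

Lemma bm_swap f : bm f -> bm (fun z : T2 * T1 => f (z.2, z.1)).
Proof.
move=> bf; apply: (@bm_comp _ _ _ _ _ _ (fun z : T2 * T1 => (z.2, z.1))) bf _.
exact: measurable_fun_pair.
Qed.

Lemma E_prod1 f : bm f ->
  \int[(m1 \x m2)%E]_z f z = \int[m1]_x \int[m2]_y f (x, y).
Proof.
move=> bf; rewrite /Rintegral.
rewrite -(integral12_prod_meas1 (bm_integrable (m1 \x m2)%E bf)).
congr fine; apply: eq_integral => x _; rewrite fineK//.
by apply/integrable_fin_num/bm_integrable => //; exact: bm_fst.
Qed.

Lemma E_prod2 f : bm f ->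
  \int[(m1 \x m2)%E]_z f z = \int[m2]_y \int[m1]_x f (x, y).
Proof.
move=> bf; rewrite /Rintegral.
rewrite -(integral21_prod_meas1 (bm_integrable (m1 \x m2)%E bf)).
congr fine; apply: eq_integral => x _; rewrite fineK//.
by apply/integrable_fin_num/bm_integrable => //; exact: bm_snd.
Qed.

Lemma E_fubini f : bm f ->
  \int[m1]_x \int[m2]_y f (x, y) = \int[m2]_y \int[m1]_x f (x, y).
Proof. by move=> bf; rewrite -E_prod1// E_prod2. Qed.

End FubiniBounded.

(** Adding the bound [C] makes the integrand nonnegative, so measurability of the partial integral
    is the Tonelli statement; [C] is subtracted afterwards. *)
Lemma bm_E2 (R : realType) d1 (T1 : measurableType d1) d2 (T2 : measurableType d2)
    (mu : probability T2 R) (f : T1 * T2 -> R) :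
  bm f -> bm (fun x => \int[mu]_y f (x, y)).
Proof.
move=> bf; have [mf [C fC]] := bf; split; last first.
  by exists C => x; apply: E_bound => //; exact: bm_fst.
pose g := fun z => f z + C.
have g0 z : (0 <= (g z)%:E)%E.
  by rewrite lee_fin /g; have := fC z; rewrite ler_norml => /andP[]; lra.
have mg : measurable_fun setT (EFin \o g).
  by apply/measurable_EFinP; apply: measurable_funD.
have := measurable_fun_fubini_tonelli_F (m2 := mu) (EFin \o g) mg g0.
move/(measurableT_comp (fine_measurable measurableT)) => mF.
rewrite (_ : (fun _ => _) = (fun z => fine (fubini_F mu (EFin \o g) z) - C)).
  exact: measurable_funB.
apply/funext => z; rewrite /fubini_F -[fine _]/(\int[mu]_x g (z, x)).
by rewrite ED; [rewrite E_cst addrK|exact: bm_fst|exact: bm_cst].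
Qed.

Lemma bm_E1 (R : realType) d1 (T1 : measurableType d1) d2 (T2 : measurableType d2)
    (mu : probability T1 R) (f : T1 * T2 -> R) :
  bm f -> bm (fun y => \int[mu]_x f (x, y)).
Proof. by move=> bf; exact: (bm_E2 mu (bm_swap bf)). Qed.

(** * Product measures on tuples of replicas *)

Section PowerMeasure.
Context (R : realType) d (T : measurableType d) (mu : probability T R).

Definition tcons k (z : T * k.-tuple T) : k.+1.-tuple T := cons_tuple z.1 z.2.

Lemma measurable_tcons k : measurable_fun setT (@tcons k).
Proof. exact: measurable_cons. Qed.

HB.instance Definition _ k := isMeasurableFun.Build _ _ _ _ (@tcons k)
  (@measurable_tcons k).

(** The k-fold power of [mu], built as a push-forward along [tcons] so that it lives on the
    sigma-algebra of tuples and unfolds one leading replica at a time. *)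
Fixpoint pw k : probability (k.-tuple T) R :=
  match k with
  | 0 => @dirac _ (0.-tuple T) [tuple] R
  | k'.+1 => distribution (mu \x pw k')%E (@tcons k')
  end.

Lemma E_pw0 (f : 0.-tuple T -> R) : \int[pw 0]_s f s = f [tuple].
Proof.
rewrite -[RHS](E_cst (pw 0)); apply: eq_Rintegral => s _.
by rewrite tuple0.
Qed.

Lemma bm_tcons k (f : k.+1.-tuple T -> R) : bm f -> bm (fun z => f (@tcons k z)).
Proof. by move=> bf; apply: bm_comp bf _; exact: measurable_tcons. Qed.

Lemma E_pwS k (f : k.+1.-tuple T -> R) : bm f ->
  \int[pw k.+1]_s f s = \int[mu]_x \int[pw k]_s f (cons_tuple x s).
Proof.
move=> bf; rewrite -(E_prod1 _ _ (bm_tcons bf)) /Rintegral.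
rewrite integral_distribution//.
- by apply/measurable_EFinP; have [] := bf.
- exact: (bm_integrable _ (bm_tcons bf)).
Qed.

End PowerMeasure.

(** * The heat operator on products of weights, and the integration of extra replicas *)

Section Replicas.
Context (R : realType) d (T : measurableType d) (lam : probability T R).
Variables (m1 : T -> R) (U : T -> T -> R).
Hypothesis bm1 : bm m1.
Hypothesis bU : bm (fun z : T * T => U z.1 z.2).
Hypothesis Usym : forall x y, U x y = U y x.

Lemma bm_Ur y : bm (U y).
Proof. exact: (bm_fst y bU). Qed.

Lemma bm_Ud : bm (fun y => U y y).
Proof.
by apply: (@bm_comp _ _ _ _ _ _ (fun y => (y, y)) bU); exact: measurable_fun_pair.
Qed.

Section Weights.
Variables a b1 b2 : T -> R.
Hypotheses (ba : bm a) (bb1 : bm b1) (bb2 : bm b2).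

(** Intended reading: [a] is g(u(y)) for a field u, and [b1], [b2] are g'/g and g''/g there. With L
    the operator of first-order coefficients [m1] and second-order coefficients [U], [Wt s * dd s]
    is L applied to [Wt s], and [Wt s * ee s x] is the derivative of [Wt s] in the direction U(.,
    x). *)
Definition Wt (s : seq T) := \prod_(y <- s) a y.
Definition ee (s : seq T) x := \sum_(y <- s) b1 y * U y x.
(** The double sum pairs each position with itself, contributing U b1^2; the term [b2 - b1 ^+ 2]
    corrects this to U b2. *)
Definition dd (s : seq T) :=
  \sum_(y <- s) (m1 y * b1 y + U y y * (b2 y - b1 y ^+ 2)) +
  \sum_(y <- s) \sum_(x <- s) U y x * b1 y * b1 x.
(** [Tq] is the mass of one replica. [al], [ell] and [ga] integrate the contributions of fresh
    replicas to the generator: one alone, one against [s], two against each other. *)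
Definition Tq := \int[lam]_y a y.
Definition al := \int[lam]_y (a y * (m1 y * b1 y + U y y * b2 y)).
Definition ell (s : seq T) := \int[lam]_x (ee s x * (a x * b1 x)).
Definition ga := \int[lam]_y (a y * b1 y * \int[lam]_x (U y x * (a x * b1 x))).

Lemma Wt_cons y s : Wt (y :: s) = a y * Wt s.
Proof. exact: big_cons. Qed.

Lemma ee_cons y s x : ee (y :: s) x = b1 y * U y x + ee s x.
Proof. exact: big_cons. Qed.

(** Product rule for a second-order operator: the new factor brings its own generator and, by
    symmetry of [U], twice its cross term with the old factors. *)
Lemma dd_cons y s : dd (y :: s) =
  dd s + (m1 y * b1 y + U y y * b2 y) + 2 * (b1 y * ee s y).
Proof.
rewrite /dd !big_cons.
under [\sum_(j <- s) \sum_(x <- y :: s) _]eq_bigr do rewrite big_cons.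
rewrite [X in _ + (_ + X) = _]big_split /= /ee.
have -> : \sum_(i <- s) U i y * b1 i * b1 y = b1 y * \sum_(x <- s) b1 x * U x y.
  by rewrite mulr_sumr; apply: eq_bigr => x _; ring.
have -> : \sum_(j <- s) U y j * b1 y * b1 j = b1 y * \sum_(x <- s) b1 x * U x y.
  by rewrite mulr_sumr; apply: eq_bigr => x _; rewrite (Usym y x); ring.
ring.
Qed.

Lemma bm_ee s : bm (ee s).
Proof. by apply: bm_sum => y; apply: bmZ; exact: bm_Ur. Qed.

Lemma bm_ab : bm (fun x => a x * b1 x).
Proof. exact: bmM. Qed.

Lemma bm_Uab : bm (fun z : T * T => U z.1 z.2 * (a z.2 * b1 z.2)).
Proof. by apply: bmM => //; exact: (bm_comp bm_ab). Qed.

Lemma bm_iU : bm (fun y => \int[lam]_x (U y x * (a x * b1 x))).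
Proof. exact: (bm_E2 lam bm_Uab). Qed.

Lemma ell_cons y s : ell (y :: s) =
  ell s + b1 y * \int[lam]_x (U y x * (a x * b1 x)).
Proof.
rewrite /ell -EZl; last by exact: (bm_fst y bm_Uab).
rewrite -ED; last by apply: bmZ; exact: (bm_fst y bm_Uab).
  by apply: eq_Rintegral => x _; rewrite ee_cons; ring.
by apply: bmM; [exact: bm_ee | exact: bm_ab].
Qed.

Lemma bm_tuple_sum n (F : T -> R) :
  bm F -> bm (fun s : n.-tuple T => \sum_(y <- s) F y).
Proof.
move=> bF; under eq_fun do rewrite big_tuple.
by apply: bm_sum => i; apply: (bm_comp bF); exact: measurable_tnth.
Qed.

Lemma bm_tuple_prod n (F : T -> R) :
  bm F -> bm (fun s : n.-tuple T => \prod_(y <- s) F y).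
Proof.
move=> bF; under eq_fun do rewrite big_tuple.
by apply: bm_prod => i; apply: (bm_comp bF); exact: measurable_tnth.
Qed.

Lemma bm_tuple_sum2 n (F : T -> T -> R) : bm (fun z : T * T => F z.1 z.2) ->
  bm (fun s : n.-tuple T => \sum_(y <- s) \sum_(x <- s) F y x).
Proof.
move=> bF.
under eq_fun => s do (rewrite big_tuple; under eq_bigr do rewrite big_tuple).
apply: bm_sum => i; apply: bm_sum => j.
apply: (@bm_comp _ _ _ _ _ _ (fun s => (tnth s i, tnth s j)) bF).
by apply: measurable_fun_pair; exact: measurable_tnth.
Qed.

Lemma bm_Wt n : bm (fun s : n.-tuple T => Wt s).
Proof. exact: bm_tuple_prod. Qed.

Lemma bm_dd n : bm (fun s : n.-tuple T => dd s).
Proof.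
apply: bmD.
  apply: bm_tuple_sum; apply: bmD; first exact: bmM.
  apply: bmM; first exact: bm_Ud.
  by apply: bmB => //; exact: bmX.
apply: (@bm_tuple_sum2 _ (fun y x => U y x * b1 y * b1 x)).
apply: bmM; last exact: (bm_comp bb1).
by apply: bmM => //; exact: (bm_comp bb1).
Qed.

Lemma ellE s : ell s = \sum_(y <- s) b1 y * \int[lam]_x (U y x * (a x * b1 x)).
Proof.
elim: s => [|y s ih]; last by rewrite ell_cons big_cons ih addrC.
rewrite big_nil /ell -[RHS](E_cst lam); apply: eq_Rintegral => x _.
by rewrite /ee big_nil mul0r.
Qed.

Lemma bm_ell n : bm (fun s : n.-tuple T => ell s).
Proof.
under eq_fun do rewrite ellE.
by apply: bm_tuple_sum; apply: bmM => //; exact: bm_iU.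
Qed.

Section ExtraReplicas.
Variables (n : nat) (f : n.-tuple T -> R).
Hypothesis bf : bm f.

(** The extra replicas stand in front because [pw] peels off the head; [f] keeps reading the last
    n. *)
Fixpoint dropt j : (j + n).-tuple T -> n.-tuple T :=
  match j with
  | 0 => fun s => s
  | j'.+1 => fun s => @dropt j' (behead_tuple s)
  end.

Lemma measurable_dropt j : measurable_fun setT (@dropt j).
Proof.
elim: j => [|j ih]; first exact: measurable_id.
exact: (measurableT_comp ih (@measurable_behead _ T (j + n))).
Qed.

Lemma dropt_cons j x (s : (j + n).-tuple T) :
  @dropt j.+1 (cons_tuple x s) = dropt s.
Proof. by rewrite /=; congr (dropt _); exact: val_inj. Qed.

Definition Ij j (G : seq T -> R) := \int[pw lam (j + n)]_s (f (dropt s) * G s).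

Lemma bm_fdrop j : bm (fun s => f (@dropt j s)).
Proof. exact: bm_comp bf (@measurable_dropt j). Qed.

Lemma IjS j (G : seq T -> R) : (forall k, bm (fun s : k.-tuple T => G s)) ->
  Ij j.+1 G = \int[pw lam (j + n)]_s (f (dropt s) * \int[lam]_y G (y :: s)).
Proof.
move=> bG; rewrite /Ij.
have bfG k : bm (fun s => f (@dropt k s) * G s).
  by apply: bmM => //; exact: bm_fdrop.
rewrite (E_pwS lam (bfG j.+1)).
rewrite (E_fubini lam (pw lam (j + n)) (bm_tcons (bfG j.+1))).
apply: eq_Rintegral => s _; rewrite -EZl.
  by apply: eq_Rintegral => y _; rewrite [tcons _]/= dropt_cons.
exact: (bm_snd s (bm_tcons (bG _))).
Qed.

Lemma IjD j (G H : seq T -> R) : bm (fun s : (j + n).-tuple T => G s) ->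
  bm (fun s : (j + n).-tuple T => H s) ->
  Ij j (fun s => G s + H s) = Ij j G + Ij j H.
Proof.
move=> bG bH; rewrite /Ij -ED; try by apply: bmM => //; exact: bm_fdrop.
by apply: eq_Rintegral => s _; rewrite mulrDr.
Qed.

Lemma IjZ j c (G : seq T -> R) : bm (fun s : (j + n).-tuple T => G s) ->
  Ij j (fun s => c * G s) = c * Ij j G.
Proof.
move=> bG; rewrite /Ij -EZl; last by apply: bmM => //; exact: bm_fdrop.
by apply: eq_Rintegral => s _; ring.
Qed.

Definition Wd s := Wt s * dd s.
Definition Wl s := Wt s * ell s.

Lemma bm_Wd k : bm (fun s : k.-tuple T => Wd s).
Proof. by apply: bmM; [exact: bm_Wt | exact: bm_dd]. Qed.

Lemma bm_Wl k : bm (fun s : k.-tuple T => Wl s).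
Proof. by apply: bmM; [exact: bm_Wt | exact: bm_ell]. Qed.

(** Each extra replica integrates to one factor [Tq], so a monomial in the partition function times
    a replica integral is again a replica integral. *)
Lemma Ij_Wt j : Ij j Wt = Tq ^+ j * Ij 0 Wt.
Proof.
elim: j => [|j ih]; first by rewrite expr0 mul1r.
rewrite exprS -mulrA -ih -IjZ; last exact: bm_Wt.
rewrite IjS; last exact: bm_Wt.
by apply: eq_Rintegral => s _; under eq_Rintegral do rewrite Wt_cons; rewrite EZr.
Qed.

Lemma Ij_Wl j : Ij j Wl = Tq ^+ j * Ij 0 Wl + j%:R * Tq ^+ j.-1 * (ga * Ij 0 Wt).
Proof.
elim: j => [|j ih]; first by rewrite expr0 mul1r !mul0r addr0.
have E s : \int[lam]_y Wl (y :: s) = Tq * Wl s + ga * Wt s.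
  transitivity (\int[lam]_y (a y * Wl s +
      (a y * b1 y * \int[lam]_x (U y x * (a x * b1 x))) * Wt s)).
    by apply: eq_Rintegral => y _; rewrite /Wl Wt_cons ell_cons; ring.
  rewrite ED.
  - by rewrite !EZr//; apply: bmM; [exact: bmM | exact: bm_iU].
  - by apply: bmM => //; exact: bm_cst.
  - apply: bmM; last exact: bm_cst.
    by apply: bmM; [exact: bmM | exact: bm_iU].
rewrite IjS; last exact: bm_Wl.
rewrite (_ : \int[_]_s _ = Ij j (fun s => Tq * Wl s + ga * Wt s)); last first.
  by apply: eq_Rintegral => s _; rewrite E.
rewrite IjD; [|by apply: bmZ; exact: bm_Wl|by apply: bmZ; exact: bm_Wt].
rewrite !IjZ; [|exact: bm_Wt|exact: bm_Wl].
rewrite ih (Ij_Wt j) exprS /= -natr1.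
case: j {ih} => [|j] /=; first by rewrite !expr0; ring.
by rewrite !exprS -natr1; ring.
Qed.

(** The generator of Z^j W by the product rule: j Z^(j-1) and j(j-1) Z^(j-2) are the first two
    derivatives of the monomial. The predecessors are truncated only where their coefficient is
    zero. *)
Lemma Ij_Wd j : Ij j Wd = Tq ^+ j * Ij 0 Wd +
  j%:R * Tq ^+ j.-1 * (al * Ij 0 Wt + 2 * Ij 0 Wl) +
  (j * j.-1)%:R * Tq ^+ j.-2 * (ga * Ij 0 Wt).
Proof.
elim: j => [|j ih]; first by rewrite expr0 mul1r !mul0r !addr0.
have bU2 : bm (fun y => m1 y * b1 y + U y y * b2 y).
  by apply: bmD; [exact: bmM | apply: bmM => //; exact: bm_Ud].
have E s : \int[lam]_y Wd (y :: s) = Tq * Wd s + (al * Wt s + 2 * Wl s).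
  transitivity (\int[lam]_y (a y * Wd s +
      ((a y * (m1 y * b1 y + U y y * b2 y)) * Wt s +
       2 * (Wt s * (ee s y * (a y * b1 y)))))).
    by apply: eq_Rintegral => y _; rewrite /Wd Wt_cons dd_cons; ring.
  have h1 : bm (fun y => a y * Wd s) by apply: bmM => //; exact: bm_cst.
  have h2 : bm (fun y => (a y * (m1 y * b1 y + U y y * b2 y)) * Wt s).
    by apply: bmM; [exact: bmM | exact: bm_cst].
  have h3 : bm (fun y => ee s y * (a y * b1 y)).
    by apply: bmM; [exact: bm_ee | exact: bm_ab].
  have h4 : bm (fun y => Wt s * (ee s y * (a y * b1 y))) by exact: bmZ.
  rewrite ED//; last by apply: bmD => //; exact: bmZ.
  rewrite ED//; last exact: bmZ.
  by rewrite !EZr ?EZl//; exact: bmM.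
rewrite IjS; last exact: bm_Wd.
rewrite (_ : \int[_]_s _ = Ij j (fun s => Tq * Wd s + (al * Wt s + 2 * Wl s)));
  last by apply: eq_Rintegral => s _; rewrite E.
have hW := bm_Wt (j + n); have hD := bm_Wd (j + n); have hL := bm_Wl (j + n).
rewrite IjD; [|exact: bmZ|by apply: bmD; exact: bmZ].
rewrite IjZ// IjD; [|exact: bmZ|exact: bmZ].
rewrite !IjZ// ih (Ij_Wt j) (Ij_Wl j) exprS /=.
case: j {ih E hW hD hL} => [|[|j]] /=; rewrite ?expr0 ?expr1; [ring|ring|].
rewrite !natrM -!natr1 !exprS; ring.
Qed.

End ExtraReplicas.
End Weights.
End Replicas.

(** * Differentiation rules for real functions *)

Section RealDerivatives.
Context (R : realType).
Implicit Types (f g : R -> R) (x df dg : R).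

Lemma is_dD f g x df dg : is_derive x 1 f df -> is_derive x 1 g dg ->
  is_derive x 1 (fun t => f t + g t) (df + dg).
Proof. exact: is_deriveD. Qed.

Lemma is_dM f g x df dg : is_derive x 1 f df -> is_derive x 1 g dg ->
  is_derive x 1 (fun t => f t * g t) (df * g x + f x * dg).
Proof.
move=> h1 h2; apply: is_derive_eq (is_deriveM h1 h2) _.
by rewrite /GRing.scale /=; ring.
Qed.

Lemma is_dcst (c x : R) : is_derive x 1 (fun _ => c) 0.
Proof. exact: is_derive_cst. Qed.

Lemma is_did x : is_derive x 1 (fun t : R => t) 1.
Proof. exact: is_derive_id. Qed.

Lemma is_dZ (c : R) f x df : is_derive x 1 f df ->
  is_derive x 1 (fun t => c * f t) (c * df).
Proof.
by move=> h; apply: is_derive_eq (is_dM (is_dcst c x) h) _; rewrite mul0r add0r.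
Qed.

Lemma is_dcomp f g x df dg : is_derive (g x) 1 f df -> is_derive x 1 g dg ->
  is_derive x 1 (fun t => f (g t)) (df * dg).
Proof. by move=> h1 h2; exact: is_derive1_comp. Qed.

Lemma is_dexp f x df : is_derive x 1 f df ->
  is_derive x 1 (fun t => expR (f t)) (expR (f x) * df).
Proof. by move=> h; apply: is_dcomp h; exact: is_derive_expR. Qed.

Lemma is_dcos f x df : is_derive x 1 f df ->
  is_derive x 1 (fun t => cos (f t)) (- sin (f x) * df).
Proof. by move=> h; apply: is_dcomp h; exact: is_derive_cos. Qed.

Lemma is_dsin f x df : is_derive x 1 f df ->
  is_derive x 1 (fun t => sin (f t)) (cos (f x) * df).
Proof. by move=> h; apply: is_dcomp h; exact: is_derive_sin. Qed.

Lemma is_daffine (a b x : R) : is_derive x 1 (fun t => a + t * b) b.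
Proof.
apply: is_derive_eq (is_dD (is_dcst a x) (is_dM (is_did x) (is_dcst b x))) _.
by ring.
Qed.

Lemma is_d_near_itv f g (u v x df : R) : u < x < v ->
  (forall y, u < y < v -> f y = g y) ->
  is_derive x 1 f df -> is_derive x 1 g df.
Proof.
move=> uxv fg; apply: near_eq_is_derive.
have : x \in `]u, v[ by rewrite in_itv.
by move/near_in_itvoo; apply: filterS => y; rewrite in_itv; exact: fg.
Qed.

End RealDerivatives.

(** * Trigonometric polynomials of a field, closed under products and under the heat operator *)

Section TrigPolynomials.
Context (R : realType) d (T : measurableType d).
Variables (m1 : T -> R) (U : T -> T -> R).
Hypothesis Usym : forall x y, U x y = U y x.

Implicit Types (u : T -> R) (cs : seq (R * T)) (tau : seq (R * R * seq (R * T))).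

Definition lin u cs := \sum_(p <- cs) p.1 * u p.2.
Definition qf cs := \sum_(p <- cs) \sum_(p' <- cs) p.1 * p'.1 * U p.2 p'.2.
Definition ql cs y := \sum_(p <- cs) p.1 * U p.2 y.

(* A term (a, al, cs) of a list stands for the field functional
   a * cos (al + \sum_p c_p u(x_p)). *)
Definition tev u tau := \sum_(z <- tau) z.1.1 * cos (z.1.2 + lin u z.2).

(** The heat operator term by term: on the cosine of a linear form, the second-order part yields
    [- qf] times cos and the drift yields [- lin m1] times sin. *)
Definition tgen u tau := \sum_(z <- tau) z.1.1 *
  (- qf z.2 * cos (z.1.2 + lin u z.2) - lin m1 z.2 * sin (z.1.2 + lin u z.2)).

(** The derivative in the direction U(., y): the cross term created when a factor depending on u(y)
    is multiplied in. *)
Definition tgrad u tau y :=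
  \sum_(z <- tau) z.1.1 * (- ql z.2 y * sin (z.1.2 + lin u z.2)).

(** cos A sin B = (cos(A + B - pi/2) - cos(A - B - pi/2)) / 2: multiplication by sin(th u(y)) stays
    within lists of cosines. *)
Definition tmul th y tau :=
  [seq (z.1.1 / 2, z.1.2 - pi / 2, (th, y) :: z.2) | z <- tau] ++
  [seq (- z.1.1 / 2, z.1.2 - pi / 2, (- th, y) :: z.2) | z <- tau].

Lemma lin_cons u th y cs : lin u ((th, y) :: cs) = th * u y + lin u cs.
Proof. exact: big_cons. Qed.

Lemma ql_cons th y cs x : ql ((th, y) :: cs) x = th * U y x + ql cs x.
Proof. exact: big_cons. Qed.

Lemma qf_cons th y cs :
  qf ((th, y) :: cs) = th ^+ 2 * U y y + 2 * th * ql cs y + qf cs.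
Proof.
rewrite /qf big_cons /= big_cons /=.
under [\sum_(j <- cs) \sum_(p' <- _ :: _) _]eq_bigr do rewrite big_cons /=.
rewrite [X in _ + X = _]big_split /= /ql.
have -> : \sum_(j <- cs) th * j.1 * U y j.2 = th * \sum_(p <- cs) p.1 * U p.2 y.
  by rewrite mulr_sumr; apply: eq_bigr => j _; rewrite (Usym y); ring.
have -> : \sum_(i <- cs) i.1 * th * U i.2 y = th * \sum_(p <- cs) p.1 * U p.2 y.
  by rewrite mulr_sumr; apply: eq_bigr => j _; ring.
ring.
Qed.

Lemma tev_mul u th y tau : tev u (tmul th y tau) = tev u tau * sin (th * u y).
Proof.
rewrite /tev /tmul big_cat !big_map /= -big_split /= mulr_suml.
apply: eq_bigr => -[[a al] cs] _ /=; rewrite !lin_cons.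
have E s : cos (al - pi / 2 + (s + lin u cs)) = sin (al + lin u cs + s).
  by rewrite -cosBpihalf; congr cos; ring.
by rewrite !E !sinD (mulNr th (u y)) cosN sinN; field.
Qed.

Lemma tgrad_mul u th y tau x : tgrad u (tmul th y tau) x =
  tgrad u tau x * sin (th * u y) + tev u tau * (th * cos (th * u y)) * U y x.
Proof.
rewrite /tgrad /tev /tmul big_cat !big_map /= -big_split /= !mulr_suml -big_split.
apply: eq_bigr => -[[a al] cs] _ /=; rewrite !lin_cons !ql_cons.
have E s : sin (al - pi / 2 + (s + lin u cs)) = - cos (al + lin u cs + s).
  by rewrite -sinBpihalf; congr sin; ring.
by rewrite !E !cosD (mulNr th (u y)) cosN sinN; field.
Qed.

(** L(FG) = (LF) G + F (LG) + 2 Gamma(F, G) with G = sin(th u(y)); [tgrad] at y is what Gamma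
    requires. *)
Lemma tgen_mul u th y tau : tgen u (tmul th y tau) =
  tgen u tau * sin (th * u y) +
  tev u tau * (m1 y * (th * cos (th * u y)) + U y y * (- th ^+ 2 * sin (th * u y))) +
  2 * tgrad u tau y * (th * cos (th * u y)).
Proof.
rewrite /tgen /tev /tgrad /tmul big_cat !big_map /= -big_split /= mulr_sumr.
rewrite !mulr_suml -!big_split.
apply: eq_bigr => -[[a al] cs] _ /=; rewrite !lin_cons !qf_cons.
have E s : sin (al - pi / 2 + (s + lin u cs)) = - cos (al + lin u cs + s).
  by rewrite -sinBpihalf; congr sin; ring.
have E' s : cos (al - pi / 2 + (s + lin u cs)) = sin (al + lin u cs + s).
  by rewrite -cosBpihalf; congr cos; ring.
by rewrite !E !E' (mulNr th (u y)) !(cosD (al + _)) !(sinD (al + _)) cosN sinN; move: (cos _) (sin _) (cos (th * _)) (sin (th * _)) => ca sa ct st; field.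
Qed.

(** The three functionals come from one and the same list, for all u at once: only then do the old
    data determine the generator after multiplication by a new factor. *)
Definition trep (W D : (T -> R) -> R) (E : (T -> R) -> T -> R) := exists tau,
  forall u, [/\ W u = tev u tau, D u = tgen u tau & forall y, E u y = tgrad u tau y].

(* [tmult g g1 g2]: multiplication by g (u y) preserves representability, with
   g1 and g2 in the roles of the first two derivatives of g. *)
Definition tmult (g g1 g2 : R -> R) := forall W D E y, trep W D E ->
  trep (fun u => W u * g (u y))
       (fun u => D u * g (u y) + W u * (m1 y * g1 (u y) + U y y * g2 (u y))
                 + 2 * E u y * g1 (u y))
       (fun u x => E u x * g (u y) + W u * g1 (u y) * U y x).

Lemma trep_ext (W D W' D' : (T -> R) -> R) (E E' : (T -> R) -> T -> R) :
  (forall u, W u = W' u) -> (forall u, D u = D' u) ->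
  (forall u y, E u y = E' u y) -> trep W D E -> trep W' D' E'.
Proof.
move=> h1 h2 h3 [tau h]; exists tau => u; have [e1 e2 e3] := h u.
by split=> [||y]; rewrite -?h1 -?h2 -?h3.
Qed.

Lemma tmult_ext g g1 g2 h h1 h2 : g =1 h -> g1 =1 h1 -> g2 =1 h2 ->
  tmult g g1 g2 -> tmult h h1 h2.
Proof. by move=> /funext <- /funext <- /funext <-. Qed.

Lemma tmult_base k th :
  tmult (fun x => 1 + k * sin (th * x)) (fun x => k * (th * cos (th * x)))
        (fun x => k * (- th ^+ 2 * sin (th * x))).
Proof.
move=> W D E y [tau h].
exists (tau ++ [seq (k * z.1.1, z.1.2, z.2) | z <- tmul th y tau]) => u.
have [-> -> h3] := h u.
have P1 t : tev u [seq (k * z.1.1, z.1.2, z.2) | z <- t] = k * tev u t.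
  rewrite /tev big_map mulr_sumr.
  by apply: eq_bigr => z _ /=; rewrite mulrA.
have P2 t : tgen u [seq (k * z.1.1, z.1.2, z.2) | z <- t] = k * tgen u t.
  rewrite /tgen big_map mulr_sumr.
  by apply: eq_bigr => z _ /=; rewrite mulrA.
have P3 t x : tgrad u [seq (k * z.1.1, z.1.2, z.2) | z <- t] x = k * tgrad u t x.
  rewrite /tgrad big_map mulr_sumr.
  by apply: eq_bigr => z _ /=; rewrite mulrA.
have C1 t t' : tev u (t ++ t') = tev u t + tev u t' by rewrite /tev big_cat.
have C2 t t' : tgen u (t ++ t') = tgen u t + tgen u t' by rewrite /tgen big_cat.
have C3 t t' x : tgrad u (t ++ t') x = tgrad u t x + tgrad u t' x.
  by rewrite /tgrad big_cat.
split=> [||x].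
- by rewrite C1 P1 tev_mul; ring.
- by rewrite C2 P2 tgen_mul h3; ring.
- by rewrite C3 P3 tgrad_mul h3; ring.
Qed.

Lemma tmult1 : tmult (fun _ => 1) (fun _ => 0) (fun _ => 0).
Proof.
move=> W D E y; apply: trep_ext => *; ring.
Qed.

Lemma tmultM g g1 g2 h h1 h2 : tmult g g1 g2 -> tmult h h1 h2 ->
  tmult (fun x => g x * h x) (fun x => g1 x * h x + g x * h1 x)
        (fun x => g2 x * h x + 2 * g1 x * h1 x + g x * h2 x).
Proof.
move=> tg th W D E y r; have := th _ _ _ y (tg _ _ _ y r).
by apply: trep_ext => *; ring.
Qed.

(** The derivatives of the power are factored as the power times a quotient, because [trep_Wt] asks
    for logarithmic derivatives. *)
Lemma tmult_pow k th n : (forall x, 1 + k * sin (th * x) != 0) ->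
  tmult (fun x => (1 + k * sin (th * x)) ^+ n)
   (fun x => (1 + k * sin (th * x)) ^+ n *
      (n%:R * (k * (th * cos (th * x))) / (1 + k * sin (th * x))))
   (fun x => (1 + k * sin (th * x)) ^+ n *
      (n%:R * (n%:R - 1) * (k * (th * cos (th * x))) ^+ 2
         / (1 + k * sin (th * x)) ^+ 2
       + n%:R * (k * (- th ^+ 2 * sin (th * x))) / (1 + k * sin (th * x)))).
Proof.
move=> nz; elim: n => [|n ih].
  by apply: tmult_ext tmult1 => x /=; rewrite ?expr0 ?mul0r ?add0r ?mulr0 ?mul0r.
have := tmultM ih (tmult_base k th).
apply: tmult_ext => x /=; have := nz x; set s := 1 + k * sin (th * x) => s0.
- by rewrite exprSr.
- by rewrite (exprSr s n) (_ : n.+1%:R = n%:R + 1) ?natr1//; field.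
- by rewrite (exprSr s n) (_ : n.+1%:R = n%:R + 1) ?natr1//; field.
Qed.

(** One factor is multiplied in per replica; the recursions [dd_cons] and [ee_cons] are exactly the
    product rules built into [tmult]. *)
Lemma trep_Wt (phi r1 r2 : R -> R) :
  tmult phi (fun x => phi x * r1 x) (fun x => phi x * r2 x) ->
  forall s : seq T,
  trep (fun u => Wt (fun y => phi (u y)) s)
    (fun u => Wt (fun y => phi (u y)) s *
              dd m1 U (fun y => r1 (u y)) (fun y => r2 (u y)) s)
    (fun u x => Wt (fun y => phi (u y)) s * ee U (fun y => r1 (u y)) s x).
Proof.
move=> tm; elim=> [|y s ih].
  exists [:: (1, 0, [::])] => u.
  rewrite /Wt /dd /ee /tev /tgen /tgrad !big_nil !big_seq1 /= /lin /qf /ql !big_nil.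
  by split=> [||y]; rewrite ?big_seq1 /= ?big_nil ?addr0 ?cos0; ring.
have := tm _ _ _ y ih.
apply: trep_ext => [u|u|u x]; rewrite ?Wt_cons.
- by ring.
- by rewrite dd_cons//; ring.
- by rewrite ee_cons; ring.
Qed.

End TrigPolynomials.

(** * Bounds and joint measurability of the replica functionals *)

Section Bounds.
Context (R : realType) (T : Type).

Lemma sum_bound (s : seq T) (F : T -> R) C : (forall y, `|F y| <= C) ->
  `|\sum_(y <- s) F y| <= (size s)%:R * C.
Proof.
move=> FC; elim: s => [|y s ih]; first by rewrite big_nil normr0 mul0r.
rewrite big_cons /= -natr1 mulrDl mul1r addrC.
by rewrite (le_trans (ler_normD _ _))// lerD.
Qed.

Lemma prod_bound (s : seq T) (F : T -> R) C : (forall y, `|F y| <= C) ->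
  `|\prod_(y <- s) F y| <= C ^+ size s.
Proof.
move=> FC; elim: s => [|y s ih]; first by rewrite big_nil normr1 expr0.
by rewrite big_cons /= exprS normrM ler_pM.
Qed.

End Bounds.

Lemma dd_bound (R : realType) d (T : measurableType d) (m1 : T -> R)
    (U : T -> T -> R) (b1 b2 : T -> R) (Cm CU C1 C2 : R) :
  (forall y, `|m1 y| <= Cm) -> (forall x y, `|U x y| <= CU) ->
  (forall y, `|b1 y| <= C1) -> (forall y, `|b2 y| <= C2) ->
  forall s, `|dd m1 U b1 b2 s| <= (size s)%:R * (Cm * C1 + CU * (C2 + C1 ^+ 2)) +
    (size s)%:R * ((size s)%:R * (CU * C1 * C1)).
Proof.
move=> hm hU h1 h2 s; rewrite (le_trans (ler_normD _ _))// lerD//.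
  apply: sum_bound => y; rewrite (le_trans (ler_normD _ _))// lerD//.
    by rewrite normrM ler_pM.
  rewrite normrM ler_pM// (le_trans (ler_normB _ _))// lerD// normrX.
  by rewrite lerXn2r// nnegrE// (le_trans _ (h1 y)).
by apply: sum_bound => y; apply: sum_bound => x; rewrite !normrM !ler_pM// mulr_ge0.
Qed.

Section Joint.
Context (R : realType) d (T : measurableType d) d' (Om : measurableType d').
Variable n : nat.

Let nthp (i : 'I_n) (z : Om * n.-tuple T) := (z.1, tnth z.2 i).

Let mnthp i : measurable_fun setT (nthp i).
Proof.
apply: measurable_fun_pair => //.
exact: (measurableT_comp (measurable_tnth i) measurable_snd).
Qed.

Lemma bm_jsum (F : Om -> T -> R) : bm (fun z : Om * T => F z.1 z.2) ->
  bm (fun z : Om * n.-tuple T => \sum_(y <- z.2) F z.1 y).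
Proof.
move=> bF; under eq_fun do rewrite big_tuple.
by apply: bm_sum => i; exact: (bm_comp bF (mnthp i)).
Qed.

Lemma bm_jprod (F : Om -> T -> R) : bm (fun z : Om * T => F z.1 z.2) ->
  bm (fun z : Om * n.-tuple T => \prod_(y <- z.2) F z.1 y).
Proof.
move=> bF; under eq_fun do rewrite big_tuple.
by apply: bm_prod => i; exact: (bm_comp bF (mnthp i)).
Qed.

Lemma bm_jsum2 (F : Om -> T -> T -> R) :
  bm (fun z : Om * (T * T) => F z.1 z.2.1 z.2.2) ->
  bm (fun z : Om * n.-tuple T => \sum_(y <- z.2) \sum_(x <- z.2) F z.1 y x).
Proof.
move=> bF.
under eq_fun => s do (rewrite big_tuple; under eq_bigr do rewrite big_tuple).
apply: bm_sum => i; apply: bm_sum => j.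
apply: (@bm_comp _ _ _ _ _ _
  (fun z : Om * n.-tuple T => (z.1, (tnth z.2 i, tnth z.2 j))) bF).
apply: measurable_fun_pair => //; apply: measurable_fun_pair.
- exact: (measurableT_comp (measurable_tnth i) measurable_snd).
- exact: (measurableT_comp (measurable_tnth j) measurable_snd).
Qed.

End Joint.

Lemma bm_horner (R : realType) d (T : measurableType d) (p : {poly R}) (f : T -> R) :
  bm f -> bm (fun x => p.[f x]).
Proof.
move=> bf; under eq_fun do rewrite horner_coef.
by apply: bm_sum => i; apply: bmZ; exact: bmX.
Qed.

Section PathFunctionals.
Context (R : realType) d (T : measurableType d) (lam : probability T R).
Context d' (Om : measurableType d').
Variables (m1 : T -> R) (U : T -> T -> R).
Hypothesis bm1 : bm m1.
Hypothesis bU : bm (fun z : T * T => U z.1 z.2).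
Hypothesis Usym : forall x y, U x y = U y x.
Variables a b1 b2 : Om -> T -> R.
Hypothesis ba : bm (fun z : Om * T => a z.1 z.2).
Hypothesis bb1 : bm (fun z : Om * T => b1 z.1 z.2).
Hypothesis bb2 : bm (fun z : Om * T => b2 z.1 z.2).

Let sndT (g : T -> R) : bm g -> bm (fun z : Om * T => g z.2).
Proof. by move=> bg; apply: (bm_comp bg). Qed.

Lemma bmj_Wt n : bm (fun z : Om * n.-tuple T => Wt (a z.1) z.2).
Proof. exact: bm_jprod. Qed.

Let c1 : measurable_fun setT (fun z : Om * (T * T) => (z.1, z.2.1)).
Proof. by apply: measurable_fun_pair => //; apply: measurableT_comp. Qed.

Let c2 : measurable_fun setT (fun z : Om * (T * T) => (z.1, z.2.2)).
Proof. by apply: measurable_fun_pair => //; apply: measurableT_comp. Qed.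

Lemma bmj_dd n : bm (fun z : Om * n.-tuple T => dd m1 U (b1 z.1) (b2 z.1) z.2).
Proof.
apply: bmD.
  apply: (@bm_jsum _ _ _ _ _ _ (fun w y =>
    m1 y * b1 w y + U y y * (b2 w y - b1 w y ^+ 2))).
  apply: bmD; first by apply: bmM => //; exact: sndT.
  apply: bmM; first exact: (sndT (bm_Ud bU)).
  by apply: bmB => //; exact: bmX.
apply: (@bm_jsum2 _ _ _ _ _ _ (fun w y x => U y x * b1 w y * b1 w x)).
apply: bmM; last exact: (bm_comp bb1 c2).
apply: bmM; last exact: (bm_comp bb1 c1).
by apply: (bm_comp bU).
Qed.

Lemma bmj_iU : bm (fun z : Om * T =>
  \int[lam]_x (U z.2 x * (a z.1 x * b1 z.1 x))).
Proof.
have c3 : measurable_fun setT (fun z : Om * T * T => (z.1.1, z.2)).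
  by apply: measurable_fun_pair => //; apply: measurableT_comp.
have c4 : measurable_fun setT (fun z : Om * T * T => (z.1.2, z.2)).
  by apply: measurable_fun_pair => //; apply: measurableT_comp.
have h : bm (fun z : Om * T * T => U z.1.2 z.2 * (a z.1.1 z.2 * b1 z.1.1 z.2)).
  apply: bmM; first exact: (bm_comp bU c4).
  by apply: bmM; [exact: (bm_comp ba c3) | exact: (bm_comp bb1 c3)].
exact: (bm_E2 lam h).
Qed.

Lemma bmj_ell n : bm (fun z : Om * n.-tuple T => ell lam U (a z.1) (b1 z.1) z.2).
Proof.
have bw w : bm (a w) by exact: (bm_fst w ba).
have bw1 w : bm (b1 w) by exact: (bm_fst w bb1).
under eq_fun => z do rewrite (ellE lam bU (bw z.1) (bw1 z.1)).
apply: (@bm_jsum _ _ _ _ _ _ (fun w y =>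
   b1 w y * \int[lam]_x (U y x * (a w x * b1 w x)))).
by apply: bmM => //; exact: bmj_iU.
Qed.

End PathFunctionals.

(** * The heat equation in mean, for products of weights and polynomials of the partition
    function *)

Section Heat.
Context (R : realType) d (T : measurableType d) (lam : probability T R).
Context d' (Om : measurableType d') (P : probability Om R).
Variables (m1 : T -> R) (U : T -> T -> R) (X : R -> Om -> T -> R).
Hypothesis bm1 : bm m1.
Hypothesis bU : bm (fun z : T * T => U z.1 z.2).
Hypothesis Usym : forall x y, U x y = U y x.
Hypothesis mX : forall t : R, 0 < t < 1 ->
  measurable_fun setT (fun z : Om * T => X t z.1 z.2).
(** Gaussianity enters only here: the characteristic function of a linear form whose mean and
    variance are affine in t, with slopes [lin m1] and twice [qf U]. The same constants serve all
    phases, which covers the sine as well. *)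
Hypothesis field_cos : forall cs, exists V0 M0 : R, forall al t : R, 0 < t < 1 ->
  \int[P]_w cos (al + lin (X t w) cs) =
  expR (- (V0 + t * qf U cs)) * cos (al + (M0 + t * lin m1 cs)).

Lemma mX1 (t : R) x : 0 < t < 1 -> measurable_fun setT (fun w => X t w x).
Proof.
by move=> /mX mXt; exact: (measurableT_comp mXt (pair2_measurable x)).
Qed.

Lemma mlin (t : R) cs : 0 < t < 1 -> measurable_fun setT (fun w => lin (X t w) cs).
Proof.
move=> t01; elim: cs => [|[c x] cs ih].
  by under eq_fun do rewrite /lin big_nil; exact: measurable_cst.
under eq_fun do rewrite lin_cons.
by apply: measurable_funD => //; apply: measurable_funM => //; exact: mX1.
Qed.

Lemma bm_coslin (t : R) al cs : 0 < t < 1 -> bm (fun w => cos (al + lin (X t w) cs)).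
Proof.
move=> t01; split; last by exists 1 => w; exact: cos_max.
apply: (measurableT_comp (continuous_measurable_fun (@continuous_cos R))).
by apply: measurable_funD => //; exact: mlin.
Qed.

Lemma sin_cosB (x : R) al : sin (al + x) = cos (al - pi / 2 + x).
Proof. by rewrite -cosBpihalf; congr cos; ring. Qed.

Lemma bm_sinlin (t : R) al cs : 0 < t < 1 -> bm (fun w => sin (al + lin (X t w) cs)).
Proof.
by move=> t01; under eq_fun do rewrite sin_cosB; exact: bm_coslin.
Qed.

Lemma bm_tev (t : R) tau : 0 < t < 1 -> bm (fun w => tev (X t w) tau).
Proof. by move=> t01; apply: bm_sum => z; apply: bmZ; exact: bm_coslin. Qed.

Lemma bm_tgen1 (t : R) al cs : 0 < t < 1 -> bm (fun w => - qf U cs *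
  cos (al + lin (X t w) cs) - lin m1 cs * sin (al + lin (X t w) cs)).
Proof.
by move=> t01; apply: bmB; apply: bmZ; [exact: bm_coslin|exact: bm_sinlin].
Qed.

Lemma bm_tgen (t : R) tau : 0 < t < 1 -> bm (fun w => tgen m1 U (X t w) tau).
Proof. by move=> t01; apply: bm_sum => z; apply: bmZ; exact: bm_tgen1. Qed.

Lemma heat_cos al cs (t : R) : 0 < t < 1 ->
  is_derive t 1 (fun s => \int[P]_w cos (al + lin (X s w) cs))
    (\int[P]_w (- qf U cs * cos (al + lin (X t w) cs)
                - lin m1 cs * sin (al + lin (X t w) cs))).
Proof.
move=> t01; have [V0 [M0 hc]] := field_cos cs.
have hs s : 0 < s < 1 -> \int[P]_w sin (al + lin (X s w) cs) =
    expR (- (V0 + s * qf U cs)) * sin (al + (M0 + s * lin m1 cs)).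
  move=> s01; under eq_Rintegral do rewrite sin_cosB.
  by rewrite hc// -sin_cosB.
apply: (is_d_near_itv t01 (f := fun s =>
    expR (- (V0 + s * qf U cs)) * cos (al + (M0 + s * lin m1 cs)))).
  by move=> s s01; rewrite hc.
rewrite EB; try (by apply: bmZ; first [exact: bm_coslin|exact: bm_sinlin]).
rewrite !EZl; try first [exact: bm_sinlin|exact: bm_coslin].
rewrite hc// hs//.
have d1 : is_derive t 1 (fun s => - (V0 + s * qf U cs)) (- qf U cs).
  exact: (is_deriveN (is_daffine _ _ _)).
have d2 : is_derive t 1 (fun s => al + (M0 + s * lin m1 cs)) (lin m1 cs).
  have := is_dD (is_dcst al t) (is_daffine M0 (lin m1 cs) t).
  by rewrite add0r.
apply: is_derive_eq (is_dM (is_dexp d1) (is_dcos d2)) _.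
by ring.
Qed.

Lemma heat_trig tau (t : R) : 0 < t < 1 ->
  is_derive t 1 (fun s => \int[P]_w tev (X s w) tau)
    (\int[P]_w tgen m1 U (X t w) tau).
Proof.
move=> t01; elim: tau => [|z tau ih].
  rewrite (_ : \int[P]_w _ = 0).
    apply: (is_d_near_itv t01 (f := fun _ => 0)).
    move=> s s01; rewrite -[LHS](E_cst P); apply: eq_Rintegral => w _.
    by rewrite /tev big_nil.
  by rewrite -[RHS](E_cst P); apply: eq_Rintegral => w _; rewrite /tgen big_nil.
have e1 s : 0 < s < 1 -> z.1.1 * \int[P]_w cos (z.1.2 + lin (X s w) z.2) +
    \int[P]_w tev (X s w) tau = \int[P]_w tev (X s w) (z :: tau).
  move=> s01; rewrite -EZl; last exact: bm_coslin.
  rewrite -ED; [|by apply: bmZ; exact: bm_coslin|exact: bm_tev].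
  by apply: eq_Rintegral => w _; rewrite /tev big_cons.
have e2 : \int[P]_w tgen m1 U (X t w) (z :: tau) =
   z.1.1 * \int[P]_w (- qf U z.2 * cos (z.1.2 + lin (X t w) z.2)
                - lin m1 z.2 * sin (z.1.2 + lin (X t w) z.2)) +
   \int[P]_w tgen m1 U (X t w) tau.
  rewrite -EZl; last exact: bm_tgen1.
  rewrite -ED; [|by apply: bmZ; exact: bm_tgen1|exact: bm_tgen].
  by apply: eq_Rintegral => w _; rewrite /tgen big_cons.
rewrite e2; apply: (is_d_near_itv t01 e1).
by apply: is_dD ih; apply: is_dZ; exact: heat_cos.
Qed.

Section FixedPhi.
Variables phi r1 r2 : R -> R.
Hypothesis tphi : tmult m1 U phi (fun x => phi x * r1 x) (fun x => phi x * r2 x).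
Hypotheses (bphi : bm phi) (br1 : bm r1) (br2 : bm r2).

Definition fa t w y := phi (X t w y).
Definition fb1 t w y := r1 (X t w y).
Definition fb2 t w y := r2 (X t w y).

Section AtTime.
Variables (t : R) (t01 : 0 < t < 1).
Lemma bm_fa : bm (fun z : Om * T => fa t z.1 z.2).
Proof. exact: bm_comp bphi (mX t01). Qed.
Lemma bm_fb1 : bm (fun z : Om * T => fb1 t z.1 z.2).
Proof. exact: bm_comp br1 (mX t01). Qed.
Lemma bm_fb2 : bm (fun z : Om * T => fb2 t z.1 z.2).
Proof. exact: bm_comp br2 (mX t01). Qed.
End AtTime.

Lemma heat_Wt s (t : R) : 0 < t < 1 ->
  is_derive t 1 (fun u => \int[P]_w Wt (fa u w) s)
    (\int[P]_w (Wt (fa t w) s * dd m1 U (fb1 t w) (fb2 t w) s)).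
Proof.
move=> t01; have [tau htau] := trep_Wt Usym tphi s.
rewrite (_ : (fun _ => _) = (fun u => \int[P]_w tev (X u w) tau)).
  rewrite (_ : \int[P]_w _ = \int[P]_w tgen m1 U (X t w) tau).
    exact: heat_trig.
  by apply: eq_Rintegral => w _; have [_ <- _] := htau (X t w).
apply/funext => u; apply: eq_Rintegral => w _.
by have [<- _ _] := htau (X u w).
Qed.

Definition jW t (s : seq T) w := Wt (fa t w) s.
Definition jD t (s : seq T) w := Wt (fa t w) s * dd m1 U (fb1 t w) (fb2 t w) s.

Lemma bm_jW (t : R) m : 0 < t < 1 -> bm (fun z : Om * m.-tuple T => jW t z.2 z.1).
Proof. by move=> t01; apply: bmj_Wt; exact: bm_fa. Qed.

Lemma bm_jD (t : R) m : 0 < t < 1 -> bm (fun z : Om * m.-tuple T => jD t z.2 z.1).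
Proof.
move=> t01; apply: bmM; first by apply: bmj_Wt; exact: bm_fa.
by apply: bmj_dd => //; [exact: bm_fb1|exact: bm_fb2].
Qed.

Lemma bound_jD m : exists C, forall t w (s : m.-tuple T), `|jD t s w| <= C.
Proof.
have [_ [Cp hp]] := bphi; have [_ [C1 h1]] := br1; have [_ [C2 h2]] := br2.
have [_ [Cm hm]] := bm1; have [_ [CU hU]] := bU.
have := @dd_bound R d T m1 U _ _ Cm CU C1 C2 hm (fun x y => hU (x, y)).
move=> ddb.
exists (Cp ^+ m * (m%:R * (Cm * C1 + CU * (C2 + C1 ^+ 2)) +
    m%:R * (m%:R * (CU * C1 * C1)))) => t w s.
rewrite /jD normrM ler_pM//.
  by rewrite -[m in leRHS](size_tuple s); apply: prod_bound => y; exact: hp.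
have := ddb (fb1 t w) (fb2 t w) (fun y => h1 _) (fun y => h2 _) s.
by rewrite size_tuple.
Qed.

(** Fubini puts the expectation inside the replica integral, where it is differentiable for each
    fixed [s]; [bound_jD] dominates uniformly in time. *)
Lemma heat_F m (F : m.-tuple T -> R) (t : R) : bm F -> 0 < t < 1 ->
  is_derive t 1 (fun u => \int[P]_w \int[pw lam m]_s (F s * jW u s w))
    (\int[P]_w \int[pw lam m]_s (F s * jD t s w)).
Proof.
move=> bF t01.
have bFW u : 0 < u < 1 -> bm (fun z : Om * m.-tuple T => F z.2 * jW u z.2 z.1).
  by move=> u01; apply: bmM; [exact: (bm_comp bF)|exact: bm_jW].
have bFD u : 0 < u < 1 -> bm (fun z : Om * m.-tuple T => F z.2 * jD u z.2 z.1).
  by move=> u01; apply: bmM; [exact: (bm_comp bF)|exact: bm_jD].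
have sw (G : R -> m.-tuple T -> Om -> R) (u : R) : bm (fun z : Om * m.-tuple T => G u z.2 z.1) ->
    bm (fun z : Om * m.-tuple T => F z.2 * G u z.2 z.1) ->
    \int[P]_w \int[pw lam m]_s (F s * G u s w) =
    \int[pw lam m]_s (F s * \int[P]_w G u s w).
  move=> bG bFG; rewrite (E_fubini P (pw lam m) bFG).
  by apply: eq_Rintegral => s _ /=; rewrite EZl//; exact: (bm_snd s bG).
rewrite (sw (fun u s => jD u s) t)//; [|exact: bm_jD|exact: bFD].
apply: (is_d_near_itv t01 (f := fun u => \int[pw lam m]_s (F s * \int[P]_w jW u s w))).
  by move=> u u01; rewrite (sw (fun u s => jW u s) u)//; [exact: bm_jW|exact: bFW].
have [_ [CF hF]] := bF; have [CD hD] := bound_jD m.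
apply: (@E_derive R _ _ (pw lam m) (fun u s => F s * \int[P]_w jW u s w)
   (fun u s => F s * \int[P]_w jD u s w) 0 1 (CF * CD)) => //.
- by move=> u u01; apply: bmM => //; exact: (bm_E1 P (bm_jW m u01)).
- by move=> u s u01; apply: is_dZ; exact: heat_Wt.
- move=> u s u01; rewrite normrM ler_pM//; apply: E_bound => [|w]; last exact: hD.
  exact: (bm_snd s (bm_jD m u01)).
Qed.

Variables (n : nat) (f : n.-tuple T -> R).
Hypothesis bf : bm f.

Definition iW t w := \int[pw lam n]_s (f s * Wt (fa t w) s).
Definition iD t w := \int[pw lam n]_s
  (f s * (Wt (fa t w) s * dd m1 U (fb1 t w) (fb2 t w) s)).
Definition iL t w := \int[pw lam n]_s
  (f s * (Wt (fa t w) s * ell lam U (fa t w) (fb1 t w) s)).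
Definition iT t w := Tq lam (fa t w).
Definition iA t w := al lam m1 U (fa t w) (fb1 t w) (fb2 t w).
Definition iG t w := ga lam U (fa t w) (fb1 t w).

(** What the second-order chain rule gives for the heat operator on p(Z) W. *)
Definition Qp (p : {poly R}) t w :=
  p.[iT t w] * iD t w + p^`().[iT t w] * (iA t w * iW t w + 2 * iL t w)
  + p^`()^`().[iT t w] * (iG t w * iW t w).

Section Bm.
Variables (t : R) (t01 : 0 < t < 1).
Let b0 := bm_fa t01.
Let b1 := bm_fb1 t01.
Let b2 := bm_fb2 t01.

Lemma bm_iT : bm (iT t). Proof. exact: (bm_E2 lam b0). Qed.

Lemma bm_iA : bm (iA t).
Proof.
have snd (g : T -> R) : bm g -> bm (fun z : Om * T => g z.2).
  by move=> bg; apply: (bm_comp bg).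
have h : bm (fun z : Om * T => fa t z.1 z.2 *
    (m1 z.2 * fb1 t z.1 z.2 + U z.2 z.2 * fb2 t z.1 z.2)).
  by apply: bmM b0 (bmD (bmM (snd _ bm1) b1) (bmM (snd _ (bm_Ud bU)) b2)).
exact: (bm_E2 lam h).
Qed.

Lemma bm_iG : bm (iG t).
Proof.
have h : bm (fun z : Om * T => fa t z.1 z.2 * fb1 t z.1 z.2 *
    \int[lam]_x (U z.2 x * (fa t z.1 x * fb1 t z.1 x))).
  by apply: bmM; [exact: bmM | exact: bmj_iU].
exact: (bm_E2 lam h).
Qed.

Let bF : bm (fun z : Om * n.-tuple T => f z.2).
Proof. exact: (bm_comp bf). Qed.

Lemma bm_iW : bm (iW t).
Proof. exact: (bm_E2 _ (bmM bF (bmj_Wt b0 n))). Qed.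

Lemma bm_iD : bm (iD t).
Proof.
exact: (bm_E2 _ (bmM bF (bmM (bmj_Wt b0 n) (bmj_dd bm1 bU b1 b2 n)))).
Qed.

Lemma bm_iL : bm (iL t).
Proof.
exact: (bm_E2 _ (bmM bF (bmM (bmj_Wt b0 n) (bmj_ell lam bU b0 b1 n)))).
Qed.

Lemma bm_Qp p : bm (Qp p t).
Proof.
have bA := bm_iA; have bW := bm_iW; have bL := bm_iL; have bG := bm_iG.
have bD := bm_iD.
by repeat first [apply: bmD | apply: bmM | apply: bmZ | apply: bm_horner
  | exact: bm_iT | exact: bm_cst | exact: bA].
Qed.

Lemma bm_Fp p : bm (fun w => p.[iT t w] * iW t w).
Proof. by apply: bmM; [apply: bm_horner; exact: bm_iT | exact: bm_iW]. Qed.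

End Bm.

(** Z^j W is an integral over j + n replicas, to which [heat_F] applies with [f] read on the last
    n. *)
Lemma heat_Xj j (t : R) : 0 < t < 1 ->
  is_derive t 1 (fun u => \int[P]_w (('X^j).[iT u w] * iW u w))
    (\int[P]_w Qp 'X^j t w).
Proof.
move=> t01.
have bw u w : 0 < u < 1 -> [/\ bm (fa u w), bm (fb1 u w) & bm (fb2 u w)].
  move=> u01; split; [exact: (bm_fst w (bm_fa u01))|
    exact: (bm_fst w (bm_fb1 u01))|exact: (bm_fst w (bm_fb2 u01))].
have bfd : bm (fun s => f (@dropt d T n j s)).
  by apply: (bm_comp bf); exact: measurable_dropt.
have := @heat_F _ _ _ bfd t01.
rewrite (_ : \int[P]_w _ = \int[P]_w Qp 'X^j t w); last first.
  apply: eq_Rintegral => w _; have [h0 h1 h2] := bw t w t01.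
  have := Ij_Wd lam bm1 bU Usym h0 h1 h2 bf j.
  rewrite {1}/Ij => ->; rewrite /Qp derivXn derivMn derivXn !hornerMn !hornerXn.
  set x := iT t w; rewrite -/x.
  have e1 k : x ^+ k *+ j = j%:R * x ^+ k by rewrite mulr_natl.
  have e2 k i : x ^+ k *+ i *+ j = (j * i)%:R * x ^+ k.
    by rewrite -mulrnA mulr_natl mulnC.
  by rewrite e1 e2.
apply: is_d_near_itv t01 _ => u u01.
apply: eq_Rintegral => w _; have [h0 _ _] := bw u w u01.
by have := Ij_Wt lam h0 bf j; rewrite {1}/Ij hornerXn.
Qed.

Lemma heat_poly p (t : R) : 0 < t < 1 ->
  is_derive t 1 (fun u => \int[P]_w (p.[iT u w] * iW u w)) (\int[P]_w Qp p t w).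
Proof.
move=> t01; rewrite -[p]coefK poly_def.
elim/big_ind: _ => [|p1 p2 ih1 ih2|i _].
- rewrite (_ : \int[P]_w _ = 0); last first.
    rewrite -[RHS](E_cst P); apply: eq_Rintegral => w _.
    by rewrite /Qp !linear0 !horner0 !mul0r !addr0.
  apply: (is_d_near_itv t01 (f := fun _ => 0)).
  move=> u u01; rewrite -[LHS](E_cst P); apply: eq_Rintegral => w _.
  by rewrite horner0 mul0r.
- rewrite (_ : \int[P]_w _ = \int[P]_w Qp p1 t w + \int[P]_w Qp p2 t w).
    apply: (is_d_near_itv t01) (is_dD ih1 ih2) => u u01.
    rewrite -ED; [|exact: bm_Fp|exact: bm_Fp].
    by apply: eq_Rintegral => w _; rewrite hornerD mulrDl.
  rewrite -ED; [|exact: bm_Qp|exact: bm_Qp].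
  by apply: eq_Rintegral => w _; rewrite /Qp !linearD /= !hornerD; ring.
- set c := p`_i.
  rewrite (_ : \int[P]_w _ = c * \int[P]_w Qp 'X^i t w).
    apply: (is_d_near_itv t01) (is_dZ c (heat_Xj i t01)) => u u01.
    rewrite -EZl; last exact: bm_Fp.
    by apply: eq_Rintegral => w _; rewrite hornerZ mulrA.
  rewrite -EZl; last exact: bm_Qp.
  by apply: eq_Rintegral => w _; rewrite /Qp !linearZ /= !hornerZ; ring.
Qed.

End FixedPhi.
End Heat.

(** * Polynomial approximation of inverse powers with relative error *)

Section PolyInverse.
Context (R : realType).

(** With c = 1 - rho, rho^J <= exp(-c J) and exp(c J) >= (c J / 3)^3, so J^2 rho^J is of order
    1/J. *)
Lemma pow_exp_small (rho eta : R) : 0 <= rho < 1 -> 0 < eta ->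
  exists2 J : nat, (0 < J)%N & (J.+2)%:R ^+ 2 * rho ^+ J <= eta.
Proof.
move=> /andP[r0 r1] e0; set c := 1 - rho.
have c0 : 0 < c by rewrite subr_gt0.
(* 243 = 9 * 27: the 9 comes from (J + 2)^2 <= 9 J^2, the 27 from the cube of the 3 in (c J /
   3)^3. *)
have [J hJ] : exists J : nat, 243 / (c ^+ 3 * eta) < J%:R.
  exists (Num.truncn (243 / (c ^+ 3 * eta))).+1; exact: truncnS_gt.
have J0 : 0 < J%:R :> R.
  apply: le_lt_trans hJ; apply: divr_ge0; first exact: ler0n.
  by apply: mulr_ge0; [apply: exprn_ge0|]; exact: ltW.
exists J; first by rewrite -(ltr_nat R).
have J1 : 1 <= J%:R :> R by rewrite ler1n -(ltr_nat R).
have h1 : rho ^+ J <= expR (- (c * J%:R)).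
  have -> : - (c * J%:R) = (rho - 1) * J%:R by rewrite /c; ring.
  rewrite expRM_natr lerXn2r// ?nnegrE ?expR_ge0//.
  by have := expR_ge1Dx (rho - 1); lra.
have h2 : (c * J%:R / 3) ^+ 3 <= expR (c * J%:R).
  have z0 : 0 <= c * J%:R / 3 by apply: mulr_ge0; [apply: mulr_ge0; lra | lra].
  have -> : c * J%:R = (c * J%:R / 3) * 3%:R by field.
  move: (c * J%:R / 3) z0 => z z0.
  rewrite (_ : z * 3 / 3 = z); last by field.
  rewrite expRM_natr lerXn2r// ?nnegrE ?expR_ge0//.
  by have := expR_ge1Dx z; lra.
have h3 : rho ^+ J * (c * J%:R / 3) ^+ 3 <= 1.
  apply: le_trans (ler_pM _ _ h1 h2) _.
  - exact: exprn_ge0.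
  - by apply: exprn_ge0; apply: mulr_ge0; [apply: mulr_ge0; lra | lra].
  - by rewrite -expRD addNr expR0.
have h4 : (J.+2)%:R ^+ 2 <= 9 * J%:R ^+ 2 :> R.
  by rewrite -!natr1; nra.
have r2 : 0 <= rho ^+ J by exact: exprn_ge0.
have h5 : 243 < J%:R * (c ^+ 3 * eta).
  by move: hJ; rewrite ltr_pdivrMr// mulr_gt0// exprn_gt0.
have h6 : rho ^+ J * (J%:R ^+ 3 * c ^+ 3) <= 27.
  have -> : rho ^+ J * (J%:R ^+ 3 * c ^+ 3) =
     27 * (rho ^+ J * (c * J%:R / 3) ^+ 3) by field.
  by lra.
have c3 : 0 < c ^+ 3 by exact: exprn_gt0.
have h7 : 9 * J%:R ^+ 2 * rho ^+ J <= eta.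
  rewrite -(ler_pM2r (mulr_gt0 J0 c3)).
  have -> : 9 * J%:R ^+ 2 * rho ^+ J * (J%:R * c ^+ 3) =
    9 * (rho ^+ J * (J%:R ^+ 3 * c ^+ 3)) by ring.
  have -> : eta * (J%:R * c ^+ 3) = J%:R * (c ^+ 3 * eta) by ring.
  by lra.
by apply: le_trans h7; rewrite ler_wpM2r.
Qed.

(** p, p', p'' approximate x^-n and its derivatives, the errors being multiplied by x^n, x^(n+1),
    x^(n+2): they are relative, so a lower end [lo] that shrinks with the stage does no harm. *)
Definition inv_approx (n : nat) (lo K eta : R) (p : {poly R}) :=
  forall x, lo <= x <= K -> [/\ `|x ^+ n * p.[x] - 1| <= eta,
    `|x ^+ n.+1 * p^`().[x] + n%:R| <= eta &
    `|x ^+ n.+2 * p^`()^`().[x] - n%:R * n.+1%:R| <= eta].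

(** Geometric series 1/x = K^-1 sum_j u^j with u = 1 - x/K, cut after J + 2 terms so that two
    differentiations still leave the small factor u^J. *)
Lemma inv_approx1 (lo K eta : R) : 0 < lo -> lo <= K -> 0 < eta ->
  exists p, inv_approx 1 lo K eta p.
Proof.
move=> lo0 loK e0; have K0 : 0 < K by exact: lt_le_trans loK.
(* The error of the second derivative consists of five terms, counted with multiplicity, each at
   most eta / 5. *)
have [] := @pow_exp_small (1 - lo / K) (eta / 5).
- rewrite subr_ge0 ler_pdivrMr// mul1r loK /= gtrBl.
  by rewrite divr_gt0.
- by rewrite divr_gt0.
move=> J J0 hJ.
pose u : {poly R} := 1 - K^-1 *: 'X.
have [q q1] : exists q : {poly R}, 'X * q = 1 - u ^+ J.+2.
  exists (K^-1 *: \sum_(j < J.+2) u ^+ j).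
  rewrite -(opprB _ 1) subrX1 -scalerAr scalerAl -mulNr; congr (_ * _).
  by rewrite /u; ring.
have du : u^`() = - (K^-1)%:P.
  by rewrite /u derivB derivZ derivX derivC sub0r alg_polyC.
have q2 : q + 'X * q^`() = (J.+2%:R * K^-1) *: u ^+ J.+1.
  have := congr1 (@deriv R) q1.
  rewrite derivM derivX mul1r derivB derivC sub0r deriv_exp du /= => ->.
  by rewrite mulNr mul_polyC mulNrn opprK -scaler_nat scalerA.
have q3 : 2 *: q^`() + 'X * q^`()^`() =
    - ((J.+2%:R * J.+1%:R * K^-1 ^+ 2) *: u ^+ J).
  have := congr1 (@deriv R) q2.
  rewrite derivD derivM derivX mul1r derivZ deriv_exp du /= => h.
  rewrite scaler_nat mulr2n -addrA h mulNr mul_polyC mulNrn scalerN -(scaler_nat J.+1).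
  by rewrite !scalerA; congr (- (_ *: _)); ring.
exists q => x /andP[lox xK].
have E1 := congr1 (horner^~ x) q1; have E2 := congr1 (horner^~ x) q2.
have E3 := congr1 (horner^~ x) q3; move: E1 E2 E3.
rewrite !hornerE.
have x0 : 0 < x by exact: lt_le_trans lox.
set v := 1 - K^-1 * x; set w := K^-1 * x.
set A := q.[x]; set B := q^`().[x]; set C := q^`()^`().[x] => E1 E2 E3'.
have E3 : 2 * B + x * C = - (J.+2%:R * J.+1%:R * K^-1 * K^-1 * v ^+ J).
  by rewrite E3' /=; ring.
have w01 : 0 <= w <= 1.
  rewrite /w; apply/andP; split; first by rewrite mulr_ge0 ?invr_ge0 ?ltW.
  by rewrite [leLHS]mulrC ler_pdivrMr ?mul1r.
have v01 : 0 <= v <= 1 by rewrite /v -/w; lra.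
have vr : v <= 1 - lo / K.
  by rewrite /v lerD2l lerN2 [leRHS]mulrC ler_wpM2r// invr_ge0 ltW.
have vJ : 0 <= v ^+ J <= (1 - lo / K) ^+ J.
  rewrite exprn_ge0; last by case/andP: v01.
  by rewrite lerXn2r// nnegrE; lra.
set N : R := J.+2%:R; have N2 : 2 <= N by rewrite ler_nat.
have N1 : J.+1%:R = N - 1 :> R by rewrite /N -[in RHS]natr1 addrK.
have e0' : N ^+ 2 * v ^+ J <= eta / 5.
  by apply: le_trans hJ; rewrite ler_wpM2l ?exprn_ge0//; case/andP: vJ.
have v1 : 0 <= v ^+ J.+1 <= v ^+ J.
  by rewrite exprS; nra.
have v2 : 0 <= v ^+ J.+2 <= v ^+ J.+1.
  by rewrite [v ^+ J.+2]exprS; nra.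
rewrite -/N N1 in E2 E3; clear E3'.
move: E1 E2 E3 vJ v1 v2 e0'.
move: (v ^+ J.+2) (v ^+ J.+1) (v ^+ J) => V2 V1 V0 E1 E2 E3 vJ v1 v2 e0'.
have V00 : 0 <= V0 by case/andP: vJ.
have /andP[w0 w1] := w01; have /andP[V10 V1V] := v1.
have N0 : 0 <= N by exact: ler0n.
have N11 : 1 <= N by rewrite ler1n.
have NN : N <= N ^+ 2 by rewrite expr2 ler_peMl.
have NV : N * V0 <= N ^+ 2 * V0 by rewrite ler_wpM2r.
have F1 : x * A - 1 = - V2 by rewrite E1; ring.
have F2 : x ^+ 2 * B + 1 = N * w * V1 - (x * A - 1).
  have -> : x ^+ 2 * B = x * (A + x * B) - x * A by ring.
  by rewrite E2 /w; ring.
have F3 : x ^+ 3 * C - 2 = - 2 * (x ^+ 2 * B + 1) - N * (N - 1) * w ^+ 2 * V0.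
  have -> : x ^+ 3 * C = x ^+ 2 * (2 * B + x * C) - 2 * (x ^+ 2 * B) by ring.
  by rewrite E3 /w; ring.
have G1 : 0 <= N * w * V1 <= eta / 5.
  rewrite -mulrA; apply/andP; split; first by apply: mulr_ge0 => //; exact: mulr_ge0.
  apply: le_trans (le_trans NV e0').
  by rewrite ler_wpM2l// (le_trans _ V1V)// ler_piMl.
have G2 : 0 <= N * (N - 1) * w ^+ 2 * V0 <= eta / 5.
  have N1' : 0 <= N - 1 by lra.
  have w20 : 0 <= w ^+ 2 by exact: sqr_ge0.
  apply/andP; split; first by do 2![apply: mulr_ge0 => //]; exact: mulr_ge0.
  apply: le_trans e0'.
  rewrite ler_wpM2r// expr2 -mulrA ler_wpM2l//.
  have w21 : w ^+ 2 <= 1 by rewrite exprn_ile1.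
  by apply: le_trans (ler_piMr N1' w21) _; lra.
have G0 : 0 <= V2 <= eta / 5.
  have VN : V0 <= N * V0 by rewrite ler_peMl.
  clear -v1 v2 e0' NV VN; lra.
rewrite expr1 F3 F2 F1.
move: (N * w * V1) (N * (N - 1) * w ^+ 2 * V0) G1 G2 G0 => a b G1 G2 G0.
by clear -G0 G1 G2; split; rewrite ler_norml; lra.
Qed.

Lemma prod_approx (A B a b e : R) : 0 <= e <= 1 -> `|A - a| <= e -> `|B - b| <= e ->
  `|A * B - a * b| <= e * (`|a| + `|b| + 1).
Proof.
move=> /andP[e0 e1] hA hB.
have -> : A * B - a * b = (A - a) * (B - b) + a * (B - b) + b * (A - a) by ring.
rewrite (le_trans (ler_normD _ _))//.
have h1 : `|(A - a) * (B - b) + a * (B - b)| <= e * 1 + `|a| * e.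
  rewrite (le_trans (ler_normD _ _))// !normrM lerD//.
    by rewrite ler_pM// (le_trans hB).
  by rewrite ler_wpM2l.
have h2 : `|b * (A - a)| <= `|b| * e by rewrite normrM ler_wpM2l.
by apply: (le_trans (lerD h1 h2)); lra.
Qed.

(** Leibniz rule. The second derivative is the costliest: [prod_approx] charges n(n+1) + 2, twice n
    + 2, and 4, adding up to n(n+1) + 2n + 10. *)
Lemma inv_approxM n lo K e p q : 0 <= e <= 1 ->
  inv_approx n lo K e p -> inv_approx 1 lo K e q ->
  inv_approx n.+1 lo K (e * (n%:R * n.+1%:R + 2 * n%:R + 10)) (p * q).
Proof.
move=> e01 hp hq x xlK; have [p0 p1 p2] := hp x xlK; have [q0 q1 q2] := hq x xlK.
have e0 : 0 <= e by case/andP: e01.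
have n0 : 0 <= n%:R :> R by [].
have N1 : n.+1%:R = n%:R + 1 :> R by rewrite natr1.
have N2 : n.+2%:R = n%:R + 2 :> R by rewrite -!natr1; ring.
have p1' : `|x ^+ n.+1 * p^`().[x] - - n%:R| <= e by rewrite opprK.
have q1' : `|x ^+ 2 * q^`().[x] - - 1| <= e by rewrite opprK.
have q2' : `|x ^+ 3 * q^`()^`().[x] - 2| <= e by move: q2; rewrite !mul1r.
rewrite expr1 in q0; rewrite N1 in p2.
have B00 := prod_approx e01 p0 q0; have B01 := prod_approx e01 p0 q1'.
have B10 := prod_approx e01 p1' q0; have B02 := prod_approx e01 p0 q2'.
have B11 := prod_approx e01 p1' q1'; have B20 := prod_approx e01 p2 q0.
have nn0 : 0 <= n%:R * (n%:R + 1) :> R by apply: mulr_ge0 => //; lra.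
rewrite !normrN normr1 ?(ger0_norm n0) ?(ger0_norm nn0) ?(ger0_norm (ler0n _ 2)) in
  B00 B01 B10 B02 B11 B20.
rewrite !derivM derivD !derivM !hornerD !hornerM N1 N2.
split.
- have -> : x ^+ n.+1 * (p.[x] * q.[x]) - 1 =
     x ^+ n * p.[x] * (x * q.[x]) - 1 * 1 by rewrite exprS; ring.
  by apply: le_trans B00 _; rewrite ler_wpM2l//; clear -n0 nn0; lra.
- have -> : x ^+ n.+2 * (p^`().[x] * q.[x] + p.[x] * q^`().[x]) + (n%:R + 1) =
    (x ^+ n.+1 * p^`().[x] * (x * q.[x]) - - n%:R * 1) +
    (x ^+ n * p.[x] * (x ^+ 2 * q^`().[x]) - 1 * - 1) by rewrite !exprS expr0; ring.
  apply: le_trans (ler_normD _ _) _; apply: le_trans (lerD B10 B01) _.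
  by rewrite -mulrDr ler_wpM2l//; clear -n0 nn0; lra.
- have -> : x ^+ n.+3 * (p^`()^`().[x] * q.[x] + p^`().[x] * q^`().[x] +
      (p^`().[x] * q^`().[x] + p.[x] * q^`()^`().[x])) - (n%:R + 1) * (n%:R + 2) =
    (x ^+ n.+2 * p^`()^`().[x] * (x * q.[x]) - n%:R * (n%:R + 1) * 1) +
    ((x ^+ n.+1 * p^`().[x] * (x ^+ 2 * q^`().[x]) - - n%:R * - 1) +
    (x ^+ n.+1 * p^`().[x] * (x ^+ 2 * q^`().[x]) - - n%:R * - 1)) +
    (x ^+ n * p.[x] * (x ^+ 3 * q^`()^`().[x]) - 1 * 2) by rewrite !exprS expr0; ring.
  apply: le_trans (ler_normD _ _) _.
  have h := le_trans (ler_normD _ _) (lerD B20 (le_trans (ler_normD _ _) (lerD B11 B11))).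
  apply: le_trans (lerD h B02) _.
  by rewrite -!mulrDr ler_wpM2l//; clear -n0 nn0; lra.
Qed.

Lemma inv_approx_ex n (lo K eta : R) : 0 < lo -> lo <= K -> 0 < eta ->
  exists p, inv_approx n lo K eta p.
Proof.
move=> lo0 loK; elim: n eta => [|n ih] eta e0.
  exists 1 => x _; rewrite derivC deriv0 !hornerC.
  by rewrite !mulr0 mul0r addr0 subrr mulr1 subrr normr0; split; exact: ltW.
set C : R := n%:R * n.+1%:R + 2 * n%:R + 10.
have C0 : 10 <= C.
  by rewrite /C lerDr; apply: addr_ge0; apply: mulr_ge0.
pose e := Num.min 1 (eta / C).
have he : 0 < e <= 1.
  rewrite /e lt_min ltr01 divr_gt0 ?ge_min ?lexx//; lra.
have he0 : 0 < e by case/andP: he.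
have [p hp] := ih e he0; have [q hq] := inv_approx1 lo0 loK he0.
exists (p * q) => x xlK.
have heC : e * C <= eta.
  by rewrite -ler_pdivlMr; [rewrite /e ge_min lexx orbT | lra].
have he01 : 0 <= e <= 1 by lra.
by have [h1 h2 h3] := inv_approxM he01 hp hq xlK; split; apply: le_trans heC.
Qed.

End PolyInverse.

(** * Derivative of a limit of functions *)

Section LimitDerivative.
Context (R : realType).

(** Convergence of [G_] along all moving times and indices amounts to uniform closeness to [G t]
    near t, since a failure would produce a bad sequence. The mean value theorem then controls the
    increments of [F_ k] uniformly in k, and this survives the limit. *)
Lemma derive_of_ccvg (F_ G_ : nat -> R -> R) (F G : R -> R) (a b t : R) :
  a < t < b ->
  (forall k s, a < s < b -> is_derive s 1 (F_ k) (G_ k s)) ->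
  (forall s, a < s < b -> F_ k s @[k --> \oo] --> F s) ->
  (forall (tn : nat -> R) (sg : nat -> nat), (forall n, a < tn n < b) ->
     (forall n, (n <= sg n)%N) -> tn @ \oo --> t ->
     G_ (sg n) (tn n) @[n --> \oo] --> G t) ->
  is_derive t 1 F (G t).
Proof.
move=> tab dF cF cG.
have unif (e : R) : 0 < e -> exists2 del : R, 0 < del & exists K, forall k s,
    (K <= k)%N -> a < s < b -> `|s - t| < del -> `|G_ k s - G t| < e.
  move=> e0; apply: contrapT => h.
  have h1 n : exists p : nat * R, [/\ (n <= p.1)%N, a < p.2 < b,
      `|p.2 - t| < n.+1%:R^-1 & e <= `|G_ p.1 p.2 - G t|].
    apply: contrapT => h1; apply: h; exists n.+1%:R^-1 => //; exists n => k s nk sab st.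
    rewrite ltNge; apply/negP => h2; apply: h1; exists (k, s); split => //.
  have [g hg] := choice h1.
  have := cG (fun n => (g n).2) (fun n => (g n).1).
  have g1 n : a < (g n).2 < b by have [] := hg n.
  have g2 n : (n <= (g n).1)%N by have [] := hg n.
  have g3 : (g n).2 @[n --> \oo] --> t.
    apply/cvgrPdist_lt => r r0.
    have := @near_infty_natSinv_lt R (PosNum r0) => /= hn; near=> n.
    rewrite distrC; have [_ _ h3 _] := hg n; apply: lt_trans h3 _.
    by near: n.
  move=> /(_ g1 g2 g3)/cvgrPdist_lt/(_ _ e0) [m _ /(_ m (leqnn m))] /=.
  by rewrite distrC; have [_ _ _ h4] := hg m; rewrite ltNge h4.
have bound (e : R) : 0 < e -> exists2 del : R, 0 < del & forall s,
    a < s < b -> `|s - t| < del -> `|F s - F t - (s - t) * G t| <= e * `|s - t|.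
  move=> /unif[del del0 [K hK]]; exists del => // s sab st.
  have hk k : (K <= k)%N -> `|F_ k s - F_ k t - (s - t) * G t| <= e * `|s - t|.
    move=> Kk.
    have mvt x y : a < x < b -> a < y < b -> x < y ->
        exists2 c, x < c < y & F_ k y - F_ k x = G_ k c * (y - x).
      move=> xab yab xy.
      have [||c] := @MVT R (F_ k) (G_ k) x y xy.
      - move=> z; rewrite in_itv /= => /andP[xz zy]; apply: dF.
        by case/andP: xab => ? _; case/andP: yab => _ ?; apply/andP; split; lra.
      - apply: derivable_within_continuous => z; rewrite in_itv /= => /andP[xz zy].
        have [] // := dF k z _.
        by case/andP: xab => ? _; case/andP: yab => _ ?; apply/andP; split; lra.
      - by rewrite in_itv /= => cxy E; exists c.
    have fin c : a < c < b -> `|c - t| < del ->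
        `|G_ k c * (s - t) - (s - t) * G t| <= e * `|s - t|.
      move=> cab ct; rewrite [_ * G t]mulrC -mulrBl normrM ler_wpM2r// ltW//.
      exact: hK.
    have /andP[s1 s2] := sab; have /andP[t1 t2] := tab.
    have [st0|ts0|->] := ltgtP s t.
    - have [c /andP[c1 c2] E] := mvt s t sab tab st0.
      have -> : F_ k s - F_ k t = G_ k c * (s - t).
        by rewrite -[LHS]opprB E; ring.
      apply: fin; first lra.
      by move: st; rewrite !ltr_norml; lra.
    - have [c /andP[c1 c2] ->] := mvt t s tab sab ts0.
      apply: fin; first lra.
      by move: st; rewrite !ltr_norml; lra.
    - by rewrite !subrr mul0r subr0 !normr0 mulr0.
  have cv : `|F_ k s - F_ k t - (s - t) * G t| @[k --> \oo] -->
      `|F s - F t - (s - t) * G t|.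
    apply: cvg_norm; apply: cvgB; last exact: cvg_cst.
    by apply: cvgB; exact: cF.
  apply: (closed_cvg (fun y => y <= e * `|s - t|) _ _ _ cv); first exact: closed_le.
  by exists K.
have dlim : (fun h : R => h^-1 *: (F (h *: 1 + t) - F t)) @ 0^' --> G t.
  apply/cvgrPdist_le => e e0.
  have [del del0 hd] := bound e e0.
  have /andP[t1 t2] := tab.
  pose r := Num.min del (Num.min (t - a) (b - t)).
  have r0 : 0 < r by rewrite /r !lt_min del0 !subr_gt0 t1 t2.
  near=> h.
  have h0 : h != 0 by near: h; exact: nbhs_dnbhs_neq.
  have hr : `|h| < r.
    near: h; apply: dnbhs0_lt => //.
  move: hr; rewrite /r !lt_min => /and3P[hdel ha hb].
  have hs : a < h + t < b.
    by move: ha hb; rewrite !ltr_norml; lra.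
  have := hd (h + t) hs; rewrite addrK => /(_ hdel) hh.
  rewrite distrC [h *: 1]mulr1 /GRing.scale /=.
  have -> : h^-1 * (F (h + t) - F t) - G t = h^-1 * (F (h + t) - F t - h * G t).
    by field.
  by rewrite normrM normfV mulrC ler_pdivrMr ?normr_gt0// .
apply: DeriveDef.
  by apply/cvg_ex; exists (G t).
exact: cvg_lim.
Unshelve. all: by end_near.
Qed.

End LimitDerivative.

Lemma cvg_pow (R : realType) (u : nat -> R) (l : R) k :
  u @ \oo --> l -> u n ^+ k @[n --> \oo] --> l ^+ k.
Proof.
move=> ul; elim: k => [|k ih]; first by under eq_fun do rewrite expr0; exact: cvg_cst.
by rewrite exprS; under eq_fun do rewrite exprS; exact: cvgM.
Qed.

Lemma cvg_abs_le (R : realType) (u : nat -> R) (l C : R) :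
  (forall n, `|u n| <= C) -> u @ \oo --> l -> `|l| <= C.
Proof.
move=> uC ul; apply: (closed_cvg (fun y => y <= C) _ _ _ (cvg_norm ul)).
  exact: closed_le.
by apply: nearW => n; exact: uC.
Qed.

(** * A bounded trigonometric approximation of the exponential *)

Section Phi.
Context (R : realType).
Variable k : nat.

(** The shift by 2 keeps [kap] at most 1/2, hence 1 + psin x in [1/2, 3/2]; the exponent satisfies
    knum kap^2 = 1, so knum psin x is close to x. *)
Definition kap : R := (k.+2%:R)^-1.
Definition psin (x : R) : R := kap * sin (kap * x).
Definition knum : nat := (k.+2 ^ 2)%N.
Definition phi (x : R) : R := (1 + psin x) ^+ knum.
(** [rr1] and [rr2] are phi'/phi and phi''/phi, in the shape delivered by [tmult_pow]. *)
Definition rr1 (x : R) : R := knum%:R * (kap * (kap * cos (kap * x))) / (1 + psin x).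
Definition rr2 (x : R) : R :=
  knum%:R * (knum%:R - 1) * (kap * (kap * cos (kap * x))) ^+ 2 / (1 + psin x) ^+ 2
  + knum%:R * (kap * (- kap ^+ 2 * sin (kap * x))) / (1 + psin x).

Lemma kap_gt0 : 0 < kap. Proof. by rewrite invr_gt0. Qed.

Lemma kap_le : kap <= 2^-1.
Proof. by rewrite lef_pV2 ?posrE// ler_nat. Qed.

Lemma kap_neq0 : kap != 0. Proof. by rewrite gt_eqF// kap_gt0. Qed.

Lemma knum_kap : knum%:R = kap^-1 ^+ 2.
Proof. by rewrite /kap invrK /knum natrX. Qed.

Lemma knumE : knum%:R * (kap * kap) = 1.
Proof. by rewrite knum_kap; field; exact: kap_neq0. Qed.

Lemma psin_bound x : `|psin x| <= 2^-1.
Proof.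
rewrite normrM (gtr0_norm kap_gt0) -[leRHS]mulr1.
by rewrite ler_pM ?(ltW kap_gt0)// ?kap_le ?sin_max.
Qed.

Lemma opsin_bound x : 2^-1 <= 1 + psin x <= 3 / 2.
Proof. by have := psin_bound x; rewrite ler_norml; lra. Qed.

Lemma opsin_gt0 x : 0 < 1 + psin x.
Proof. by have := opsin_bound x; lra. Qed.

Lemma phi_gt0 x : 0 < phi x.
Proof. by rewrite exprn_gt0// opsin_gt0. Qed.

Lemma phi_bound x : (2^-1) ^+ knum <= phi x <= (3 / 2) ^+ knum.
Proof.
have := opsin_bound x => /andP[h1 h2]; have h0 := opsin_gt0 x.
by rewrite !lerXn2r// nnegrE; lra.
Qed.

Lemma rr1E x : rr1 x = cos (kap * x) / (1 + psin x).
Proof.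
rewrite /rr1; have -> : knum%:R * (kap * (kap * cos (kap * x))) =
  (knum%:R * (kap * kap)) * cos (kap * x) by ring.
by rewrite knumE mul1r.
Qed.

Lemma rr2E x : rr2 x = (1 - kap ^+ 2) * rr1 x ^+ 2 - psin x / (1 + psin x).
Proof.
have h := opsin_gt0 x; have h' : 1 + psin x != 0 by rewrite gt_eqF.
have k0 := kap_neq0.
have e1 : knum%:R * (kap * (- kap ^+ 2 * sin (kap * x))) = - psin x.
  by rewrite knum_kap /psin; field; exact: k0.
have e2 : knum%:R * (knum%:R - 1) * (kap * (kap * cos (kap * x))) ^+ 2 =
    (1 - kap ^+ 2) * cos (kap * x) ^+ 2.
  by rewrite knum_kap; field; exact: k0.
rewrite /rr2 e1 e2 rr1E; move: (psin x) h' => p h'.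
by field; exact: h'.
Qed.

(** Here and in [rr2_bound] nothing depends on k, in contrast to [phi_bound]: this is what dominates
    the generators along the approximation. *)
Lemma rr1_bound x : `|rr1 x| <= 2.
Proof.
rewrite rr1E normrM normfV (gtr0_norm (opsin_gt0 x)) ler_pdivrMr ?opsin_gt0//.
by have := cos_max (kap * x); have := opsin_bound x; lra.
Qed.

Lemma rr2_bound x : `|rr2 x| <= 5.
Proof.
rewrite rr2E (le_trans (ler_normB _ _))//.
have h1 : `|(1 - kap ^+ 2) * rr1 x ^+ 2| <= 4.
  rewrite normrM normrX; have := rr1_bound x; have := normr_ge0 (rr1 x).
  have k1 := kap_gt0; have k2 := kap_le.
  have -> : `|1 - kap ^+ 2| = 1 - kap ^+ 2 by rewrite ger0_norm//; nra.
  by move=> r0 r2; have : 0 <= 1 - kap ^+ 2 <= 1 by [nra]; nra.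
have h2 : `|psin x / (1 + psin x)| <= 1.
  rewrite normrM normfV (gtr0_norm (opsin_gt0 x)) ler_pdivrMr ?opsin_gt0//.
  by have := psin_bound x; have := opsin_bound x; lra.
by lra.
Qed.

Lemma cont_kapM : continuous (fun x : R => kap * x).
Proof. by move=> x; apply: cvgM; [exact: cvg_cst|exact: cvg_id]. Qed.

Lemma cont_psin : continuous psin.
Proof.
move=> x; apply: cvgM; first exact: cvg_cst.
apply: (cvg_comp (fun x => kap * x) sin); first exact: cont_kapM.
exact: continuous_sin.
Qed.

Lemma cont_opsin : continuous (fun x => 1 + psin x).
Proof. by move=> x; apply: cvgD; [exact: cvg_cst|exact: cont_psin]. Qed.

Lemma cont_rr1 : continuous rr1.
Proof.
move=> x; rewrite (_ : rr1 = fun x => cos (kap * x) / (1 + psin x)).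
  apply: cvgM.
    apply: (cvg_comp (fun x => kap * x) cos); first exact: cont_kapM.
    exact: continuous_cos.
  by apply: cvgV; [rewrite gt_eqF// opsin_gt0|exact: cont_opsin].
by apply/funext => y; exact: rr1E.
Qed.

Lemma bm_phi : bm phi.
Proof.
split; last by exists ((3 / 2) ^+ knum) => x; rewrite gtr0_norm ?phi_gt0//; case/andP: (phi_bound x).
apply: measurable_funX; exact: (continuous_measurable_fun cont_opsin).
Qed.

Lemma bm_rr1 : bm rr1.
Proof.
by split; [exact: (continuous_measurable_fun cont_rr1)|exists 2; exact: rr1_bound].
Qed.

Lemma bm_rr2 : bm rr2.
Proof.
split; last by exists 5; exact: rr2_bound.
rewrite (_ : rr2 = fun x => (1 - kap ^+ 2) * rr1 x ^+ 2 - psin x / (1 + psin x)).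
  apply: measurable_funB.
    by apply: measurable_funM => //; apply: measurable_funX; exact: (bm_rr1).1.
  apply: continuous_measurable_fun => x; apply: cvgM; first exact: cont_psin.
  by apply: cvgV; [rewrite gt_eqF// opsin_gt0|exact: cont_opsin].
by apply/funext => y; exact: rr2E.
Qed.

Lemma phi_tmult d (T : measurableType d) (m1 : T -> R) (U : T -> T -> R) :
  (forall x y, U x y = U y x) ->
  tmult m1 U phi (fun x => phi x * rr1 x) (fun x => phi x * rr2 x).
Proof.
move=> Us; apply: (@tmult_pow R d T m1 U Us kap kap knum) => x.
by rewrite gt_eqF// opsin_gt0.
Qed.

Lemma phi_sandwich x :
  expR (knum%:R * psin x - 2 * knum%:R * psin x ^+ 2) <= phi x <= expR (knum%:R * psin x).
Proof.
have h := psin_bound x; rewrite ler_norml in h.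
have h0 := opsin_gt0 x.
have e1 : 1 + psin x <= expR (psin x) by exact: expR_ge1Dx.
(* (1 - y + 2 y^2)(1 + y) = 1 + y^2 (1 + 2 y) is at least 1 for y >= -1/2. *)
have e2 : expR (psin x - 2 * psin x ^+ 2) <= 1 + psin x.
  have := expR_ge1Dx (- (psin x - 2 * psin x ^+ 2)).
  rewrite expRN => h2; rewrite -lef_pV2 ?posrE ?expR_gt0//.
  apply: le_trans h2.
  rewrite -(ler_pM2r h0) mulVf ?gt_eqF//.
  have : 0 <= psin x ^+ 2 * (1 + 2 * psin x) by apply: mulr_ge0; [exact: sqr_ge0|lra].
  by nra.
rewrite /phi; apply/andP; split.
  rewrite (_ : _ - _ = (psin x - 2 * psin x ^+ 2) * knum%:R); last by ring.
  by rewrite expRM_natr lerXn2r// ?nnegrE ?expR_ge0// ltW.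
by rewrite mulrC expRM_natr lerXn2r// ?nnegrE ?expR_ge0// ltW.
Qed.

Lemma sin_mvt (z : R) : exists2 c, `|c| <= `|z| & sin z = z * cos c.
Proof.
have cs (a b : R) : {within `[a, b], continuous (@sin R)}.
  by apply: continuous_subspaceT; exact: continuous_sin.
have ds (x : R) : is_derive x 1 (@sin R) (cos x) by exact: is_derive_sin.
have [z0|z0|->] := ltgtP z 0.
- have [c] := MVT z0 (fun x _ => ds x) (cs z 0).
  rewrite in_itv /= sin0 => /andP[zc c0] E; exists c.
    by rewrite !ltr0_norm// lerN2 ltW.
  by move: E; rewrite !sub0r mulrN => /oppr_inj ->; rewrite mulrC.
- have [c] := MVT z0 (fun x _ => ds x) (cs 0 z).
  rewrite in_itv /= sin0 !subr0 => /andP[c0 cz] E; exists c.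
    by rewrite !gtr0_norm// ltW.
  by rewrite E mulrC.
- by exists 0 => //; rewrite sin0 mul0r.
Qed.

Lemma knum_psin x : exists2 c, `|c| <= kap * `|x| & knum%:R * psin x = x * cos c.
Proof.
have [c hc E] := sin_mvt (kap * x); exists c.
  by rewrite -{1}(gtr0_norm kap_gt0) -normrM.
rewrite /psin E; have -> : knum%:R * (kap * (kap * x * cos c)) =
  knum%:R * (kap * kap) * (x * cos c) by ring.
by rewrite knumE mul1r.
Qed.

(** Uniform in k, since knum psin x = x cos c: on a bounded path it dominates all stages at once. *)
Lemma phi_le x : phi x <= expR `|x|.
Proof.
have /andP[_ /le_trans] := phi_sandwich x; apply; rewrite ler_expR.
have [c _ ->] := knum_psin x.
rewrite (le_trans (ler_norm _))// normrM -[leRHS]mulr1 ler_pM//.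
exact: cos_max.
Qed.

End Phi.

(** * Limits of the approximate weights along moving arguments and stages *)

Section PhiLimit.
Context (R : realType).
Variables (sg : nat -> nat) (xn : nat -> R) (x : R).
Hypothesis sgP : forall n, (n <= sg n)%N.
Hypothesis xnx : xn @ \oo --> x.

Lemma kap0 : kap R (sg n) @[n --> \oo] --> 0.
Proof.
have h : (n.+1%:R : R)^-1 @[n --> \oo] --> 0 by exact: cvg_harmonic.
apply: (squeeze_cvgr _ (cvg_cst 0) h); near=> n.
rewrite ltW ?kap_gt0//= lef_pV2 ?posrE// ler_nat ltnS.
by rewrite (leq_trans (sgP n))// leqW.
Unshelve. all: by end_near.
Qed.

Lemma kapx0 : kap R (sg n) * xn n @[n --> \oo] --> 0.
Proof. by rewrite -(mul0r x); apply: cvgM => //; exact: kap0. Qed.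

Lemma psin0 : psin (sg n) (xn n) @[n --> \oo] --> 0.
Proof.
rewrite -(mul0r (sin (0 : R))); apply: cvgM; first exact: kap0.
by apply: (cvg_comp (fun n => kap R (sg n) * xn n) sin); [exact: kapx0|exact: continuous_sin].
Qed.

Lemma rr1_cvg : rr1 (sg n) (xn n) @[n --> \oo] --> (1 : R).
Proof.
under eq_fun do rewrite rr1E.
have -> : nbhs (1 : R) = nbhs (cos 0 / (1 + 0) : R) by rewrite cos0 addr0 divr1.
apply: cvgM.
  by apply: (cvg_comp (fun n => kap R (sg n) * xn n) cos); [exact: kapx0|exact: continuous_cos].
by apply: cvgV; [rewrite addr0 oner_eq0|apply: cvgD; [exact: cvg_cst|exact: psin0]].
Qed.

Lemma rr2_cvg : rr2 (sg n) (xn n) @[n --> \oo] --> (1 : R).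
Proof.
under eq_fun do rewrite rr2E.
have -> : nbhs (1 : R) = nbhs ((1 - 0 ^+ 2) * 1 ^+ 2 - 0 / (1 + 0) : R).
  by rewrite expr0n expr1n /= subr0 mulr1 mul0r subr0.
apply: cvgB; last first.
  apply: cvgM; first exact: psin0.
  by apply: cvgV; [rewrite addr0 oner_eq0|apply: cvgD; [exact: cvg_cst|exact: psin0]].
apply: cvgM; last by apply: cvg_pow; exact: rr1_cvg.
by apply: cvgB; [exact: cvg_cst|apply: cvg_pow; exact: kap0].
Qed.

(** By [phi_sandwich] it suffices that knum psin tends to x, which is the mean value form of the
    sine, and that knum psin^2 = (knum psin) psin tends to 0. *)
Lemma phi_cvg : phi (sg n) (xn n) @[n --> \oo] --> expR x.
Proof.
have hx n : exists c, `|c| <= kap R (sg n) * `|xn n| /\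
    (knum (sg n))%:R * psin (sg n) (xn n) = xn n * cos c.
  by have [c h1 h2] := knum_psin (sg n) (xn n); exists c.
have [c hc] := choice hx.
have c0 : c @ \oo --> (0 : R).
  apply: norm_cvg0.
  have h : kap R (sg n) * `|xn n| @[n --> \oo] --> (0 : R).
    by rewrite -(mul0r `|x|); apply: cvgM; [exact: kap0|exact: cvg_norm].
  apply: (squeeze_cvgr _ (cvg_cst 0) h); apply: nearW => n.
  by rewrite normr_ge0; have [] := hc n.
have yx : (knum (sg n))%:R * psin (sg n) (xn n) @[n --> \oo] --> x.
  under eq_fun => n do rewrite (hc n).2.
  rewrite -{1}(mulr1 x) -[X in x * X](@cos0 R); apply: cvgM => //.
  by apply: (cvg_comp c cos c0); exact: continuous_cos.
have h1 : expR ((knum (sg n))%:R * psin (sg n) (xn n)) @[n --> \oo] --> expR x.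
  exact: (cvg_comp _ expR yx (@continuous_expR R x)).
have h2 : expR ((knum (sg n))%:R * psin (sg n) (xn n) -
    2 * (knum (sg n))%:R * psin (sg n) (xn n) ^+ 2) @[n --> \oo] --> expR x.
  have h3 : (knum (sg n))%:R * psin (sg n) (xn n) -
    2 * (knum (sg n))%:R * psin (sg n) (xn n) ^+ 2 @[n --> \oo] --> x.
    have h4 : (knum (sg n))%:R * psin (sg n) (xn n) -
       2 * (((knum (sg n))%:R * psin (sg n) (xn n)) * psin (sg n) (xn n))
         @[n --> \oo] --> x - 2 * (x * 0).
      apply: cvgB => //; apply: cvgM; first exact: cvg_cst.
      by apply: cvgM => //; exact: psin0.
    move: h4; rewrite !mulr0 subr0; apply: cvg_trans.
    by apply: near_eq_cvg; apply: nearW => n; ring.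
  exact: (cvg_comp _ expR h3 (@continuous_expR R x)).
apply: (squeeze_cvgr _ h2 h1); apply: nearW => n; exact: phi_sandwich.
Qed.

End PhiLimit.

Lemma cvg_sumseq (R : realType) (T : Type) (s : seq T) (F : nat -> T -> R) (G : T -> R) :
  (forall y, F ^~ y @ \oo --> G y) ->
  \sum_(y <- s) F n y @[n --> \oo] --> \sum_(y <- s) G y.
Proof.
move=> FG; elim: s => [|y s ih].
  by rewrite big_nil; under eq_fun do rewrite big_nil; exact: cvg_cst.
by rewrite big_cons; under eq_fun do rewrite big_cons; exact: cvgD.
Qed.

Lemma cvg_prodseq (R : realType) (T : Type) (s : seq T) (F : nat -> T -> R) (G : T -> R) :
  (forall y, F ^~ y @ \oo --> G y) ->
  \prod_(y <- s) F n y @[n --> \oo] --> \prod_(y <- s) G y.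
Proof.
move=> FG; elim: s => [|y s ih].
  by rewrite big_nil; under eq_fun do rewrite big_nil; exact: cvg_cst.
by rewrite big_cons; under eq_fun do rewrite big_cons; exact: cvgM.
Qed.

(** * Bounds in powers of the partition function, and limits at fixed disorder *)

Section PathBounds.
Context (R : realType) d (T : measurableType d) (lam : probability T R).
Variables (m1 : T -> R) (U : T -> T -> R).
Variables (Cm CU : R).
Hypothesis bm1 : bm m1.
Hypothesis bU : bm (fun z : T * T => U z.1 z.2).
Hypothesis m1C : forall y, `|m1 y| <= Cm.
Hypothesis UC : forall x y, `|U x y| <= CU.

Variables a b1 b2 : T -> R.
Hypotheses (ba : bm a) (bb1 : bm b1) (bb2 : bm b2).
Hypothesis a0 : forall y, 0 <= a y.
Hypothesis b1C : forall y, `|b1 y| <= 2.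
Hypothesis b2C : forall y, `|b2 y| <= 5.

Let Tn := Tq lam a.

Lemma E_Wt n : \int[pw lam n]_s Wt a s = Tn ^+ n.
Proof.
elim: n => [|n ih]; first by rewrite E_pw0 /Wt big_nil expr0.
rewrite (E_pwS lam (bm_Wt ba n.+1)).
under eq_Rintegral => x _.
  under eq_Rintegral do rewrite Wt_cons.
  rewrite EZl ?ih; last exact: bm_Wt.
  over.
by rewrite EZr// exprS.
Qed.

Lemma Wt_ge0 s : 0 <= Wt a s.
Proof. by apply: prodr_ge0. Qed.

Lemma al_bound : `|al lam m1 U a b1 b2| <= (Cm * 2 + CU * 5) * Tn.
Proof.
rewrite -EZl//; apply: E_norm_le.
- apply: bmM => //; apply: bmD; apply: bmM => //; exact: bm_Ud.
- exact: bmZ.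
- move=> y; rewrite normrM ger0_norm// mulrC ler_wpM2r//.
  by rewrite (le_trans (ler_normD _ _))// !normrM lerD// ler_pM.
Qed.

Lemma iU_bound y : `|\int[lam]_x (U y x * (a x * b1 x))| <= CU * 2 * Tn.
Proof.
rewrite -EZl//; apply: E_norm_le.
- exact: (bm_fst y (bm_Uab bU ba bb1)).
- exact: bmZ.
- move=> x; rewrite !normrM (ger0_norm (a0 x)) -mulrA [2 * _]mulrC.
  by rewrite ler_pM ?mulr_ge0 ?ler_wpM2l.
Qed.

Lemma ga_bound : `|ga lam U a b1| <= CU * 4 * Tn ^+ 2.
Proof.
rewrite expr2 mulrA -EZl//; apply: E_norm_le.
- by apply: bmM; [exact: bmM|exact: bm_iU].
- exact: bmZ.
- move=> y; rewrite !normrM (ger0_norm (a0 y)) -mulrA.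
  have h1 := iU_bound y; have h2 := b1C y; have h3 := a0 y.
  have h := ler_pM (normr_ge0 _) (normr_ge0 _) h2 h1.
  apply: le_trans (ler_wpM2l h3 h) _.
  by rewrite le_eqVlt; apply/orP; left; apply/eqP; ring.
Qed.

Lemma ell_bound s : `|ell lam U a b1 s| <= (size s)%:R * (4 * CU * Tn).
Proof.
rewrite (ellE lam bU ba bb1); apply: sum_bound => y; rewrite normrM.
apply: le_trans (ler_pM (normr_ge0 _) (normr_ge0 _) (b1C y) (iU_bound y)) _.
by rewrite le_eqVlt; apply/orP; left; apply/eqP; ring.
Qed.

Variables (n : nat) (f : n.-tuple T -> R) (Cf : R).
Hypothesis bf : bm f.
Hypothesis fC : forall s, `|f s| <= Cf.

(** [Wt] is nonnegative with integral Tn^n, so bounded factors cost only their bound; measured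
    against Tn^n, nothing depends on the field. *)
Lemma iW_bound (G : n.-tuple T -> R) C : bm G -> (forall s, `|G s| <= C) ->
  `|\int[pw lam n]_s (f s * (Wt a s * G s))| <= Cf * C * Tn ^+ n.
Proof.
move=> bG GC; rewrite -E_Wt -EZl; last exact: bm_Wt.
apply: E_norm_le.
- by apply: bmM => //; apply: bmM => //; exact: bm_Wt.
- by apply: bmZ; exact: bm_Wt.
- move=> s; rewrite !normrM (ger0_norm (Wt_ge0 s)) -mulrA [_ * Wt a s]mulrC.
  by rewrite ler_pM ?mulr_ge0 ?Wt_ge0// ler_wpM2l ?Wt_ge0.
Qed.

End PathBounds.

Section PathLimits.
Context (R : realType) d (T : measurableType d) (lam : probability T R).
Variables (m1 : T -> R) (U : T -> T -> R).
Hypothesis bm1 : bm m1.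
Hypothesis bU : bm (fun z : T * T => U z.1 z.2).
Variables an b1n b2n : nat -> T -> R.
Variables a b1 b2 : T -> R.
Variable A : R.
Hypothesis anC : forall n y, `|an n y| <= A.
Hypothesis b1nC : forall n y, `|b1n n y| <= 2.
Hypothesis b2nC : forall n y, `|b2n n y| <= 5.
Hypothesis man : forall n, measurable_fun setT (an n).
Hypothesis mb1n : forall n, measurable_fun setT (b1n n).
Hypothesis mb2n : forall n, measurable_fun setT (b2n n).
Hypothesis ana : forall y, an ^~ y @ \oo --> a y.
Hypothesis b1nb1 : forall y, b1n ^~ y @ \oo --> b1 y.
Hypothesis b2nb2 : forall y, b2n ^~ y @ \oo --> b2 y.

Let ban n : bm (an n). Proof. by split; [exact: man|exists A]. Qed.
Let bb1n n : bm (b1n n). Proof. by split; [exact: mb1n|exists 2]. Qed.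
Let bb2n n : bm (b2n n). Proof. by split; [exact: mb2n|exists 5]. Qed.

Lemma Tq_cvg : Tq lam (an n) @[n --> \oo] --> Tq lam a.
Proof. exact: (@E_cvg _ _ _ lam _ _ A). Qed.

Lemma al_cvg : al lam m1 U (an n) (b1n n) (b2n n) @[n --> \oo] --> al lam m1 U a b1 b2.
Proof.
have [_ [Cm hm]] := bm1; have [_ [CU hU]] := bU.
apply: (@E_cvg _ _ _ lam _ _ (A * (Cm * 2 + CU * 5))).
- move=> n; have [] : bm (fun y => an n y * (m1 y * b1n n y + U y y * b2n n y)) => //.
  by apply: bmM => //; apply: bmD; apply: bmM => //; exact: bm_Ud.
- move=> n y; rewrite normrM ler_pM//.
  rewrite (le_trans (ler_normD _ _))// !normrM lerD// ler_pM//.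
  exact: (hU (y, y)).
- move=> y; apply: cvgM => //; apply: cvgD; apply: cvgM => //; exact: cvg_cst.
Qed.

Lemma iU_cvg y : \int[lam]_x (U y x * (an n x * b1n n x)) @[n --> \oo] -->
  \int[lam]_x (U y x * (a x * b1 x)).
Proof.
have [_ [CU hU]] := bU.
apply: (@E_cvg _ _ _ lam _ _ (CU * (A * 2))).
- by move=> n; have [] := bm_fst y (bm_Uab bU (ban n) (bb1n n)).
- by move=> n x; rewrite !normrM ler_pM ?mulr_ge0 ?ler_pM//; exact: (hU (y, x)).
- by move=> x; apply: cvgM; [exact: cvg_cst|exact: cvgM].
Qed.

Lemma iUn_bound : exists C, forall n y,
  `|\int[lam]_x (U y x * (an n x * b1n n x))| <= C.
Proof.
have [_ [CU hU]] := bU; exists (CU * (A * 2)) => n y; apply: E_bound.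
  exact: bm_fst y (bm_Uab bU (ban n) (bb1n n)).
by move=> x; rewrite !normrM ler_pM ?mulr_ge0 ?ler_pM//; exact: (hU (y, x)).
Qed.

Lemma ga_cvg : ga lam U (an n) (b1n n) @[n --> \oo] --> ga lam U a b1.
Proof.
have [C hC] := iUn_bound.
apply: (@E_cvg _ _ _ lam _ _ (A * 2 * C)).
- move=> n; have [] // : bm (fun y => an n y * b1n n y *
     \int[lam]_x (U y x * (an n x * b1n n x))).
  by apply: bmM; [exact: bmM|exact: bm_iU].
- by move=> n x; rewrite !normrM ler_pM ?mulr_ge0 ?ler_pM.
- by move=> y; apply: cvgM; [exact: cvgM|exact: iU_cvg].
Qed.

Lemma Wt_cvg s : Wt (an n) s @[n --> \oo] --> Wt a s.
Proof. exact: cvg_prodseq. Qed.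

Lemma ell_cvg s : ell lam U (an n) (b1n n) s @[n --> \oo] --> ell lam U a b1 s.
Proof.
have e n : ell lam U (an n) (b1n n) s =
    \sum_(y <- s) b1n n y * \int[lam]_x (U y x * (an n x * b1n n x)).
  exact: ellE.
under eq_fun do rewrite e.
have aA y : `|a y| <= A.
  by apply: (cvg_abs_le (anC ^~ y)) => //; exact: ana.
have b1A y : `|b1 y| <= 2.
  by apply: (cvg_abs_le (b1nC ^~ y)) => //; exact: b1nb1.
have ba : bm a.
  by split; [apply: measurable_fun_cvg man _ => y _ //|exists A].
have bb1 : bm b1.
  by split; [apply: measurable_fun_cvg mb1n _ => y _ //|exists 2].
rewrite (ellE lam bU ba bb1).
by apply: cvg_sumseq => y; apply: cvgM => //; exact: iU_cvg.
Qed.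

Lemma dd_cvg s : dd m1 U (b1n n) (b2n n) s @[n --> \oo] --> dd m1 U b1 b2 s.
Proof.
apply: cvgD.
  apply: cvg_sumseq => y; apply: cvgD; apply: cvgM => //; try exact: cvg_cst.
  by apply: cvgB => //; exact: cvg_pow.
apply: cvg_sumseq => y; apply: cvg_sumseq => x.
by apply: cvgM => //; apply: cvgM => //; exact: cvg_cst.
Qed.

Variables (n : nat) (f : n.-tuple T -> R).
Hypothesis bf : bm f.

Lemma iW_cvg (Gn : nat -> n.-tuple T -> R) (G : n.-tuple T -> R) C :
  (forall k, bm (Gn k)) -> (forall k s, `|Gn k s| <= C) ->
  (forall s, Gn ^~ s @ \oo --> G s) ->
  \int[pw lam n]_s (f s * (Wt (an k) s * Gn k s)) @[k --> \oo] -->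
  \int[pw lam n]_s (f s * (Wt a s * G s)).
Proof.
move=> bG GC GG; have [_ [Cf hf]] := bf.
apply: (@E_cvg _ _ _ (pw lam n) _ _ (Cf * (A ^+ n * C))).
- move=> k; have [] // : bm (fun s : n.-tuple T => f s * (Wt (an k) s * Gn k s)).
  by apply: bmM => //; apply: bmM => //; exact: bm_Wt.
- move=> k s; rewrite !normrM ler_pM ?mulr_ge0 ?ler_pM//.
  by rewrite -[n in leRHS](size_tuple s); exact: prod_bound.
- move=> s; apply: cvgM; first exact: cvg_cst.
  by apply: cvgM => //; exact: Wt_cvg.
Qed.

End PathLimits.

Section QReal.
Context (R : realType) (n : nat).

Lemma approx_cvg (u h : nat -> R) (l : R) : (forall k, `|u k - l| <= h k) ->
  h @ \oo --> (0 : R) -> u @ \oo --> l.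
Proof.
move=> ul h0; apply/cvgrPdist_le => e e0.
move/cvgr0_norm_le : h0 => /(_ _ e0); apply: filterS => k hk.
rewrite distrC (le_trans (ul k))//; exact: le_trans (ler_norm _) hk.
Qed.

(** Each product p A is regrouped as (T^m p)(A / T^m), whose first factor tends to 1, -n or
    n(n+1). *)
Lemma Q_cvg (Tn Dn En Gn p0 p1 p2 h : nat -> R) (Z D E G : R) :
  (forall k, 0 < Tn k) -> 0 < Z -> Tn @ \oo --> Z -> Dn @ \oo --> D ->
  En @ \oo --> E -> Gn @ \oo --> G ->
  (forall k, `|Tn k ^+ n * p0 k - 1| <= h k) ->
  (forall k, `|Tn k ^+ n.+1 * p1 k + n%:R| <= h k) ->
  (forall k, `|Tn k ^+ n.+2 * p2 k - n%:R * n.+1%:R| <= h k) ->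
  h @ \oo --> (0 : R) ->
  p0 k * Dn k + p1 k * En k + p2 k * Gn k @[k --> \oo] -->
  D / Z ^+ n - n%:R * (E / Z ^+ n.+1) + n%:R * n.+1%:R * (G / Z ^+ n.+2).
Proof.
move=> T0 Z0 TZ DD EE GG h0 h1 h2 hh.
have Tn0 k m : Tn k ^+ m != 0 by rewrite expf_neq0// gt_eqF.
have inv m (An : nat -> R) (A : R) : An @ \oo --> A ->
    An k / Tn k ^+ m @[k --> \oo] --> A / Z ^+ m.
  move=> AA; apply: cvgM => //; apply: cvgV; first by rewrite expf_neq0// gt_eqF.
  exact: cvg_pow.
have c0 := approx_cvg h0 hh.
have h1' k : `|Tn k ^+ n.+1 * p1 k - - n%:R| <= h k by rewrite opprK.
have c1 := approx_cvg h1' hh.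
have c2 := approx_cvg h2 hh.
have e m k p A : p * A = Tn k ^+ m * p * (A / Tn k ^+ m).
  by field; exact: Tn0.
have -> : (fun k => p0 k * Dn k + p1 k * En k + p2 k * Gn k) = (fun k =>
    Tn k ^+ n * p0 k * (Dn k / Tn k ^+ n) + Tn k ^+ n.+1 * p1 k * (En k / Tn k ^+ n.+1)
    + Tn k ^+ n.+2 * p2 k * (Gn k / Tn k ^+ n.+2)).
  by apply/funext => k; rewrite -!e.
have -> : nbhs (D / Z ^+ n - n%:R * (E / Z ^+ n.+1) + n%:R * n.+1%:R * (G / Z ^+ n.+2)) =
    nbhs (1 * (D / Z ^+ n) + (- n%:R) * (E / Z ^+ n.+1) + n%:R * n.+1%:R * (G / Z ^+ n.+2)).
  by rewrite mul1r mulNr.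
apply: cvgD; last by apply: cvgM; [exact: c2|exact: inv].
by apply: cvgD; apply: cvgM; [exact: c0|exact: inv|exact: c1|exact: inv].
Qed.

(** The same regrouping cancels all powers of [T]: the bound is independent of the disorder, as
    dominated convergence over the disorder requires. *)
Lemma Q_bound (T D E G p0 p1 p2 CD CE CG : R) : 0 < T ->
  `|T ^+ n * p0 - 1| <= 1 -> `|T ^+ n.+1 * p1 + n%:R| <= 1 ->
  `|T ^+ n.+2 * p2 - n%:R * n.+1%:R| <= 1 ->
  `|D| <= CD * T ^+ n -> `|E| <= CE * T ^+ n.+1 -> `|G| <= CG * T ^+ n.+2 ->
  `|p0 * D + p1 * E + p2 * G| <= 2 * CD + (n%:R + 1) * CE + (n%:R * n.+1%:R + 1) * CG.
Proof.
move=> T0 h0 h1 h2 hD hE hG.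
have key m p A C c : `|T ^+ m * p| <= c -> `|A| <= C * T ^+ m -> `|p * A| <= c * C.
  move=> hp hA; have Tm : 0 < T ^+ m by exact: exprn_gt0.
  have -> : p * A = (T ^+ m * p) * (A / T ^+ m) by field; rewrite gt_eqF.
  by rewrite normrM ler_pM// normrM normfV (gtr0_norm Tm) ler_pdivrMr.
rewrite (le_trans (ler_normD _ _))// lerD//.
  rewrite (le_trans (ler_normD _ _))// lerD//.
    apply: key hD; move: h0; rewrite !ler_norml; lra.
  apply: key hE; have n0 : 0 <= n%:R :> R by [].
  by move: h1; rewrite !ler_norml; lra.
apply: key hG; have n0 : 0 <= n%:R * n.+1%:R :> R by exact: mulr_ge0.
by move: h2; rewrite !ler_norml; lra.
Qed.

End QReal.

(** * Derivative of a replica average along an abstract Gaussian interpolation *)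

Section Interpolation.
Context (R : realType) d (T : measurableType d) (lam : probability T R).
Context d' (Om : measurableType d') (P : probability Om R).
Variables (m1 : T -> R) (U : T -> T -> R) (X : R -> Om -> T -> R).
Hypothesis bm1 : bm m1.
Hypothesis bU : bm (fun z : T * T => U z.1 z.2).
Hypothesis Usym : forall x y, U x y = U y x.
Hypothesis mX : forall t : R, 0 < t < 1 ->
  measurable_fun setT (fun z : Om * T => X t z.1 z.2).
Hypothesis field_cos : forall cs, exists V0 M0 : R, forall al t : R, 0 < t < 1 ->
  \int[P]_w cos (al + lin (X t w) cs) =
  expR (- (V0 + t * qf U cs)) * cos (al + (M0 + t * lin m1 cs)).
Hypothesis X_bounded : forall w, exists B, forall (t : R) x, 0 < t < 1 -> `|X t w x| <= B.
Hypothesis X_cont : forall w x (t : R), 0 < t < 1 -> {for t, continuous (fun s => X s w x)}.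

Variables (n : nat) (f : n.-tuple T -> R).
Hypothesis bf : bm f.

(** The exponential equals its first two derivatives, so both logarithmic derivatives are 1 in the
    limit. *)
Let one (x : R) : R := 1.

Definition gW t w := iW lam X expR f t w.
Definition gD t w := iD lam m1 U X expR one one f t w.
Definition gL t w := iL lam U X expR one f t w.
Definition gZ t w := iT lam X expR t w.
Definition gA t w := iA lam m1 U X expR one one t w.
Definition gG t w := iG lam U X expR one t w.

(** The heat operator applied to W / Z^n: [Qp] with the polynomial replaced by x^-n. *)
Definition gQ t w := gD t w / gZ t w ^+ n
  - n%:R * ((gA t w * gW t w + 2 * gL t w) / gZ t w ^+ n.+1)
  + n%:R * n.+1%:R * (gG t w * gW t w / gZ t w ^+ n.+2).

Section Seq.
Variables (tn : nat -> R) (sg : nat -> nat) (t : R).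
Hypothesis t01 : 0 < t < 1.
Hypothesis tn01 : forall k, 0 < tn k < 1.
Hypothesis sgP : forall k, (k <= sg k)%N.
Hypothesis tnt : tn @ \oo --> t.

Let ph k := phi (R := R) (sg k).
Let q1 k := rr1 (R := R) (sg k).
Let q2 k := rr2 (R := R) (sg k).

Section AtPoint.
Variable w : Om.

Let Xc x : X (tn k) w x @[k --> \oo] --> X t w x.
Proof. by apply: (cvg_comp tn (fun s => X s w x) tnt); exact: X_cont. Qed.

Let an k := fa X (ph k) (tn k) w.
Let b1n k := fb1 X (q1 k) (tn k) w.
Let b2n k := fb2 X (q2 k) (tn k) w.

Let mXw k : measurable_fun setT (X (tn k) w).
Proof. exact: (measurableT_comp (mX (tn01 k)) (pair1_measurable w)). Qed.

Let ban k : bm (an k). Proof. exact: bm_comp (bm_phi _ _) (mXw k). Qed.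
Let bb1n k : bm (b1n k). Proof. exact: bm_comp (bm_rr1 _ _) (mXw k). Qed.
Let bb2n k : bm (b2n k). Proof. exact: bm_comp (bm_rr2 _ _) (mXw k). Qed.

Let b1nC k y : `|b1n k y| <= 2. Proof. exact: rr1_bound. Qed.
Let b2nC k y : `|b2n k y| <= 5. Proof. exact: rr2_bound. Qed.

(** A bound depending on [w] suffices for limits under replica integrals; the expectation over [w]
    is dominated separately, through [Q_bound]. *)
Let anC : exists A, forall k y, `|an k y| <= A.
Proof.
have [B hB] := X_bounded w; exists (expR B) => k y.
rewrite gtr0_norm ?phi_gt0// (le_trans (phi_le _ _))// ler_expR.
exact: hB.
Qed.

Let a := fa X expR t w.
Let b1 := fb1 X one t w.
Let b2 := fb2 X one t w.

Let ana y : an ^~ y @ \oo --> a y.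
Proof. by apply: phi_cvg => //; exact: Xc. Qed.
Let b1nb1 y : b1n ^~ y @ \oo --> b1 y.
Proof. by apply: rr1_cvg => //; exact: Xc. Qed.
Let b2nb2 y : b2n ^~ y @ \oo --> b2 y.
Proof. by apply: rr2_cvg => //; exact: Xc. Qed.

Lemma iT_gZ : iT lam X (ph k) (tn k) w @[k --> \oo] --> gZ t w.
Proof.
have [A hA] := anC.
exact: (Tq_cvg hA (fun k => (ban k).1) ana).
Qed.

Lemma iA_gA : iA lam m1 U X (ph k) (q1 k) (q2 k) (tn k) w @[k --> \oo] --> gA t w.
Proof.
have [A hA] := anC.
exact: (al_cvg bm1 bU hA b1nC b2nC (fun k => (ban k).1) (fun k => (bb1n k).1)
  (fun k => (bb2n k).1) ana b1nb1 b2nb2).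
Qed.

Lemma iG_gG : iG lam U X (ph k) (q1 k) (tn k) w @[k --> \oo] --> gG t w.
Proof.
have [A hA] := anC.
exact: (ga_cvg bU hA b1nC (fun k => (ban k).1) (fun k => (bb1n k).1) ana b1nb1).
Qed.

Lemma iW_gW : iW lam X (ph k) f (tn k) w @[k --> \oo] --> gW t w.
Proof.
have [A hA] := anC.
have h1 (s : n.-tuple T) : (fun _ : nat => 1 : R) @ \oo --> (1 : R) by exact: cvg_cst.
have h2 (k : nat) (s : n.-tuple T) : `|1 : R| <= 1 by rewrite normr1.
have := @iW_cvg R d T lam an a A hA (fun k => (ban k).1) ana n f bf (fun _ _ => 1) (fun _ => 1) 1
  (fun k => bm_cst _ 1) h2 h1.
rewrite (_ : \int[_]_s _ = gW t w); last first.
  by apply: eq_Rintegral => s _; rewrite mulr1.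
apply: cvg_trans; apply: near_eq_cvg; apply: nearW => k.
by apply: eq_Rintegral => s _; rewrite mulr1.
Qed.

Lemma iD_gD : iD lam m1 U X (ph k) (q1 k) (q2 k) f (tn k) w @[k --> \oo] --> gD t w.
Proof.
have [A hA] := anC.
have [_ [Cm hm]] := bm1; have [_ [CU hU]] := bU.
have hd k (s : n.-tuple T) := dd_bound hm (fun x y => hU (x, y)) (b1nC k) (b2nC k) s.
apply: (iW_cvg hA (fun k => (ban k).1) ana bf (fun k => bm_dd bm1 bU (bb1n k) (bb2n k) n)).
  by move=> k s; have := hd k s; rewrite size_tuple; exact.
by move=> s; exact: (dd_cvg b1nb1 b2nb2).
Qed.

Lemma iL_gL : iL lam U X (ph k) (q1 k) f (tn k) w @[k --> \oo] --> gL t w.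
Proof.
have [A hA] := anC.
have [C hC] := iUn_bound lam bU hA b1nC (fun k => (ban k).1) (fun k => (bb1n k).1).
apply: (iW_cvg hA (fun k => (ban k).1) ana bf (fun k => bm_ell lam bU (ban k) (bb1n k) n)
  (C := n%:R * (2 * C))).
  move=> k s; rewrite (ellE lam bU (ban k) (bb1n k)) -[n in leRHS](size_tuple s).
  by apply: sum_bound => y; rewrite normrM ler_pM// ?b1nC ?hC.
move=> s; exact: (ell_cvg bU hA b1nC (fun k => (ban k).1) (fun k => (bb1n k).1) ana b1nb1).
Qed.

(** A deterministic range for the approximate partition function: it allows one polynomial per
    stage, valid for every [w] and every time. *)
Lemma iT_bounds k : (2^-1) ^+ knum (sg k) <= iT lam X (ph k) (tn k) w <= (3 / 2) ^+ knum (sg k).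
Proof.
apply/andP; split.
  rewrite -[leLHS](E_cst lam); apply: E_le; [exact: bm_cst|exact: ban|].
  by move=> x; case/andP: (phi_bound (sg k) (X (tn k) w x)).
rewrite -[leRHS](E_cst lam); apply: E_le; [exact: ban|exact: bm_cst|].
by move=> x; case/andP: (phi_bound (sg k) (X (tn k) w x)).
Qed.

Lemma gZ_gt0 : 0 < gZ t w.
Proof.
have [B hB] := X_bounded w.
apply: (@lt_le_trans _ _ (expR (- B))); first exact: expR_gt0.
have mXt : measurable_fun setT (X t w).
  exact: (measurableT_comp (mX t01) (pair1_measurable w)).
rewrite -[leLHS](E_cst lam); apply: E_le.
- exact: bm_cst.
- split; first by apply: measurableT_comp mXt; exact: measurable_expR.
  exists (expR B) => x; rewrite gtr0_norm ?expR_gt0// ler_expR.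
  by rewrite (le_trans (ler_norm _))// hB.
- move=> x; rewrite ler_expR; have := hB t x t01.
  by rewrite ler_norml => /andP[].
Qed.

End AtPoint.

Variable p_ : nat -> {poly R}.
Hypothesis hp : forall k,
  inv_approx n ((2^-1) ^+ knum k) ((3 / 2) ^+ knum k) (k.+1%:R^-1) (p_ k).

Let hsg0 : (sg k).+1%:R^-1 @[k --> \oo] --> (0 : R).
Proof.
apply: (squeeze_cvgr _ (cvg_cst 0) (@cvg_harmonic R)); apply: nearW => k.
by rewrite invr_ge0 ler0n /= lef_pV2 ?posrE// ler_nat ltnS.
Qed.

Let iT_gt0 k w : 0 < iT lam X (ph k) (tn k) w.
Proof.
by case/andP: (iT_bounds w k) => h _; apply: lt_le_trans h; exact: exprn_gt0.
Qed.

Let hs1 k : (sg k).+1%:R^-1 <= (1 : R).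
Proof. by rewrite invf_le1// ler1n. Qed.

Let bphk u (u01 : 0 < u < 1) w k : bm (fa X (ph k) u w).
Proof.
apply: bm_comp (bm_phi _ _) _.
exact: (measurableT_comp (mX u01) (pair1_measurable w)).
Qed.

Let bq1k u (u01 : 0 < u < 1) w k : bm (fb1 X (q1 k) u w).
Proof.
apply: bm_comp (bm_rr1 _ _) _.
exact: (measurableT_comp (mX u01) (pair1_measurable w)).
Qed.

Let bq2k u (u01 : 0 < u < 1) w k : bm (fb2 X (q2 k) u w).
Proof.
apply: bm_comp (bm_rr2 _ _) _.
exact: (measurableT_comp (mX u01) (pair1_measurable w)).
Qed.

Let iW_le : exists C, forall k w,
  `|iW lam X (ph k) f (tn k) w| <= C * iT lam X (ph k) (tn k) w ^+ n.
Proof.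
have [_ [Cf hf]] := bf; exists (Cf * 1) => k w.
have := @iW_bound R d T lam _ (bphk (tn01 k) w k) (fun y => ltW (phi_gt0 _ _)) n f Cf
  bf hf (fun _ => 1) 1 (bm_cst _ 1) (fun s => _).
rewrite normr1 => /(_ (fun=> lexx _)).
apply: le_trans; rewrite le_eqVlt; apply/orP; left; apply/eqP; congr `|_|.
by apply: eq_Rintegral => s _; rewrite mulr1.
Qed.

Lemma F_cvg : \int[P]_w ((p_ (sg k)).[iT lam X (ph k) (tn k) w] * iW lam X (ph k) f (tn k) w)
  @[k --> \oo] --> \int[P]_w (gW t w / gZ t w ^+ n).
Proof.
have [C hC] := iW_le.
apply: (@E_cvg _ _ _ P _ _ (2 * C)).
- move=> k; have [//] := bm_Fp lam mX (bm_phi R (sg k)) bf (tn01 k) (p_ (sg k)).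
- move=> k w; have [h0 h1 h2] := hp (iT_bounds w k).
  have := @Q_bound R n _ (iW lam X (ph k) f (tn k) w) 0 0 _ _ _ C 0 0 (iT_gt0 k w)
     (le_trans h0 (hs1 k)) (le_trans h1 (hs1 k)) (le_trans h2 (hs1 k)) (hC k w).
  by rewrite !normr0 !mul0r !mulr0 !addr0; apply.
- move=> w.
  have z0 : (fun _ : nat => 0 : R) @ \oo --> (0 : R) by exact: cvg_cst.
  have := @Q_cvg R n _ _ (fun _ => 0) (fun _ => 0)
    (fun k => (p_ (sg k)).[iT lam X (ph k) (tn k) w])
    (fun k => (p_ (sg k))^`().[iT lam X (ph k) (tn k) w])
    (fun k => (p_ (sg k))^`()^`().[iT lam X (ph k) (tn k) w])
    (fun k => (sg k).+1%:R^-1) _ _ 0 0 (iT_gt0 ^~ w) (gZ_gt0 w) (@iT_gZ w) (@iW_gW w)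
    z0 z0.
  rewrite !mul0r !mulr0 subr0 addr0.
  have h k := hp (iT_bounds w k).
  move=> /(_ (fun k => let: And3 a _ _ := h k in a) (fun k => let: And3 _ a _ := h k in a)
     (fun k => let: And3 _ _ a := h k in a) hsg0).
  apply: cvg_trans; apply: near_eq_cvg; apply: nearW => k.
  by rewrite !mulr0 !addr0.
Qed.

Lemma G_cvg : \int[P]_w Qp lam m1 U X (ph k) (q1 k) (q2 k) f (p_ (sg k)) (tn k) w
  @[k --> \oo] --> \int[P]_w gQ t w.
Proof.
have [C hC] := iW_le; have [_ [Cf hf]] := bf.
have [_ [Cm hm]] := bm1; have [_ [CU hU]] := bU.
have hU' x y : `|U x y| <= CU by exact: (hU (x, y)).
pose CD := n%:R * (Cm * 2 + CU * (5 + 2 ^+ 2)) + n%:R * (n%:R * (CU * 2 * 2)).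
pose CA := Cm * 2 + CU * 5.
pose CL := n%:R * (4 * CU).
have hD k w : `|iD lam m1 U X (ph k) (q1 k) (q2 k) f (tn k) w| <=
    Cf * CD * iT lam X (ph k) (tn k) w ^+ n.
  apply: (iW_bound lam (bphk (tn01 k) w k) (fun y => ltW (phi_gt0 _ _)) bf hf).
    exact: (bm_dd bm1 bU (bq1k (tn01 k) w k) (bq2k (tn01 k) w k)).
  move=> s; have := dd_bound hm hU' (fun y => rr1_bound (sg k) (X (tn k) w y))
    (fun y => rr2_bound (sg k) (X (tn k) w y)) s.
  by rewrite size_tuple.
have hL k w : `|iL lam U X (ph k) (q1 k) f (tn k) w| <=
    Cf * CL * iT lam X (ph k) (tn k) w ^+ n.+1.
  rewrite exprSr mulrA -[X in _ <= X]mulrA [_ * iT _ _ _ _ _]mulrC mulrA -[Cf * _ * _]mulrA.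
  apply: (iW_bound lam (bphk (tn01 k) w k) (fun y => ltW (phi_gt0 _ _)) bf hf).
    exact: (bm_ell lam bU (bphk (tn01 k) w k) (bq1k (tn01 k) w k)).
  move=> s; have := ell_bound lam bU hU' (bphk (tn01 k) w k) (bq1k (tn01 k) w k)
    (fun y => ltW (phi_gt0 _ _)) (fun y => rr1_bound (sg k) (X (tn k) w y)) s.
  by rewrite size_tuple mulrA.
have hA k w : `|iA lam m1 U X (ph k) (q1 k) (q2 k) (tn k) w| <=
    CA * iT lam X (ph k) (tn k) w.
  exact: (al_bound lam bm1 bU hm hU' (bphk (tn01 k) w k) (bq1k (tn01 k) w k)
    (bq2k (tn01 k) w k) (fun y => ltW (phi_gt0 _ _))
    (fun y => rr1_bound (sg k) (X (tn k) w y)) (fun y => rr2_bound (sg k) (X (tn k) w y))).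
have hG k w : `|iG lam U X (ph k) (q1 k) (tn k) w| <=
    CU * 4 * iT lam X (ph k) (tn k) w ^+ 2.
  exact: (ga_bound lam bU hU' (bphk (tn01 k) w k) (bq1k (tn01 k) w k)
    (fun y => ltW (phi_gt0 _ _)) (fun y => rr1_bound (sg k) (X (tn k) w y))).
apply: (@E_cvg _ _ _ P _ _ (2 * (Cf * CD) + (n%:R + 1) * (CA * C + 2 * (Cf * CL)) +
   (n%:R * n.+1%:R + 1) * (CU * 4 * C))).
- move=> k; have [//] := bm_Qp lam bm1 bU mX (bm_phi R (sg k)) (bm_rr1 R (sg k))
    (bm_rr2 R (sg k)) bf (tn01 k) (p_ (sg k)).
- move=> k w; have [h0 h1 h2] := hp (iT_bounds w k).
  apply: (Q_bound (iT_gt0 k w) (le_trans h0 (hs1 k)) (le_trans h1 (hs1 k))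
    (le_trans h2 (hs1 k)) (hD k w)).
    rewrite (le_trans (ler_normD _ _))// [in leRHS]mulrDl lerD//.
      have := ler_pM (normr_ge0 _) (normr_ge0 _) (hA k w) (hC k w).
      by rewrite -normrM exprS mulrACA.
    by rewrite normrM ger0_norm// -mulrA ler_wpM2l// hL.
  have := ler_pM (normr_ge0 _) (normr_ge0 _) (hG k w) (hC k w).
  by rewrite -normrM -[n.+2]add2n exprD mulrACA.
- move=> w; have h k := hp (iT_bounds w k).
  apply: (Q_cvg (iT_gt0 ^~ w) (gZ_gt0 w) (@iT_gZ w) (@iD_gD w) _ _
    (fun k => let: And3 a _ _ := h k in a) (fun k => let: And3 _ a _ := h k in a)
     (fun k => let: And3 _ _ a := h k in a) hsg0).
    apply: cvgD; first by apply: cvgM; [exact: iA_gA|exact: iW_gW].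
    by apply: cvgM; [exact: cvg_cst|exact: iL_gL].
  by apply: cvgM; [exact: iG_gG|exact: iW_gW].
Qed.

End Seq.

(** The k-th polynomial inverts the n-th power on the whole range of the k-th partition function,
    with relative error 1/(k+1); [heat_poly] then holds at each stage and [derive_of_ccvg] removes
    the approximation. *)
Theorem interpolation (t : R) : 0 < t < 1 ->
  is_derive t 1 (fun u => \int[P]_w (gW u w / gZ u w ^+ n)) (\int[P]_w gQ t w).
Proof.
move=> t01.
have hex k : exists p, inv_approx n ((2^-1) ^+ knum k) ((3 / 2) ^+ knum k)
    (k.+1%:R^-1 : R) p.
  apply: inv_approx_ex; [exact: exprn_gt0| |by rewrite invr_gt0].
  by rewrite lerXn2r// ?nnegrE; lra.
have [p_ hp] := choice hex.
apply: (@derive_of_ccvg R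
  (fun k u => \int[P]_w ((p_ k).[iT lam X (phi k) u w] * iW lam X (phi k) f u w))
  (fun k u => \int[P]_w Qp lam m1 U X (phi k) (rr1 k) (rr2 k) f (p_ k) u w)
  _ (fun u => \int[P]_w gQ u w) 0 1 t t01).
- move=> k s s01; apply: heat_poly => //; [exact: phi_tmult|exact: bm_phi|
    exact: bm_rr1|exact: bm_rr2].
- move=> s s01.
  exact: (@F_cvg (fun=> s) id s s01 (fun=> s01) (fun k => leqnn k) (cvg_cst s) p_ hp).
- move=> tn sg tn01 sgP tnt; exact: (@G_cvg tn sg t t01 tn01 sgP tnt p_ hp).
Qed.

End Interpolation.

(** * Induction on bounded measurable functions; laws and independence *)

Lemma step_sum (R : realType) (k : nat) (x : R) : 0 <= x ->
  (k%:R <= x -> \sum_(j < k) (j.+1%:R <= x)%R%:R = k%:R :> R) /\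
  (x < k%:R -> x - 1 < \sum_(j < k) (j.+1%:R <= x)%R%:R /\
               \sum_(j < k) (j.+1%:R <= x)%R%:R <= x).
Proof.
move=> x0; elim: k => [|k [ih1 ih2]].
  by rewrite big_ord0; split => // xlt; have := le_lt_trans x0 xlt; rewrite ltxx.
rewrite big_ord_recr /=; split=> h.
  by rewrite h ih1 ?natr1//; apply: le_trans h; rewrite ler_nat.
rewrite (lt_geF h) addr0; have [kx|xk] := leP k%:R x; last exact: ih2.
by rewrite ih1//; split => //; rewrite ltrBlDr natr1.
Qed.

Lemma cvgn_uniq (R : realType) (u v : nat -> R) (l m : R) :
  u @ \oo --> l -> v @ \oo --> m -> (forall n, u n = v n) -> l = m.
Proof. by move=> ul vm /funext uv; move: ul; rewrite uv => ul; exact: (cvg_unique _ ul vm). Qed.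

(** After an affine rescaling, 0 <= g <= 1; such a g is the uniform limit of floor((k+1) g) / (k+1),
    a finite combination of indicators of the sets where (k+1) g >= j + 1. *)
Lemma bm_elim (R : realType) d (T : measurableType d) (Q : (T -> R) -> Prop) :
  (forall A, measurable A -> Q \1_A) ->
  (forall a f g, bm f -> bm g -> Q f -> Q g -> Q (fun x => a * f x + g x)) ->
  (forall (f_ : nat -> T -> R) (f : T -> R) (C : R), (forall n, bm (f_ n)) -> (forall n x, `|f_ n x| <= C) ->
    (forall x, f_ ^~ x @ \oo --> f x) -> (forall n, Q (f_ n)) -> Q f) ->
  forall f, bm f -> Q f.
Proof.
move=> Q1 Qlin Qlim f bf.
have bi A : measurable A -> bm (\1_A : T -> R) by exact: bm_indic.
have Q0 : Q (fun _ => 0).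
  have := Qlin (-1) _ _ (bi _ measurableT) (bi _ measurableT) (Q1 _ measurableT) (Q1 _ measurableT).
  by congr Q; apply/funext => x; rewrite mulN1r addNr.
have Qsum (I : Type) (r : seq I) (c : R) (A : I -> set T) : (forall i, measurable (A i)) ->
    Q (fun x => \sum_(i <- r) c * \1_(A i) x).
  move=> mA; elim: r => [|i r ih]; first by under eq_fun do rewrite big_nil.
  under eq_fun do rewrite big_cons.
  apply: Qlin => //; [exact: bi| |exact: Q1].
  by apply: bm_sum => j; apply: bmZ; exact: bi.
have Q01 g : bm g -> (forall x, 0 <= g x <= 1) -> Q g.
  move=> bg g01.
  pose A (k j : nat) := [set x | j.+1%:R <= k.+1%:R * g x].
  have mA k j : measurable (A k j).
    rewrite -[A k j]setTI; apply: measurable_fun_le.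
      exact: measurableT.
      exact: measurable_cst.
    by apply: measurable_funM; [exact: measurable_cst|exact: bg.1].
  pose g_ k x := \sum_(j < k.+1) k.+1%:R^-1 * \1_(A k j) x : R.
  have g_E k x : g_ k x = k.+1%:R^-1 * \sum_(j < k.+1) (j.+1%:R <= k.+1%:R * g x)%R%:R.
    rewrite mulr_sumr; apply: eq_bigr => j _; congr (_ * _).
    rewrite indicE; congr (_ %:R); congr nat_of_bool; apply/idP/idP.
      by rewrite inE.
    by move=> h; rewrite inE.
  have key k x : `|g_ k x - g x| <= k.+1%:R^-1.
    have k0 : 0 < k.+1%:R :> R by [].
    have /andP[g0 g1] := g01 x.
    have [h1 h2] := @step_sum R k.+1 (k.+1%:R * g x) (mulr_ge0 (ltW k0) g0).
    have -> : g_ k x - g x =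
        k.+1%:R^-1 * (\sum_(j < k.+1) (j.+1%:R <= k.+1%:R * g x)%R%:R - k.+1%:R * g x).
      by rewrite g_E mulrBr mulKf// gt_eqF.
    rewrite normrM ger0_norm ?invr_ge0// ler_piMr ?invr_ge0//.
    have [kx|xk] := leP k.+1%:R (k.+1%:R * g x).
      rewrite h1// -[X in X - _]mulr1 -mulrBr normrM ger0_norm//.
      move: kx; rewrite -[leLHS]mulr1 ler_pM2l// => h.
      have -> : g x = 1 by apply/eqP; rewrite eq_le g1 h.
      by rewrite subrr normr0 mulr0.
    by have [a1 a2] := h2 xk; rewrite ler_norml; lra.
  apply: (Qlim g_ g 2).
  - by move=> n; apply: bm_sum => j; apply: bmZ; exact: bi.
  - move=> n x; have h := key n x; have /andP[g0 g1] := g01 x.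
    have h1 : n.+1%:R^-1 <= 1 :> R by rewrite invf_le1// ler1n.
    by move: (le_trans h h1); rewrite !ler_norml; lra.
  - move=> x; apply/cvgrPdist_le => e e0.
    have /cvgr0_norm_le/(_ _ e0) := @cvg_harmonic R.
    apply: filterS => k hk; rewrite distrC (le_trans (key k x))//.
    by apply: le_trans hk; exact: ler_norm.
  - by move=> n; exact: Qsum.
have [mf [C fC]] := bf.
pose D := `|C| + 1.
have D0 : 0 < D by rewrite ltr_wpDl.
have fD x : `|f x| <= D.
  by rewrite (le_trans (fC x))// (le_trans (ler_norm _))// lerDl.
pose g x := (2 * D)^-1 * (f x + D).
have bg : bm g by apply: bmZ; apply: bmD => //; exact: bm_cst.
have Qg : Q g.
  apply: Q01 => // x; have := fD x; rewrite ler_norml => /andP[f1 f2].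
  have D2 : 0 < 2 * D by lra.
  by rewrite /g mulrC ler_pdivlMr// ler_pdivrMr//; lra.
have := Qlin (2 * D) _ _ bg (bmZ (- D) (bi _ measurableT)) Qg.
have QD : Q (fun x => - D * \1_[set: T] x).
  have := Qlin (- D) _ _ (bi _ measurableT) (bm_cst _ 0) (Q1 _ measurableT) Q0.
  by congr Q; apply/funext => x; rewrite addr0.
move/(_ QD); congr Q; apply/funext => x.
rewrite /g indicE in_setT mulr1; field; lra.
Qed.

Section Laws.
Context (R : realType) d (Om : measurableType d) (P : probability Om R).

Lemma E_indic A : measurable A -> \int[P]_w \1_A w = fine (P A).
Proof. by move=> mA; rewrite /Rintegral integral_indic// setIT. Qed.

Lemma bm_rv (f : R -> R) (Y : Om -> R) : measurable_fun setT Y -> bm f ->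
  bm (fun w => f (Y w)).
Proof. by move=> mY bf; exact: (bm_comp bf mY). Qed.

Lemma law_E (m : probability (measurableTypeR R) R) (Y : Om -> R) (f : R -> R) :
  has_law P Y m -> bm f -> \int[P]_w f (Y w) = \int[m]_x f x.
Proof.
move=> [mY hY]; move: f; apply: bm_elim.
- move=> A mA; transitivity (\int[P]_w (\1_(Y @^-1` A) w : R)).
    by apply: eq_Rintegral => w _; rewrite !indicE.
  transitivity (fine (P (Y @^-1` A))).
    by apply: E_indic; rewrite -[X in measurable X]setTI; exact: mY.
  by rewrite hY//; symmetry; rewrite /Rintegral integral_indic// setIT.
- move=> a f g bf bg hf hg.
  rewrite ED ?EZl ?ED ?EZl ?hf ?hg//; try exact: bmZ; try exact: bm_rv.
  by apply: bmZ; exact: bm_rv.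
- move=> f_ f C bf_ f_C f_f Q_.
  have c1 : \int[m]_x f_ n x @[n --> \oo] --> \int[m]_x f x.
    apply: (@E_cvg _ _ _ m f_ _ C) => [n|n w|w].
    - exact: (bf_ n).1.
    - exact: f_C.
    - exact: f_f.
  have c2 : \int[P]_w f_ n (Y w) @[n --> \oo] --> \int[P]_w f (Y w).
    apply: (@E_cvg _ _ _ P (fun n w => f_ n (Y w)) _ C) => [n|n w|w].
    - exact: (bm_rv mY (bf_ n)).1.
    - exact: f_C.
    - exact: f_f.
  exact: cvgn_uniq c2 c1 Q_.
Qed.

(** Frees one variable from indicators to bounded functions, [g] collecting the other factors. *)
Lemma indep_ext (Y : Om -> R) (g : Om -> R) : measurable_fun setT Y -> bm g ->
  (forall A, measurable A -> \int[P]_w (g w * \1_A (Y w)) =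
     \int[P]_w g w * \int[P]_w \1_A (Y w)) ->
  forall f, bm f -> \int[P]_w (g w * f (Y w)) = \int[P]_w g w * \int[P]_w f (Y w).
Proof.
move=> mY bg hA; apply: bm_elim => //.
- move=> a f1 f2 b1 b2 h1 h2.
  rewrite ED ?EZl//; [|exact: bm_rv|by apply: bmZ; exact: bm_rv|exact: bm_rv].
  have g1 : bm (fun w => g w * f1 (Y w)) by apply: bmM => //; exact: bm_rv.
  have g2 : bm (fun w => g w * f2 (Y w)) by apply: bmM => //; exact: bm_rv.
  rewrite mulrDr mulrCA -h1 -h2 -EZl// -ED//; last exact: bmZ.
  by apply: eq_Rintegral => w _; ring.
- move=> f_ f C bf_ f_C f_f Q_.
  have [_ [Cg hg]] := bg.
  have c1 : \int[P]_w f_ n (Y w) @[n --> \oo] --> \int[P]_w f (Y w).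
    apply: (@E_cvg _ _ _ P (fun n w => f_ n (Y w)) _ C) => [n|n w|w].
    - exact: (bm_rv mY (bf_ n)).1.
    - exact: f_C.
    - exact: f_f.
  have c2 : (\int[P]_w (g w * f_ n (Y w))) @[n --> \oo] --> \int[P]_w (g w * f (Y w)).
    apply: (@E_cvg _ _ _ P (fun n w => g w * f_ n (Y w)) _ (Cg * C)).
    + by move=> n; exact: (bmM bg (bm_rv mY (bf_ n))).1.
    + by move=> n w; rewrite normrM ler_pM.
    + by move=> w; apply: cvgM; [exact: cvg_cst|exact: f_f].
  apply: (cvgn_uniq c2 _ Q_).
  by apply: cvgM; [exact: cvg_cst|exact: c1].
Qed.

Definition rv_in (F : set (set Om)) (Y : Om -> R) :=
  forall A, measurable A -> F (Y @^-1` A).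

(** Indicators are replaced by bounded functions in the order [Y3], [Y2], [Y1]; the two-factor
    identities needed on the way come from taking the whole line as one of the three sets. *)
Lemma indep3_E (F1 F2 F3 : set (set Om)) (Y1 Y2 Y3 : Om -> R) f1 f2 f3 :
  F1 setT -> F2 setT ->F3 setT ->
  indep3 P F1 F2 F3 -> rv_in F1 Y1 -> rv_in F2 Y2 -> rv_in F3 Y3 ->
  measurable_fun setT Y1 -> measurable_fun setT Y2 -> measurable_fun setT Y3 ->
  bm f1 -> bm f2 -> bm f3 ->
  \int[P]_w (f1 (Y1 w) * f2 (Y2 w) * f3 (Y3 w)) =
  \int[P]_w f1 (Y1 w) * \int[P]_w f2 (Y2 w) * \int[P]_w f3 (Y3 w).
Proof.
move=> T1 T2 T3 ind i1 i2 i3 m1 m2 m3 b1 b2 b3.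
have mp (Y : Om -> R) A : measurable_fun setT Y -> measurable A -> measurable (Y @^-1` A).
  by move=> mY mA; rewrite -[X in measurable X]setTI; exact: mY.
have iE (Y : Om -> R) A w : \1_A (Y w) = \1_(Y @^-1` A) w :> R.
  by rewrite !indicE.
have b1A (Y : Om -> R) A : measurable_fun setT Y -> measurable A ->
    bm (fun w => \1_A (Y w) : R).
  by move=> mY mA; apply: bm_rv => //; exact: bm_indic.
have e3 A B C : measurable A -> measurable B -> measurable C ->
    \int[P]_w (\1_A (Y1 w) * \1_B (Y2 w) * \1_C (Y3 w)) =
    fine (P (Y1 @^-1` A)) * fine (P (Y2 @^-1` B)) * fine (P (Y3 @^-1` C)).
  move=> mA mB mC.
  transitivity (\int[P]_w (\1_(Y1 @^-1` A `&` Y2 @^-1` B `&` Y3 @^-1` C) w : R)).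
    by apply: eq_Rintegral => w _; rewrite !iE !indicI.
  rewrite E_indic; last by do 2 ?apply: measurableI; exact: mp.
  rewrite ind; [|exact: i1|exact: i2|exact: i3].
  by rewrite !fineM// ?fin_numM//; apply: fin_num_measure; exact: mp.
have e12 A B : measurable A -> measurable B ->
    \int[P]_w (\1_A (Y1 w) * \1_B (Y2 w)) =
    fine (P (Y1 @^-1` A)) * fine (P (Y2 @^-1` B)).
  move=> mA mB; have := e3 A B setT mA mB measurableT.
  rewrite preimage_setT probability_setT /= mulr1 => <-.
  by apply: eq_Rintegral => w _; rewrite [\1_[set: R] _]indicE in_setT mulr1.
have e1 (Y : Om -> R) A : measurable_fun setT Y -> measurable A ->
    \int[P]_w (\1_A (Y w)) = fine (P (Y @^-1` A)).
  by move=> mY mA; under eq_Rintegral do rewrite iE; rewrite E_indic//; exact: mp.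
have s3 A B f : measurable A -> measurable B -> bm f ->
    \int[P]_w (\1_A (Y1 w) * \1_B (Y2 w) * f (Y3 w)) =
    fine (P (Y1 @^-1` A)) * fine (P (Y2 @^-1` B)) * \int[P]_w f (Y3 w).
  move=> mA mB; rewrite -e12//; apply: indep_ext => //.
    by apply: bmM; exact: b1A.
  by move=> C mC; rewrite e3// e12// e1.
have s2 A f : measurable A -> bm f ->
    \int[P]_w ((\1_A (Y1 w) * f3 (Y3 w)) * f (Y2 w)) =
    \int[P]_w (\1_A (Y1 w) * f3 (Y3 w)) * \int[P]_w f (Y2 w).
  move=> mA; apply: indep_ext => //.
    by apply: bmM; [exact: b1A|exact: bm_rv].
  move=> B mB; rewrite e1//.
  have := s3 A setT f3 mA measurableT b3.
  rewrite preimage_setT probability_setT /= mulr1.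
  under eq_Rintegral do rewrite [\1_[set: R] _]indicE in_setT mulr1.
  move=> ->.
  under eq_Rintegral do rewrite mulrAC.
  by rewrite s3//; ring.
have s2' A : measurable A -> \int[P]_w (\1_A (Y1 w) * f3 (Y3 w)) =
    fine (P (Y1 @^-1` A)) * \int[P]_w f3 (Y3 w).
  move=> mA; have := s3 A setT f3 mA measurableT b3.
  rewrite preimage_setT probability_setT /= mulr1.
  by under eq_Rintegral do rewrite [\1_[set: R] _]indicE in_setT mulr1.
have e23 : \int[P]_w (f2 (Y2 w) * f3 (Y3 w)) =
    \int[P]_w f2 (Y2 w) * \int[P]_w f3 (Y3 w).
  have := s2 setT f2 measurableT b2; rewrite s2'// preimage_setT probability_setT /=.
  rewrite mul1r mulrC => <-; apply: eq_Rintegral => w _.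
  by rewrite indicE in_setT mul1r mulrC.
have := @indep_ext Y1 (fun w => f2 (Y2 w) * f3 (Y3 w)) m1
  (bmM (bm_rv m2 b2) (bm_rv m3 b3)) _ f1 b1.
rewrite e23 => h.
transitivity (\int[P]_w (f2 (Y2 w) * f3 (Y3 w) * f1 (Y1 w))).
  by apply: eq_Rintegral => w _; ring.
rewrite h; first by ring.
move=> A mA; rewrite e1//.
transitivity (\int[P]_w (\1_A (Y1 w) * f3 (Y3 w) * f2 (Y2 w))).
  by apply: eq_Rintegral => w _; ring.
by rewrite s2// s2'//; ring.
Qed.

Lemma rv_in_lin (I : Type) (D : set I) (X : I -> Om -> R) (J : Type) (r : seq J)
    (c : J -> R) (x : J -> I) : (forall j, D (x j)) ->
  rv_in (gen_sigma D X) (fun w => \sum_(j <- r) c j * X (x j) w).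
Proof.
move=> Dx A mA.
pose G := \bigcup_(i in D) [set X i @^-1` A | A in (@measurable _ R)].
have mX i : D i -> measurable_fun (setT : set (g_sigma_algebraType G)) (X i : g_sigma_algebraType G -> R).
  move=> Di _ B mB; rewrite setTI; apply: sub_sigma_algebra.
  by exists i => //; exists B.
have : measurable_fun (setT : set (g_sigma_algebraType G))
    ((fun w => \sum_(j <- r) c j * X (x j) w) : g_sigma_algebraType G -> R).
  apply: measurable_sum => j; apply: measurable_funM; first exact: measurable_cst.
  exact: mX.
by move=> /(_ measurableT A mA); rewrite setTI.
Qed.

Lemma gen_sigmaT (I : Type) (D : set I) (X : I -> Om -> R) : gen_sigma D X setT.
Proof. have [h0 hC _] := smallest_sigma_algebra setT (\bigcup_(i in D) [set X i @^-1` A | A in (@measurable _ R)]).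
by have := hC _ h0; rewrite setD0. Qed.

End Laws.

(** * Dominated integrals and the characteristic function of a normal law *)

Section DominatedIntegrals.
Context (R : realType) d (T : measurableType d) (mu : {measure set T -> \bar R}).

Lemma Rint_cvg (f_ : nat -> T -> R) (f g : T -> R) :
  (forall n, measurable_fun setT (f_ n)) -> mu.-integrable setT (EFin \o g) ->
  (forall n x, `|f_ n x| <= g x) -> (forall x, f_ ^~ x @ \oo --> f x) ->
  (\int[mu]_x f_ n x) @[n --> \oo] --> \int[mu]_x f x.
Proof.
move=> mf_ ig f_g f_f.
have mf : measurable_fun setT f by apply: measurable_fun_cvg mf_ _ => x _.
have bg x : `|f x| <= g x.
  apply: (closed_cvg (fun y => y <= g x) _ _ _ (cvg_norm (f_f x))).
    exact: closed_le.
  by apply: nearW => n; exact: f_g.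
have [_ _ h] := @dominated_convergence _ T R mu setT measurableT
  (fun n x => (f_ n x)%:E) (EFin \o f) (EFin \o g)
  (fun n => measurableT_comp (@EFin_measurable R setT) (mf_ n))
  (measurableT_comp (@EFin_measurable R setT) mf)
  (aeW mu (fun x _ => @cvg_EFin _ _ _ _ (fun n => (f_ n x)%:E) _
    (nearW _ (fun n => isT)) (f_f x)))
  ig (aeW mu (fun x n _ => f_g n x)).
apply: fine_cvg; rewrite fineK//.
apply: integrable_fin_num => //; apply: le_integrable ig => //.
  by apply/measurable_EFinP.
move=> x _ /=; rewrite lee_fin (ger0_norm (le_trans (normr_ge0 _) (bg x))).
exact: bg.
Qed.

Lemma Rint_derive (f df : R -> T -> R) (G : T -> R) (u v : R) : u < v ->
  (forall t, u < t < v -> mu.-integrable setT (EFin \o f t)) ->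
  (forall t x, u < t < v -> is_derive t 1 (f ^~ x) (df t x)) ->
  mu.-integrable setT (EFin \o G) ->
  (forall t x, u < t < v -> `|df t x| <= G x) ->
  forall t, u < t < v ->
  is_derive t 1 (fun s => \int[mu]_x f s x) (\int[mu]_x df t x).
Proof.
move=> uv bf fdf iG dfC t tuv.
have G0 x : 0 <= G x by exact: le_trans (normr_ge0 _) (dfC _ x tuv).
have dE s x : u < s < v -> partial1of2 f s x = df s x.
  by move=> suv; rewrite partial1of2E; have [_ ->] := fdf s x suv.
have tI : `]u, v[%classic t by rewrite /= in_itv.
have h1 s : `]u, v[%classic s -> mu.-integrable setT (EFin \o f s).
  by rewrite /= in_itv /= => suv; exact/bf.
have h2 s x : `]u, v[%classic s -> setT x -> derivable (f ^~ x) s 1.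
  by rewrite /= in_itv /= => suv _; have [] := fdf s x suv.
have h3 s x : `]u, v[%classic s -> setT x -> `|partial1of2 f s x| <= G x.
  by rewrite /= in_itv /= => suv _; rewrite dE// dfC.
have D := @derivable_under_integral R _ T mu f setT measurableT t u v tI h1 h2 G G0 iG h3.
apply: DeriveDef => //.
rewrite -derive1E (differentiation_under_integral measurableT tI h1 h2 G0 iG h3).
by apply: eq_Rintegral => x _; rewrite dE.
Qed.

Lemma integrable_scale (c : R) (f : T -> R) : mu.-integrable setT (EFin \o f) ->
  mu.-integrable setT (EFin \o (fun x => c * f x)).
Proof.
by move=> h; have := integrableZl measurableT c h; apply: eq_integrable.
Qed.

Lemma le_norm_integrable (f g : T -> R) : measurable_fun setT f ->
  mu.-integrable setT (EFin \o g) -> (forall x, `|f x| <= g x) ->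
  mu.-integrable setT (EFin \o f).
Proof.
move=> mf ig fg; apply: le_integrable ig => //; first exact/measurable_EFinP.
by move=> x _ /=; rewrite lee_fin (le_trans (fg x))// ler_norm.
Qed.

End DominatedIntegrals.

Section Density.
Context (R : realType) (s ph : R).
Hypothesis s0 : s != 0.
Notation mu := (@lebesgue_measure R).
Let s2 := Num.sqrt 2 * s.
Let p : R -> R := normal_pdf 0 s.
Let p2 : R -> R := normal_pdf 0 s2.
Let c : R := - (s ^+ 2 *+ 2)^-1.

Let s20 : s2 != 0.
Proof. by rewrite mulf_neq0// gt_eqF// sqrtr_gt0. Qed.

Let p_ge0 x : 0 <= p x. Proof. exact: normal_pdf_ge0. Qed.

Let mp : measurable_fun setT p. Proof. exact: measurable_normal_pdf. Qed.

Let ip : mu.-integrable setT (EFin \o p).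
Proof. exact: integrable_normal_pdf. Qed.

Let pE : p = fun x => normal_peak s * expR (x * x * c).
Proof.
apply/funext => x; rewrite /p normal_pdfE// /normal_fun subr0; congr (_ * expR _).
by rewrite /c; ring.
Qed.

Let p2E x : p2 x = normal_peak s2 * expR (x * x * c / 2).
Proof.
rewrite /p2 normal_pdfE// /normal_fun subr0; congr (_ * expR _).
rewrite /c /s2 exprMn sqr_sqrtr//; field; exact: s0.
Qed.

Let is_dp (x : R) : is_derive x 1 p (- (x / s ^+ 2) * p x).
Proof.
rewrite pE.
apply: is_derive_eq (is_dZ (normal_peak s)
  (is_dexp (is_dM (is_dM (is_did x) (is_did x)) (is_dcst c x)))) _.
rewrite /c; field; exact: s0.
Qed.

Let K := `|s| * normal_peak s / normal_peak s2.

(** The normal density of standard deviation sqrt 2 s serves as integrable majorant of |x| p(x):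
    with u = |x| / |s| the claim is u <= exp(u^2 / 4), which follows from u <= 1 + u^2 / 4. *)
Let abs_p x : `|x| * p x <= K * p2 x.
Proof.
have P0 := normal_peak_gt0 s0; have P20 := normal_peak_gt0 s20.
have a0 : 0 < `|s| by rewrite normr_gt0.
rewrite p2E pE.
have -> : K * (normal_peak s2 * expR (x * x * c / 2)) =
    normal_peak s * (`|s| * expR (x * x * c / 2)).
  by rewrite /K; field; rewrite gt_eqF.
rewrite mulrCA ler_pM2l//.
have -> : expR (x * x * c / 2) = expR (- (x * x * c / 2)) * expR (x * x * c).
  by rewrite -expRD; congr expR; field.
rewrite mulrA ler_pM2r ?expR_gt0//.
set u := `|x| / `|s|.
have -> : - (x * x * c / 2) = u ^+ 2 / 4.
  rewrite /u expr_div_n !real_normK ?num_real// /c.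
  by field; exact: s0.
have -> : `|x| = `|s| * u by rewrite /u mulrC divfK// gt_eqF.
rewrite ler_pM2l//; apply: le_trans (expR_ge1Dx _).
by have := sqr_ge0 (1 - u / 2); lra.
Qed.

Let iGp : mu.-integrable setT (EFin \o (fun x => K * p2 x)).
Proof.
exact: integrable_scale (integrable_normal_pdf 0 s2).
Qed.

Let ibp (f : R -> R) : bm f -> mu.-integrable setT (EFin \o (fun x => f x * p x)).
Proof.
move=> [mf [C fC]]; apply: (@le_norm_integrable _ _ _ mu _ (fun x => C * p x)).
- exact: measurable_funM.
- exact: integrable_scale ip.
- by move=> x; rewrite normrM (ger0_norm (p_ge0 x)) ler_wpM2r.
Qed.

Let ibxp (f : R -> R) : measurable_fun setT f -> (forall x, `|f x| <= 1) ->
  mu.-integrable setT (EFin \o (fun x => f x * (x * p x))).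
Proof.
move=> mf fC; apply: (le_norm_integrable _ iGp).
  by apply: measurable_funM => //; apply: measurable_funM.
move=> x; apply: le_trans (abs_p x).
by rewrite !normrM (ger0_norm (p_ge0 x)) ler_piMl// mulr_ge0.
Qed.

Lemma normal_E (f : R -> R) : bm f ->
  \int[normal_prob (0 : R) s]_x f x = \int[mu]_x (f x * p x).
Proof.
move: f; apply: bm_elim.
- move=> A mA; rewrite /Rintegral integral_indic// setIT /normal_prob; congr fine.
  rewrite /= [LHS]integral_mkcond; apply: eq_integral => x _.
  by rewrite epatch_indic /= -EFinM mulrC.
- move=> a f g bf bg hf hg.
  rewrite ED ?EZl ?hf ?hg//; last exact: bmZ.
  rewrite -RintegralZl//; last exact: ibp.
  rewrite -RintegralD//; last exact: ibp.
    by apply: eq_Rintegral => x _; ring.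
  by have := ibp (bmZ a bf); apply: eq_integrable => // x _ /=; rewrite mulrA.
- move=> f_ f C bf_ f_C f_f Q_.
  have c1 : \int[normal_prob (0 : R) s]_x f_ n x @[n --> \oo] -->
      \int[normal_prob (0 : R) s]_x f x.
    apply: (@E_cvg _ _ _ (normal_prob (0 : R) s) f_ _ C) => [n|n w|w].
    - exact: (bf_ n).1.
    - exact: f_C.
    - exact: f_f.
  have c2 : \int[mu]_x (f_ n x * p x) @[n --> \oo] --> \int[mu]_x (f x * p x).
    apply: (@Rint_cvg _ _ _ mu (fun n x => f_ n x * p x) _ (fun x => C * p x)).
    - by move=> n; apply: measurable_funM => //; exact: (bf_ n).1.
    - exact: integrable_scale ip.
    - by move=> n x; rewrite normrM (ger0_norm (p_ge0 x)) ler_wpM2r.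
    - by move=> x; apply: cvgM; [exact: f_f|exact: cvg_cst].
  exact: cvgn_uniq c1 c2 Q_.
Qed.

Let mcos (a : R) : measurable_fun setT (fun x : R => cos (ph + a * x)).
Proof.
apply: measurableT_comp; first by apply: continuous_measurable_fun; exact: continuous_cos.
by apply: measurable_funD; [exact: measurable_cst|apply: measurable_funM].
Qed.

Let msin (a : R) : measurable_fun setT (fun x : R => sin (ph + a * x)).
Proof.
apply: measurableT_comp; first by apply: continuous_measurable_fun; exact: continuous_sin.
by apply: measurable_funD; [exact: measurable_cst|apply: measurable_funM].
Qed.

Let bcos (a : R) : bm (fun x : R => cos (ph + a * x)).
Proof.
by split; [exact: mcos|exists 1 => x; rewrite ler_norml cos_le1 cos_geN1].
Qed.

Let C (th : R) := \int[mu]_x (cos (ph + th * x) * p x).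
Let S (th : R) := \int[mu]_x (sin (ph + th * x) * (x * p x)).

Let dC (th : R) : is_derive th 1 C (- S th).
Proof.
have -> : - S th = \int[mu]_x (- sin (ph + th * x) * x * p x).
  rewrite -mulN1r /S -RintegralZl//.
    by apply: eq_Rintegral => x _; ring.
  apply: ibxp; first exact: msin.
  by move=> x; rewrite ler_norml sin_le1 sin_geN1.
apply: (@Rint_derive _ _ _ mu (fun th x => cos (ph + th * x) * p x)
  (fun th x => - sin (ph + th * x) * x * p x) (fun x => K * p2 x) (th - 1) (th + 1)).
- lra.
- by move=> t _; exact/ibp/bcos.
- move=> t x _.
  apply: is_derive_eq (is_dM (is_dcos (is_dD (is_dcst ph t) (is_dM (is_did t) (is_dcst x t)))) (is_dcst (p x) t)) _.
  by ring.
- exact: iGp.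
- move=> t x _; apply: le_trans (abs_p x).
  rewrite !normrM normrN (ger0_norm (p_ge0 x)) ler_wpM2r// ler_piMl//.
  by rewrite ler_norml sin_le1 sin_geN1.
- lra.
Qed.

Let g th x := th * (cos (ph + th * x) * p x) - (s ^+ 2)^-1 * (sin (ph + th * x) * (x * p x)).

Let dF th (x : R) : is_derive x 1 (fun x => sin (ph + th * x) * p x) (g th x).
Proof.
apply: is_derive_eq (is_dM (is_dsin (is_dD (is_dcst ph x) (is_dZ th (is_did x)))) (is_dp x)) _.
by rewrite /g; field.
Qed.

Let ig th : mu.-integrable setT (EFin \o g th).
Proof.
have h1 : mu.-integrable setT (fun x => th%:E * (cos (ph + th * x) * p x)%:E)%E.
  by apply: integrableZl => //; exact/ibp/bcos.
have h2 : mu.-integrable setT (fun x => (s ^+ 2)^-1%:E * (sin (ph + th * x) * (x * p x))%:E)%E.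
  apply: integrableZl => //; apply: ibxp; first exact: msin.
  by move=> x; rewrite ler_norml sin_le1 sin_geN1.
by have := integrableB measurableT h1 h2; apply: eq_integrable.
Qed.

Let int_g th : \int[mu]_x g th x = th * C th - (s ^+ 2)^-1 * S th.
Proof.
have i1 : mu.-integrable setT (EFin \o (fun x => cos (ph + th * x) * p x)).
  exact/ibp/bcos.
have i2 : mu.-integrable setT (EFin \o (fun x => sin (ph + th * x) * (x * p x))).
  apply: ibxp; first exact: msin.
  by move=> x; rewrite ler_norml sin_le1 sin_geN1.
rewrite /g RintegralB//.
- by rewrite !RintegralZl.
- exact: integrable_scale.
- exact: integrable_scale.
Qed.

Let cg th : continuous (g th).
Proof.
move=> x.
have cp : {for x, continuous p} by apply: continuous_normal_pdf.
have cl : {for x, continuous (fun x : R => ph + th * x)}.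
  by apply: cvgD; [exact: cvg_cst|apply: cvgM; [exact: cvg_cst|exact: cvg_id]].
have cs : {for x, continuous (fun x : R => sin (ph + th * x))}.
  by apply: continuous_comp => //; exact: continuous_sin.
have cc : {for x, continuous (fun x : R => cos (ph + th * x))}.
  by apply: continuous_comp => //; exact: continuous_cos.
apply: cvgB; apply: cvgM; try exact: cvg_cst.
  by apply: cvgM.
by apply: cvgM => //; apply: cvgM => //; exact: cvg_id.
Qed.

Let FTC th (a : R) : 0 < a ->
  \int[mu]_(x in `[- a, a]) g th x = sin (ph + th * a) * p a - sin (ph + th * - a) * p (- a).
Proof.
move=> a0; rewrite /Rintegral (@continuous_FTC2 _ _ (fun x => sin (ph + th * x) * p x))//.
- lra.
- by apply: continuous_subspaceT => x; exact: cg.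
- have cF x : {for x, continuous (fun x => sin (ph + th * x) * p x)}.
    apply: differentiable_continuous; apply/derivable1_diffP.
    by have [] := dF th x.
  split.
  + by move=> x _; have [] := dF th x.
  + by apply: cvg_at_right_filter; exact: cF.
  + by apply: cvg_at_left_filter; exact: cF.
- by move=> x _; rewrite derive1E; have [_ ->] := dF th x.
Qed.

(** Integration by parts on [-(n+1), n+1]; [abs_p] makes the boundary terms O(1/n). *)
Let ibp0 th : \int[mu]_x g th x = 0.
Proof.
have c1 : (\int[mu]_x (g th x * \1_`[- n.+1%:R, n.+1%:R] x)) @[n --> \oo] -->
    \int[mu]_x g th x.
  apply: (@Rint_cvg _ _ _ mu (fun n x => g th x * \1_`[- n.+1%:R, n.+1%:R] x) _
    (fun x => `|g th x|)).
  - move=> n; apply: measurable_funM; last exact: measurable_indic.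
    by apply: continuous_measurable_fun => x; exact: cg.
  - by have := integrable_norm (ig th).
  - by move=> n x; rewrite normrM ler_piMr// indicE normr_nat; case: (_ \in _).
  - move=> x; rewrite -[X in _ --> X]mulr1; apply: cvgM; first exact: cvg_cst.
    apply: cvg_near_cst; near=> n.
    rewrite indicE; apply/eqP; rewrite pnatr_eq1 eqb1 inE /= in_itv /= -ler_norml.
    near: n; exists (Num.truncn `|x|) => // n /= hn.
    rewrite (le_trans (ltW (truncnS_gt _)))// ler_nat ltnS//.
have c2 : (\int[mu]_x (g th x * \1_`[- n.+1%:R, n.+1%:R] x)) @[n --> \oo] --> (0 : R).
  pose B := K * normal_peak s2.
  have h n : `|\int[mu]_x (g th x * \1_`[- n.+1%:R, n.+1%:R] x)| <= 2 * B * n.+1%:R^-1.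
    have n0 : 0 < n.+1%:R :> R by [].
    rewrite (_ : \int[mu]_x _ = \int[mu]_(x in `[- n.+1%:R, n.+1%:R]) g th x); last first.
      rewrite [RHS]Rintegral_mkcond; apply: eq_Rintegral => x _.
      by rewrite patch_indic.
    rewrite FTC// (le_trans (ler_normB _ _))//.
    have hp y : `|y| = n.+1%:R -> `|sin (ph + th * y) * p y| <= B * n.+1%:R^-1.
      move=> yn; rewrite normrM (ger0_norm (p_ge0 y)) ler_pdivlMr//.
      have := abs_p y; rewrite yn => h1.
      have h2 : p2 y <= normal_peak s2 by exact: normal_pdf_ub.
      have K0 : 0 <= K by rewrite /K !mulr_ge0// ?invr_ge0 ?normal_peak_ge0.
      apply: le_trans (_ : n.+1%:R * p y <= _); last first.
        by rewrite (le_trans h1)// ler_wpM2l.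
      rewrite mulrC mulrA ler_wpM2r// ler_piMr//.
      by rewrite ler_norml sin_le1 sin_geN1.
    rewrite -mulrA mulr_natl mulr2n lerD// hp// ?normrN normr_nat//.
  apply/cvgr0Pnorm_le => e e0.
  have c3 : 2 * B * n.+1%:R^-1 @[n --> \oo] --> (0 : R).
    by rewrite -[X in _ --> X](mulr0 (2 * B)); apply: cvgM; [exact: cvg_cst|exact: cvg_harmonic].
  move/cvgr0_norm_le : c3 => /(_ _ e0); apply: filterS => n hn.
  by rewrite (le_trans (h n))// (le_trans (ler_norm _)).
exact: (cvgn_uniq c1 c2).
Unshelve. all: by end_near.
Qed.

(** [dC] and [ibp0] give C'(th) = - s^2 th C(th), so C(th) exp(th^2 s^2 / 2) is constant. *)
Lemma normal_cos (th : R) :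
  \int[normal_prob (0 : R) s]_x cos (ph + th * x) = expR (- (th ^+ 2 * s ^+ 2) / 2) * cos ph.
Proof.
rewrite (normal_E (bcos th)).
have SE u : S u = s ^+ 2 * u * C u.
  have := int_g u; rewrite ibp0 => /esym/eqP; rewrite subr_eq0 => /eqP h.
  by rewrite -mulrA h; field; exact: s0.
have dH (u : R) : is_derive u 1 (fun u => C u * expR (u * u * (s ^+ 2 / 2))) 0.
  apply: is_derive_eq (is_dM (dC u) (is_dexp (is_dM (is_dM (is_did u) (is_did u))
    (is_dcst (s ^+ 2 / 2) u)))) _.
  by rewrite SE; field.
have := is_derive_0_is_cst th 0 dH.
rewrite !mul0r expR0 mulr1 => h.
have C0 : C 0 = cos ph.
  have -> : C 0 = \int[mu]_x (cos ph * p x).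
    by apply: eq_Rintegral => x _; rewrite mul0r addr0.
  by rewrite RintegralZl// /Rintegral integral_normal_pdf mulr1.
have -> : - (th ^+ 2 * s ^+ 2) / 2 = - (th * th * (s ^+ 2 / 2)) by field.
have e0 : expR (th * th * (s ^+ 2 / 2)) != 0 by rewrite gt_eqF// expR_gt0.
by rewrite expRN; apply: (mulIf e0); rewrite h C0 mulrAC mulVf// mul1r.
Qed.

End Density.

Section GaussCos.
Context (R : realType) d (Om : measurableType d) (P : probability Om R).

Lemma bm_cosD (a : R) : bm (fun y : R => cos (a + y)).
Proof.
split; last by exists 1 => x; rewrite ler_norml cos_le1 cos_geN1.
apply: measurableT_comp; first by apply: continuous_measurable_fun; exact: continuous_cos.
exact: measurable_funD.
Qed.

Lemma gauss_cos (Y : Om -> R) (v ph th : R) : 0 <= v -> has_law P Y (gauss_law v) ->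
  \int[P]_w cos (ph + th * Y w) = expR (- (th ^+ 2 * v) / 2) * cos ph.
Proof.
move=> v0 hY.
have bc : bm (fun y : R => cos (ph + th * y)).
  split; last by exists 1 => x; rewrite ler_norml cos_le1 cos_geN1.
  apply: measurableT_comp; first by apply: continuous_measurable_fun; exact: continuous_cos.
  by apply: measurable_funD => //; exact: measurable_funM.
have [v1|v1] := eqVneq v 0.
  rewrite (law_E (m := @dirac _ (measurableTypeR R) 0 R) _ bc); last first.
    by rewrite /has_law; move: hY; rewrite /gauss_law v1 eqxx.
  rewrite /Rintegral integral_dirac//; last by apply/measurable_EFinP; exact: bc.1.
  by rewrite diracT mul1e /= v1 !mulr0 oppr0 mul0r expR0 addr0 mul1r.
rewrite (law_E (m := normal_prob 0 (Num.sqrt v)) _ bc); last first.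
  by rewrite /has_law; move: hY; rewrite /gauss_law (negbTE v1).
by rewrite normal_cos ?sqr_sqrtr// gt_eqF// sqrtr_gt0 lt_neqAle eq_sym v1.
Qed.

(** For v < 0 the square root is 0 by convention and [normal_prob 0 0] is the uniform law on [0, 1],
    which gives no mass to the half-line up to 0; [Y] and [- Y] cannot both have it. *)
Lemma gauss_law_ge0 (Y : Om -> R) (v : R) :
  has_law P Y (gauss_law v) -> has_law P (fun w => - Y w) (gauss_law v) -> 0 <= v.
Proof.
move=> hY hNY; have mY := hY.1; rewrite leNgt; apply/negP => v0.
move: hY hNY; rewrite /gauss_law lt_eqF// ler0_sqrtr ?ltW// => -[_ lY] [mNY lNY].
have z : normal_prob (0 : R) 0 `]-oo, 0] = 0%E.
  rewrite /normal_prob /normal_pdf eqxx integral_indic//.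
  rewrite (_ : _ `&` _ = [set 0]); first exact: lebesgue_measure_set1.
  apply/seteqP; split => x /=; rewrite !in_itv /=.
    by move=> [/andP[x0 _] x1]; apply/eqP; rewrite eq_le x0 x1.
  by move=> ->; rewrite lexx ler01.
have h1 : P (Y @^-1` `]-oo, 0]) = 0%E by rewrite lY.
have h2 : P ((fun w => - Y w) @^-1` `]-oo, 0]) = 0%E by rewrite lNY.
have m1 : measurable (Y @^-1` `]-oo, 0]).
  by rewrite -[X in measurable X]setTI; exact: mY.
have m2 : measurable ((fun w => - Y w) @^-1` `]-oo, 0]).
  by rewrite -[X in measurable X]setTI; exact: mNY.
have : (P (Y @^-1` `]-oo, 0%R] `|` (fun w => (- Y w)%R) @^-1` `]-oo, 0%R]) <= 0)%E.
  rewrite (le_trans (measureU2 P m1 m2))//.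
  by rewrite [X in (X + _ <= _)%E]h1 [X in (_ + X <= _)%E]h2 adde0.
rewrite (_ : _ `|` _ = setT); first by rewrite probability_setT lee_fin ler10.
apply/seteqP; split => w //= _; rewrite !in_itv /= oppr_le0.
by have [|/ltW] := leP (Y w) 0; [left|right].
Qed.

End GaussCos.

(** * Measurability and boundedness of processes with continuous paths *)

Section Coordinates.
Context (R : realType).

Lemma measurable_coord M i : measurable_fun setT (fun x : M.-tuple R => coord x i).
Proof.
have [iM|Mi] := ltnP i M.
  rewrite (_ : (fun _ => _) = (fun x : M.-tuple R => tnth x (Ordinal iM))).
    exact: measurable_tnth.
  by apply/funext => x; rewrite /coord (tnth_nth 0).
rewrite (_ : (fun _ => _) = (fun _ => 0)); first exact: measurable_cst.
by apply/funext => x; rewrite /coord nth_default// size_tuple.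
Qed.

Lemma measurable_mktuple d (T : measurableType d) M (f : 'I_M -> T -> R) :
  (forall i, measurable_fun setT (f i)) ->
  measurable_fun setT (fun x => mktuple (f ^~ x)).
Proof.
move=> mf; apply/measurable_fun_tnthP => i.
rewrite (_ : _ \o _ = f i)//.
by apply/funext => x /=; rewrite tnth_mktuple.
Qed.

Lemma coord_mktuple M (f : 'I_M -> R) (i : 'I_M) : coord (mktuple f) i = f i.
Proof. by rewrite /coord -tnth_nth tnth_mktuple. Qed.

Lemma measurable_set_le d (T : measurableType d) (f g : T -> R) :
  measurable_fun setT f -> measurable_fun setT g -> measurable [set x | f x <= g x].
Proof.
move=> mf mg; rewrite -[X in measurable X]setTI.
exact: measurable_fun_le measurableT mf mg.
Qed.

Lemma measurable_set_lt d (T : measurableType d) (f g : T -> R) :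
  measurable_fun setT f -> measurable_fun setT g -> measurable [set x | f x < g x].
Proof.
move=> mf mg; rewrite (_ : [set _ | _] = ~` [set x | g x <= f x]).
  by apply: measurableC; exact: measurable_set_le.
by apply/seteqP; split => x /=; rewrite ltNge => /negP.
Qed.

Lemma measurable_set_eq d (T : measurableType d) (f g : T -> R) :
  measurable_fun setT f -> measurable_fun setT g -> measurable [set x | f x = g x].
Proof.
move=> mf mg; rewrite (_ : [set _ | _] = [set x | f x <= g x] `&` [set x | g x <= f x]).
  by apply: measurableI; exact: measurable_set_le.
apply/seteqP; split => x /=; first by move=> ->; rewrite lexx.
by move=> [h1 h2]; apply/eqP; rewrite eq_le h1 h2.
Qed.

End Coordinates.

Section Caratheodory.
Context (R : realType) d (Om : measurableType d) (M : nat).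
Variables (S : set (M.-tuple R)) (g : Om -> M.-tuple R -> R).
Hypothesis mS : measurable S.
Hypothesis mg : forall x, S x -> measurable_fun setT (g ^~ x).
Hypothesis cg : forall w x, S x -> forall e : R, 0 < e -> exists2 del : R, 0 < del &
  forall y, S y -> \sum_(i < M) (coord x i - coord y i) ^+ 2 < del -> `|g w x - g w y| < e.

Let cell (m : nat) (x : M.-tuple R) : M.-tuple int :=
  mktuple (fun i : 'I_M => Num.floor (m.+1%:R * coord x i)).

Let mcell m k : measurable [set x | cell m x = k].
Proof.
have -> : [set x | cell m x = k] = \bigcap_(i in [set: 'I_M])
    ([set x | (tnth k i)%:~R <= m.+1%:R * coord x i] `&`
     [set x | m.+1%:R * coord x i < (tnth k i + 1)%:~R]).
  apply/seteqP; split => x /=.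
    move=> <- i _ /=; rewrite tnth_mktuple.
    by have /andP[] := floor_itv (m.+1%:R * coord x i).
  move=> h; apply: eq_from_tnth => i; rewrite tnth_mktuple.
  by apply/eqP; rewrite floor_eq; have [/= -> ->] := h i Logic.I.
apply: fin_bigcap_measurable => // i _.
have mc : measurable_fun setT (fun x : M.-tuple R => m.+1%:R * coord x i).
  by apply: measurable_funM; [exact: measurable_cst|exact: measurable_coord].
by apply: measurableI; [apply: measurable_set_le|apply: measurable_set_lt].
Qed.

Let cell_close m x y : cell m x = cell m y ->
  \sum_(i < M) (coord x i - coord y i) ^+ 2 <= M%:R * m.+1%:R^-1.
Proof.
move=> xy; rewrite -[M in leRHS]card_ord -sumr_const mulr_suml.
apply: ler_sum => i _; rewrite mul1r.
have /(congr1 (fun k : M.-tuple int => tnth k i)) := xy; rewrite !tnth_mktuple => e.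
have /andP[h1 h2] := floor_itv (m.+1%:R * coord x i).
have /andP[h3 h4] := floor_itv (m.+1%:R * coord y i).
rewrite -e in h3 h4.
have m0 : 0 < m.+1%:R :> R by [].
set z := coord x i - coord y i.
have hz : `|m.+1%:R * z| <= 1.
  by move: h2 h4; rewrite !intrD /z ler_norml mulrBr; lra.
have m1 : m.+1%:R^-1 <= 1 :> R by rewrite invf_le1// ler1n.
have hz' : `|z| <= m.+1%:R^-1.
  by rewrite -[leRHS]mul1r ler_pdivlMr// mulrC -[X in X * _](gtr0_norm m0) -normrM.
rewrite -real_normK ?num_real// expr2 -[leRHS]mul1r ler_pM//.
exact: le_trans hz' m1.
Qed.

(** The argument x is replaced by a representative in [S] of its cube of side 1/(m+1). There are
    countably many cubes, so the discretised process is jointly measurable, and it converges by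
    continuity on [S]; the indicator discards the points outside, where [g] is arbitrary. *)
Lemma caratheodory :
  measurable_fun setT (fun z : Om * M.-tuple R => g z.1 z.2 * \1_S z.2).
Proof.
have [-> |/set0P[x0 Sx0]] := eqVneq S set0.
  rewrite (_ : (fun _ => _) = (fun _ => 0)); first exact: measurable_cst.
  by apply/funext => z; rewrite indicE in_set0 mulr0.
(* [x0] is only the default value for cubes that miss [S]. *)
pose rho m k := xget x0 [set y | S y /\ cell m y = k].
have Srho m k : S (rho m k).
  by rewrite /rho; case: xgetP => [y _ []|].
have rhoE m x : S x -> cell m x = cell m (rho m (cell m x)).
  move=> Sx; rewrite /rho; case: xgetP => [y _ [_ ->]//|].
  by move=> /(_ x); case.
pose gm m (z : Om * M.-tuple R) := g z.1 (rho m (cell m z.2)) * \1_S z.2.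
have mgm m : measurable_fun setT (gm m).
  apply: measurable_funM; last first.
    exact: (measurableT_comp (measurable_indic mS) measurable_snd).
  move=> _ B mB; rewrite setTI.
  have -> : (fun z : Om * M.-tuple R => g z.1 (rho m (cell m z.2))) @^-1` B =
      \bigcup_k ((g ^~ (rho m k) @^-1` B) `*` [set x | cell m x = k]).
    apply/seteqP; split => -[w x] /=; first by move=> h; exists (cell m x).
    by move=> [k _ [/= h e]]; rewrite e.
  apply: countable_bigcupT_measurable; first exact: countableP.
  move=> k; apply: measurableX; last exact: mcell.
  by rewrite -[X in measurable X]setTI; exact: (mg (Srho m k)).
apply: measurable_fun_cvg mgm _ => -[w x] _ /=; rewrite /gm /=.
rewrite indicE; have [/set_mem Sx|_] := boolP (x \in S); last first.
  by under eq_fun do rewrite mulr0; rewrite mulr0; exact: cvg_cst.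
under eq_fun do rewrite mulr1; rewrite mulr1.
apply/cvgrPdist_le => e e0.
have [del d0 hd] := cg w Sx e0.
have c0 : M%:R * m.+1%:R^-1 @[m --> \oo] --> (0 : R).
  by rewrite -[X in _ --> X](mulr0 M%:R); apply: cvgM; [exact: cvg_cst|exact: cvg_harmonic].
move/cvgr0_norm_lt : c0 => /(_ _ d0); apply: filterS => m hm.
apply: ltW; apply: hd => //.
apply: le_lt_trans (cell_close (rhoE m x Sx)) _.
exact: le_lt_trans (ler_norm _) hm.
Qed.

End Caratheodory.

Lemma cvg_sumF (R : realType) (T : Type) (F : set_system T) (FF : Filter F)
    (I : Type) (r : seq I) (f : I -> T -> R) (l : I -> R) :
  (forall i, f i x @[x --> F] --> l i) ->
  \sum_(i <- r) f i x @[x --> F] --> \sum_(i <- r) l i.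
Proof.
move=> h; elim: r => [|i r ih].
  by under eq_fun do rewrite big_nil; rewrite big_nil; exact: cvg_cst.
by under eq_fun do rewrite big_cons; rewrite big_cons; apply: cvgD.
Qed.

Section SphereCompact.
Context (R : realType) (M : nat).

(** Points are turned into row vectors, where closed bounded sets are compact. *)
Lemma cont_on_sph_bounded (g : M.-tuple R -> R) : cont_on_sph g ->
  exists C, forall x, sph M x -> `|g x| <= C.
Proof.
move=> cg.
pose tup (v : 'rV[R]_M) : M.-tuple R := mktuple (v ord0).
pose A := [set v : 'rV[R]_M | \sum_(i < M) v ord0 i ^+ 2 = M%:R].
have At v : A v <-> sph M (tup v).
  rewrite /A /sph /=; under [X in _ <-> X = _]eq_bigr do rewrite coord_mktuple.
  by [].
have cA : closed A.
  rewrite (_ : A = (fun v : 'rV[R]_M => \sum_(i < M) v ord0 i ^+ 2) @^-1` [set M%:R])//.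
  apply: preimage_closed; last exact: closed_eq.
  move=> v _; apply: (@cvg_sumF _ _ (nbhs v)) => i.
  by under eq_fun do rewrite expr2; rewrite expr2; apply: cvgM; exact: coord_continuous.
have bA : bounded_set A.
  exists M%:R; split => [|y My v Av]; first exact: num_real.
  have y0 : 0 <= y by rewrite (le_trans _ (ltW My)).
  rewrite /= [leLHS]/Num.norm /= mx_normrE; apply/bigmax_leP; split => // -[i j] _ /=.
  rewrite (ord1 i).
  have [->|M0] := eqVneq (v ord0 j) 0; first by rewrite normr0.
  have h : v ord0 j ^+ 2 <= M%:R.
    rewrite -Av (bigD1 j)//= lerDl sumr_ge0// => k _; exact: sqr_ge0.
  have M1 : 1 <= M%:R :> R by rewrite ler1n (leq_ltn_trans _ (ltn_ord j)).
  rewrite -(@ler_pXn2r _ 2)// ?nnegrE// real_normK ?num_real//.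
  rewrite (le_trans h)// (le_trans (ltW My))// expr2 ler_peMl//.
  exact: le_trans M1 (ltW My).
have kA := bounded_closed_compact bA cA.
have cgA : {within A, continuous (fun v => g (tup v))}.
  apply/subspace_continuousP => v Av; apply/cvgrPdist_lt => e e0.
  have [del d0 hd] := cg _ ((At v).1 Av) e e0.
  have c0 : \sum_(i < M) (v ord0 i - (u : 'rV[R]_M) ord0 i) ^+ 2 @[u --> v] --> (0 : R).
    rewrite [X in _ --> X](_ : _ = \sum_(i < M) (v ord0 i - v ord0 i) ^+ 2); last first.
      by rewrite big1// => i _; rewrite subrr expr0n.
    apply: (@cvg_sumF _ _ (nbhs v)) => i; under eq_fun do rewrite expr2; rewrite expr2.
    by apply: cvgM; apply: cvgB; solve [exact: cvg_cst|exact: coord_continuous].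
  have n0 : nbhs v [set u : 'rV[R]_M | `|\sum_(i < M) (v ord0 i - u ord0 i) ^+ 2| < del].
    by move/cvgr0_norm_lt : c0 => /(_ _ d0).
  rewrite near_withinE; apply: filterS n0 => u hu Au; apply: hd; first exact/At.
  apply: le_lt_trans hu; apply: le_trans (ler_norm _).
  by under eq_bigr do rewrite !coord_mktuple.
have /compact_bounded[C [_ hC]] := continuous_compact cgA kA.
exists (C + 1) => x Sx.
have xt : tup (\row_i coord x i) = x.
  by apply: eq_from_tnth => i; rewrite tnth_mktuple mxE /Defs.coord -tnth_nth.
apply: (hC (C + 1)); first by rewrite ltrDl.
exists (\row_i coord x i); last by rewrite xt.
by apply/At; rewrite xt.
Qed.

End SphereCompact.

(** * Null sets, and the poles of the sphere *)

Section FullMeasure.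
Context (R : realType) d (T : measurableType d) (mu : probability T R).

(** Since (f1 - f2) g = 0, |f1 - f2| is at most (C1 + C2)(1 - g), whose integral is zero. *)
Lemma E_full (g f1 f2 : T -> R) : bm g -> (forall x, 0 <= g x <= 1) ->
  \int[mu]_x g x = 1 -> bm f1 -> bm f2 -> (forall x, f1 x * g x = f2 x * g x) ->
  \int[mu]_x f1 x = \int[mu]_x f2 x.
Proof.
move=> bg g01 g1 b1 b2 e.
have [_ [C1 h1]] := b1; have [_ [C2 h2]] := b2.
apply/eqP; rewrite -subr_eq0 -EB// -normr_le0.
have -> : 0 = \int[mu]_x ((C1 + C2) * (1 - g x)).
  rewrite EZl ?EB ?E_cst ?g1 ?subrr ?mulr0//; first exact: bm_cst.
  by apply: bmB => //; exact: bm_cst.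
apply: E_norm_le; first exact: bmB.
  by apply: bmZ; apply: bmB => //; exact: bm_cst.
move=> x; have /andP[g0 gle] := g01 x.
have -> : f1 x - f2 x = (f1 x - f2 x) * (1 - g x).
  by have := e x; rewrite mulrBr mulr1 mulrBl => ->; rewrite subrr subr0.
rewrite normrM (ger0_norm (_ : 0 <= 1 - g x)) ?subr_ge0// ler_wpM2r ?subr_ge0//.
by rewrite (le_trans (ler_normB _ _))// lerD.
Qed.

End FullMeasure.

Lemma sum_last (R : realType) (N : nat) (F : nat -> R) : (0 < N)%N ->
  \sum_(i < N) F i = \sum_(i < N.-1) F i + F N.-1.
Proof. by case: N => // N _; rewrite big_ord_recr. Qed.

Section Good.
Context (R : realType) (N : nat).
Hypothesis hN : (2 <= N)%N.
Implicit Types x y : N.-tuple R.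

(** At the excluded poles [hat] divides by 0 and returns the zero vector, which is off the sphere
    where the process of dimension N - 1 is controlled. *)
Definition good : set (N.-tuple R) := [set x | sph N x /\ eps x ^+ 2 < N%:R].

Lemma N_gt0 : 0 < N%:R :> R. Proof. by rewrite ltr0n (leq_trans _ hN). Qed.

Lemma N1_gt0 : 0 < N.-1%:R :> R. Proof. by rewrite ltr0n; case: N hN => [|[]]. Qed.

Lemma N1E : N.-1%:R = N%:R - 1 :> R.
Proof. by case: N hN => // n _; rewrite -natr1 addrK. Qed.

Lemma sph_split x : sph N x <->
  \sum_(i < N.-1) coord x i ^+ 2 = N%:R - eps x ^+ 2.
Proof.
rewrite /sph /= (sum_last (fun i => coord x i ^+ 2)) ?(leq_trans _ hN)// /eps.
by split=> h; [rewrite -h addrK|rewrite h subrK].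
Qed.

Lemma eps_le x : sph N x -> eps x ^+ 2 <= N%:R.
Proof.
move/sph_split => h; rewrite -subr_ge0 -h; apply: sumr_ge0 => i _; exact: sqr_ge0.
Qed.

Definition scale x := Num.sqrt ((N%:R - eps x ^+ 2) / N.-1%:R).

Lemma scale_gt0 x : good x -> 0 < scale x.
Proof. by move=> [_ h]; rewrite sqrtr_gt0 divr_gt0 ?N1_gt0// subr_gt0. Qed.

Lemma scale_sqr x : good x -> scale x ^+ 2 = (N%:R - eps x ^+ 2) / N.-1%:R.
Proof.
by move=> [_ h]; rewrite sqr_sqrtr// divr_ge0 ?ler0n// subr_ge0 ltW.
Qed.

Lemma coord_hat x (i : 'I_N.-1) : coord (hat x) i = coord x i / scale x.
Proof. exact: coord_mktuple. Qed.

Lemma coord_scale x (i : 'I_N.-1) : good x -> coord x i = coord (hat x) i * scale x.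
Proof. by move=> gx; rewrite coord_hat divfK// gt_eqF// scale_gt0. Qed.

Lemma hat_sph x : good x -> sph N.-1 (hat x).
Proof.
move=> gx; rewrite /sph /=.
under eq_bigr do rewrite coord_hat expr_div_n.
rewrite -mulr_suml ((sph_split x).1 gx.1) scale_sqr//.
have h : N%:R - eps x ^+ 2 != 0 by rewrite gt_eqF// subr_gt0 gx.2.
by field; rewrite h gt_eqF// N1_gt0.
Qed.

Lemma measurable_eps : measurable_fun setT (fun x => eps x).
Proof. exact: measurable_coord. Qed.

Lemma measurable_sph : measurable (sph N : set (N.-tuple R)).
Proof.
apply: measurable_set_eq; last exact: measurable_cst.
by apply: measurable_sum => i; apply: measurable_funX; exact: measurable_coord.
Qed.

Lemma measurable_good : measurable good.
Proof.
apply: measurableI; first exact: measurable_sph.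
apply: measurable_set_lt; last exact: measurable_cst.
by apply: measurable_funX; exact: measurable_eps.
Qed.

Lemma measurable_scale : measurable_fun setT scale.
Proof.
apply: measurableT_comp.
  by apply: continuous_measurable_fun; exact: sqrt_continuous.
apply: measurable_funM; last exact: measurable_cst.
apply: measurable_funB; first exact: measurable_cst.
by apply: measurable_funX; exact: measurable_eps.
Qed.

Lemma measurable_hat : measurable_fun setT (@hat R N).
Proof.
apply: (measurable_mktuple (f := fun (i : 'I_N.-1) x => coord x i / scale x)) => i.
apply: measurable_funM; first exact: measurable_coord.
rewrite (_ : (fun _ => _) = (fun x => powR (scale x) (-1))); last first.
  by apply/funext => x; rewrite powR_inv1// sqrtr_ge0.
exact: (measurableT_comp (measurable_powR _) measurable_scale).
Qed.

Section BadNull.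
Variable lam : probability (N.-tuple R) R.
Hypothesis ulam : uniform_on_sphere lam.

Let Nl : (N.-1 < N)%N. Proof. by case: N hN. Qed.
Let N0 : (0 < N)%N. Proof. by case: N hN. Qed.
Let N1 : (0 < N.-1)%N. Proof. by case: N hN => [|[]]. Qed.
Let l : 'I_N := Ordinal Nl.
Let o : 'I_N := Ordinal N0.

Let lo : l != o.
Proof. by rewrite -val_eqE /= -lt0n. Qed.

Let v (t : R) : 'cV[R]_N := \col_i (if i == o then 1 else if i == l then t else 0).
Let k (t : R) := 2 / (1 + t ^+ 2).
(** Householder reflection in the hyperplane orthogonal to e_o + t e_l: an explicit infinite family
    of orthogonal matrices moving the poles to different places. *)
Let hh (t : R) : 'M[R]_N := 1%:M - k t *: (v t *m (v t)^T).

Let sum_v t (y : 'I_N -> R) : \sum_j v t j 0 * y j = y o + t * y l.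
Proof.
rewrite (bigD1 o)//= (bigD1 l)//= !mxE !eqxx (negbTE lo) mul1r big1 ?addr0// => i /andP[io il].
by rewrite mxE (negbTE io) (negbTE il) mul0r.
Qed.

Let t1 (t : R) : 0 < 1 + t ^+ 2. Proof. by rewrite ltr_pwDl// sqr_ge0. Qed.

Let hh_orth t : (hh t)^T *m hh t = 1%:M.
Proof.
have vv : (v t)^T *m v t = (1 + t ^+ 2)%:M.
  apply/matrixP => i j; rewrite !mxE !ord1 eqxx mulr1n.
  under eq_bigr do rewrite [_^T _ _]mxE.
  by rewrite sum_v !mxE !eqxx (negbTE lo) expr2.
have hT : (hh t)^T = hh t.
  by rewrite /hh linearB /= trmx1 linearZ /= trmx_mul trmxK.
rewrite hT /hh mulmxBl mul1mx mulmxBr mulmx1 -scalemxAl -scalemxAr.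
rewrite mulmxA -[_ *m _ *m v t]mulmxA vv mul_mx_scalar -scalemxAl.
rewrite !scalerA -addrA -opprD -[RHS]subr0; congr (_ - _).
rewrite -scalerBl -scalerDl [X in X *: _](_ : _ = 0) ?scale0r// /k.
by field; rewrite gt_eqF.
Qed.

Let eps_hh t x : eps (mx_act (hh t) x) =
  ((1 - t ^+ 2) * coord x l - 2 * t * coord x o) / (1 + t ^+ 2).
Proof.
rewrite /eps (coord_mktuple _ l).
transitivity (coord x l - k t * t * (coord x o + t * coord x l)).
  rewrite -[X in X - _]mul1r.
  rewrite -(sum_v t (coord x)) mulr_sumr.
  have -> : 1 * coord x l = \sum_(j < N) (l == j)%:R * coord x j.
    rewrite (bigD1 l)//= eqxx mul1r big1 ?addr0 ?mul1r// => i il.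
    by rewrite eq_sym (negbTE il) mul0r.
  rewrite -sumrB; apply: eq_bigr => j _.
  rewrite !mxE big_ord1 !mxE eqxx (negbTE lo) mulrBl; congr (_ - _).
  by ring.
by rewrite /k; field; rewrite gt_eqF.
Qed.

Let B t : set (N.-tuple R) := [set x | sph N x /\ eps (mx_act (hh t) x) ^+ 2 = N%:R].

Let measurable_act t : measurable_fun setT (mx_act (hh t)).
Proof.
apply: measurable_mktuple => i; apply: measurable_sum => j.
by apply: measurable_funM; [exact: measurable_cst|exact: measurable_coord].
Qed.

(** With A the numerator in [eps_hh], A^2 + (2 t xl + (1 - t^2) xo)^2 = (xo^2 + xl^2)(1 + t^2)^2 <=
    N (1 + t^2)^2, and on [B t] the term A^2 alone exhausts the bound. *)
Let Bcoord t x : B t x ->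
  2 * t * coord x l + (1 - t ^+ 2) * coord x o = 0 /\
  coord x o ^+ 2 + coord x l ^+ 2 = N%:R.
Proof.
move=> [Sx]; rewrite eps_hh.
have le : coord x o ^+ 2 + coord x l ^+ 2 <= N%:R.
  rewrite -Sx (bigD1 o)//= (bigD1 l)//= lerD2l lerDl sumr_ge0// => i _.
  exact: sqr_ge0.
set xl := coord x l in le *; set xo := coord x o in le *.
set A := _ * xl - _ => h.
have h1 : A ^+ 2 = N%:R * (1 + t ^+ 2) ^+ 2.
  by rewrite -h expr_div_n divfK// expf_neq0// gt_eqF.
have h2 : A ^+ 2 + (2 * t * xl + (1 - t ^+ 2) * xo) ^+ 2 =
    (xo ^+ 2 + xl ^+ 2) * (1 + t ^+ 2) ^+ 2 by rewrite /A; ring.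
have T2 : 0 < (1 + t ^+ 2) ^+ 2 by rewrite exprn_gt0.
have h3 : (2 * t * xl + (1 - t ^+ 2) * xo) ^+ 2 = 0.
  apply/eqP; rewrite eq_le sqr_ge0 andbT.
  have := ler_wpM2r (ltW T2) le; rewrite -h2 h1; lra.
split; first by apply/eqP; rewrite -sqrf_eq0 h3.
by apply: (mulIf (lt0r_neq0 T2)); rewrite -h2 h3 addr0 h1.
Qed.

Let Bdisj t u x : 0 <= t -> 0 <= u -> t != u -> B t x -> B u x -> False.
Proof.
move=> t0 u0 tu /Bcoord[h1 hN'] /Bcoord[h2 _].
have xl0 : coord x l = 0.
  have e : (t - u) * (1 + t * u) * coord x l = 0.
    have : 2 * ((t - u) * (1 + t * u) * coord x l) =
      (1 - u ^+ 2) * (2 * t * coord x l + (1 - t ^+ 2) * coord x o) -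
      (1 - t ^+ 2) * (2 * u * coord x l + (1 - u ^+ 2) * coord x o) by ring.
    by rewrite h1 h2; lra.
  move/eqP: e; rewrite !mulf_eq0 subr_eq0 (negbTE tu) /= => /orP[|/eqP//].
  by rewrite gt_eqF// ltr_pwDl// mulr_ge0.
have xo0 : coord x o = 0.
  apply/eqP; case: (eqVneq (coord x o) 0) => // xo.
  move: h1 h2; rewrite xl0 !mulr0 !add0r => /eqP + /eqP.
  rewrite !mulf_eq0 (negbTE xo) !orbF !subr_eq0 => /eqP tt /eqP uu.
  by move: tu; rewrite -(eqrXn2 (n := 2))// -tt -uu eqxx.
by move: hN' (N_gt0); rewrite xl0 xo0 !expr0n /= addr0 => <-; rewrite ltxx.
Qed.

Let mB t : measurable (B t).
Proof.
apply: measurableI; first exact: measurable_sph.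
apply: measurable_set_eq; last exact: measurable_cst.
apply: measurable_funX.
exact: (measurableT_comp measurable_eps (measurable_act t)).
Qed.

Lemma E_sph : \int[lam]_x \1_(sph N) x = 1.
Proof.
have [ms [s0 _]] := ulam.
rewrite E_indic// -[X in lam X]setCK probability_setC ?s0 ?sube0//.
exact: measurableC.
Qed.

Let E_B t : \int[lam]_x \1_(B t) x = \int[lam]_x \1_(B 0) x.
Proof.
have [ms [s0 inv]] := ulam.
pose C := [set x : N.-tuple R | eps x ^+ 2 = N%:R].
have mC : measurable C.
  apply: measurable_set_eq; last exact: measurable_cst.
  by apply: measurable_funX; exact: measurable_eps.
have mtC u : measurable (mx_act (hh u) @^-1` C).
  by rewrite -[X in measurable X]setTI; exact: measurable_act.
have EC u : \int[lam]_x \1_(B u) x = \int[lam]_x \1_(mx_act (hh u) @^-1` C) x.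
  apply: (E_full (g := \1_(sph N))).
  - exact: bm_indic.
  - by move=> x; rewrite indicE; case: (_ \in _); rewrite lexx ler01.
  - exact: E_sph.
  - exact: bm_indic.
  - exact: bm_indic.
  - move=> x; rewrite (_ : B u = sph N `&` mx_act (hh u) @^-1` C)// indicI /=.
    by rewrite !indicE; case: (x \in sph N); rewrite ?mulr1 ?mul1r ?mul0r ?mulr0.
rewrite !EC [LHS](E_indic lam (mtC t)) [RHS](E_indic lam (mtC 0)).
by rewrite (inv _ (hh_orth t) _ mC) (inv _ (hh_orth 0) _ mC).
Qed.

(** The sets [B i] for i < K are disjoint and have equal mass by invariance, so K times that mass is
    at most 1, for every K. *)
Lemma E_good : \int[lam]_x \1_good x = 1.
Proof.
have a0 : \int[lam]_x \1_(B 0) x = 0.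
  set a := (LHS); have a0 : 0 <= a.
    by rewrite -(E_cst lam 0); apply: E_le; [exact: bm_cst|exact: bm_indic|].
  apply/eqP; rewrite eq_le a0 andbT leNgt; apply/negP => ap.
  have key K : K%:R * a <= 1.
    have -> : K%:R * a = \int[lam]_x \sum_(i < K) \1_(B i%:R) x.
      rewrite E_sum; last by move=> i; exact: bm_indic.
      by under eq_bigr do rewrite E_B; rewrite sumr_const card_ord mulr_natl.
    rewrite -[leRHS](E_cst lam); apply: E_le; last 1 first.
    - move=> x; case: (boolP [exists i : 'I_K, x \in B i%:R]) => [/existsP[i xi]|].
        rewrite (bigD1 i)//= big1 ?addr0; first by rewrite indicE; case: (_ \in _).
        move=> j ji; rewrite indicE; case: (boolP (x \in _)) => // xj; exfalso.
        apply: (@Bdisj i%:R j%:R x _ _ _ (set_mem xi) (set_mem xj)) => //.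
        by rewrite eqr_nat eq_sym.
      rewrite negb_exists => /forallP h; rewrite big1// => i _.
      by rewrite indicE (negbTE (h i)).
    - by apply: bm_sum => i; exact: bm_indic.
    - exact: bm_cst.
  have := key (Num.truncn a^-1).+1; rewrite leNgt => /negP; apply.
  by rewrite -ltr_pdivrMr// mul1r truncnS_gt.
rewrite -E_sph -[LHS]addr0 -a0 -ED; [|by apply: bm_indic; exact: measurable_good|exact: bm_indic].
(* For t = 0 the reflection only changes the sign of coordinate o, so [B 0] is the set of poles
   itself. *)
have B0 : B 0 = [set x | sph N x /\ eps x ^+ 2 = N%:R].
  have hx x : eps (mx_act (hh 0) x) = eps x.
    by rewrite eps_hh expr0n /= mulr0 mul0r subr0 subr0 addr0 divr1 mul1r.
  by apply/seteqP; split => x [h1 h2]; split => //; [rewrite -hx|rewrite hx].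
apply: eq_Rintegral => x _; rewrite !indicE B0.
case: (boolP (x \in sph N)) => [/set_mem Sx|nS]; last first.
  rewrite memNset ?memNset ?addr0//.
    by move=> [h _]; move: nS; rewrite mem_set.
  by move=> [h _]; move: nS; rewrite mem_set.
have := eps_le Sx; rewrite le_eqVlt => /orP[/eqP e|e].
  rewrite memNset ?mem_set ?add0r//.
  by move=> [_]; rewrite e ltxx.
rewrite mem_set ?memNset ?addr0//.
by move=> [_ h]; move: e; rewrite h ltxx.
Qed.

End BadNull.

(** There are at most two poles, told apart by the sign of the last coordinate, so every set of
    poles is measurable. *)
Lemma measurable_sub_bad (V : set (N.-tuple R)) :
  V `<=` [set x | sph N x /\ eps x ^+ 2 = N%:R] -> measurable V.
Proof.
move=> VB.
pose D (b : bool) := [set x : N.-tuple R | sph N x /\ eps x ^+ 2 = N%:R] `&`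
  [set x | (0 < eps x) = b].
have mD b : measurable (D b).
  apply: measurableI.
    apply: measurableI; first exact: measurable_sph.
    apply: measurable_set_eq; last exact: measurable_cst.
    by apply: measurable_funX; exact: measurable_eps.
  have m1 : measurable [set x : N.-tuple R | 0 < eps x].
    by apply: measurable_set_lt; [exact: measurable_cst|exact: measurable_eps].
  case: b; first exact: m1.
  rewrite (_ : [set _ | _] = ~` [set x : N.-tuple R | 0 < eps x]); first exact: measurableC.
  by apply/seteqP; split => x /=; [move=> ->|move/negP/negbTE].
have Dsub b x y : D b x -> D b y -> x = y.
  move=> [[Sx ex] bx] [[Sy ey] by'].
  have z (u : N.-tuple R) : sph N u -> eps u ^+ 2 = N%:R -> forall i : 'I_N.-1, coord u i = 0.
    move=> /(sph_split u) h e i; move: h; rewrite e subrr => /eqP.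
    rewrite psumr_eq0 => [/allP /(_ i)|j _]; last exact: sqr_ge0.
    by rewrite mem_index_enum sqrf_eq0 => /(_ isT)/eqP.
  have exy : eps x = eps y.
    have : eps x ^+ 2 == eps y ^+ 2 by rewrite ex ey.
    rewrite eqf_sqr => /orP[/eqP//|/eqP e]; exfalso.
    move: bx by' ex; rewrite /= e oppr_gt0 => <-.
    have := N_gt0; rewrite -ey.
    by case: (ltgtP (eps y) 0) => // ->; rewrite expr0n ltxx.
  apply: eq_from_tnth => i; rewrite !(tnth_nth 0) -/(coord x i) -/(coord y i).
  have [iN|iN] := ltnP i N.-1.
    by rewrite (z x Sx ex (Ordinal iN)) (z y Sy ey (Ordinal iN)).
  suff -> : (i : nat) = N.-1 by [].
  by apply/eqP; rewrite eqn_leq iN andbT -ltnS prednK// (leq_trans _ hN).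
have mVD b : measurable (V `&` D b).
  have [->|/set0P[x [Vx Dx]]] := eqVneq (V `&` D b) set0; first exact: measurable0.
  rewrite (_ : V `&` D b = D b)//.
  by apply/seteqP; split => [y []//|y Dy]; split => //; rewrite -(Dsub b x y).
rewrite (_ : V = (V `&` D true) `|` (V `&` D false)); first exact: measurableU.
apply/seteqP; split => [x Vx|x [[]|[]]]//.
have bx := VB x Vx; rewrite /D.
by case: (boolP (0 < eps x)) => h; [left|right]; do 2 split => //=; rewrite (negbTE h).
Qed.

(** The averages integrate over the whole sphere, and at a pole the integrand may involve
    uncontrolled values of the process; with at most two such points measurability is unaffected. *)
Lemma measurable_on_sph (F : N.-tuple R -> R) :
  measurable_fun setT (fun x => F x * \1_good x) ->
  measurable_fun setT (fun x => F x * \1_(sph N) x).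
Proof.
move=> mF; pose bad := [set x : N.-tuple R | sph N x /\ eps x ^+ 2 = N%:R].
have -> : (fun x => F x * \1_(sph N) x) = (fun x => F x * \1_good x + F x * \1_bad x).
  apply/funext => x; rewrite -mulrDr !indicE; congr (_ * _).
  case: (boolP (x \in sph N)) => [/set_mem Sx|nS]; last first.
    rewrite memNset ?memNset ?addr0//.
      by move=> [h _]; move: nS; rewrite mem_set.
    by move=> [h _]; move: nS; rewrite mem_set.
  have := eps_le Sx; rewrite le_eqVlt => /orP[/eqP e|e].
    rewrite memNset ?mem_set ?add0r//.
    by move=> [_]; rewrite e ltxx.
  rewrite mem_set ?memNset ?addr0//.
  by move=> [_ h]; move: e; rewrite h ltxx.
apply: measurable_funD => //.
move=> _ A mA; rewrite setTI.
have [A0|A0] := pselect (A 0).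
  rewrite (_ : _ @^-1` _ = ~` [set x | bad x /\ ~ A (F x)]).
    by apply: measurableC; apply: measurable_sub_bad => x [].
  apply/seteqP; split => x /=; rewrite indicE.
    by move=> h [bx nA]; apply: nA; move: h; rewrite mem_set// mulr1.
  move=> h; case: (boolP (x \in bad)) => [/set_mem bx|_]; last by rewrite mulr0.
  by rewrite mulr1; apply: contrapT => nA; apply: h.
rewrite (_ : _ @^-1` _ = [set x | bad x /\ A (F x)]).
  by apply: measurable_sub_bad => x [].
apply/seteqP; split => x /=; rewrite indicE.
  by case: (boolP (x \in bad)) => [/set_mem bx|_]; [rewrite mulr1|rewrite mulr0].
by move=> [bx h]; rewrite mem_set// mulr1.
Qed.

End Good.

(** * Iterated integrals over the sphere as product integrals *)

Section Rcons.
Context (R : realType) d (T : measurableType d) (lam : probability T R).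

Lemma measurable_rcons k :
  measurable_fun setT (fun z : k.-tuple T * T => rcons_tuple z.1 z.2 : k.+1.-tuple T).
Proof.
apply/measurable_fun_tnthP => i.
have [ik|ki] := ltnP i k.
  rewrite (_ : _ \o _ = (fun z : k.-tuple T * T => tnth z.1 (Ordinal ik))).
    exact: (measurableT_comp (measurable_tnth _) measurable_fst).
  apply/funext => z /=; rewrite !(tnth_nth z.2) /= nth_rcons size_tuple ik//.
rewrite (_ : _ \o _ = snd) //.
apply/funext => z /=; rewrite (tnth_nth z.2) /= nth_rcons size_tuple ltnNge ki /=.
by case: ifP.
Qed.

Lemma bm_rcons k (F : k.+1.-tuple T -> R) : bm F ->
  bm (fun z : k.-tuple T * T => F (rcons_tuple z.1 z.2)).
Proof. by move=> bF; apply: bm_comp bF _; exact: measurable_rcons. Qed.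

(** [pw] peels off the head, whereas the fresh replicas of the final formula come last; this is the
    same product measure unfolded from the other end. *)
Lemma E_pw_rcons k (F : k.+1.-tuple T -> R) : bm F ->
  \int[pw lam k.+1]_s F s = \int[pw lam k]_s \int[lam]_y F (rcons_tuple s y).
Proof.
elim: k F => [|k ih] F bF.
  rewrite E_pwS// E_pw0; apply: eq_Rintegral => x _; rewrite E_pw0.
  by congr F; apply: val_inj.
have bG : bm (fun s : k.+1.-tuple T => \int[lam]_y F (rcons_tuple s y)).
  exact: bm_E2 (bm_rcons bF).
rewrite E_pwS// [RHS]E_pwS//; apply: eq_Rintegral => x _.
rewrite ih; last exact: (bm_fst x (bm_tcons bF)).
apply: eq_Rintegral => s _; apply: eq_Rintegral => y _.
by congr F; apply: val_inj.
Qed.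

End Rcons.

Section Iint.
Context (R : realType) (N : nat).
Hypothesis hN : (2 <= N)%N.
Variable lam : probability (N.-tuple R) R.
Hypothesis ulam : uniform_on_sphere lam.

Definition ig (x : N.-tuple R) : R := \1_(@good R N) x.
Definition igs (s : seq (N.-tuple R)) : R := \prod_(x <- s) ig x.

Lemma bm_ig : bm ig.
Proof. by apply: bm_indic; exact: measurable_good. Qed.

Lemma ig_good x : good x -> ig x = 1.
Proof. by move=> gx; rewrite /ig indicE mem_set. Qed.

Lemma ig_bad x : ~ good x -> ig x = 0.
Proof. by move=> gx; rewrite /ig indicE memNset. Qed.

Lemma ig01 x : 0 <= ig x <= 1.
Proof. by rewrite /ig indicE; case: (_ \in _); rewrite lexx ler01. Qed.

Lemma E_ig : \int[lam]_x ig x = 1.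
Proof. exact: E_good. Qed.

Lemma igs_cons x s : igs (x :: s) = ig x * igs s.
Proof. by rewrite /igs big_cons. Qed.

Lemma igs01 s : 0 <= igs s <= 1.
Proof.
elim: s => [|x s ih]; first by rewrite /igs big_nil lexx ler01.
rewrite igs_cons; have /andP[a b] := ih; have /andP[c e] := ig01 x.
by rewrite mulr_ge0 //= mulr_ile1.
Qed.

Lemma bm_igs k : bm (fun s : k.-tuple (N.-tuple R) => igs s).
Proof.
rewrite (_ : (fun _ => _) = (fun s : k.-tuple (N.-tuple R) => \prod_(i < k) ig (tnth s i))).
  apply: bm_prod => i; apply: bm_comp bm_ig _; exact: measurable_tnth.
by apply/funext => s; rewrite /igs big_tuple.
Qed.

Lemma E_igs k : \int[pw lam k]_s igs s = 1.
Proof.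
elim: k => [|k ih]; first by rewrite E_pw0 /igs big_nil.
rewrite E_pwS; last exact: bm_igs.
under eq_Rintegral do (under eq_Rintegral do rewrite igs_cons; rewrite EZl; last exact: bm_igs).
by rewrite ih; under eq_Rintegral do rewrite mulr1; exact: E_ig.
Qed.

Lemma E_igs_eq k (f1 f2 : k.-tuple (N.-tuple R) -> R) : bm f1 -> bm f2 ->
  (forall s, f1 s * igs s = f2 s * igs s) ->
  \int[pw lam k]_s f1 s = \int[pw lam k]_s f2 s.
Proof.
by move=> b1 b2 e; apply: E_full e => //; [exact: bm_igs|move=> s; exact: igs01|exact: E_igs].
Qed.

Lemma Rint_sph (A : N.-tuple R -> R) : bm (fun x => A x * ig x) ->
  \int[lam]_(x in sph N) A x = \int[lam]_x (A x * ig x).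
Proof.
move=> bA.
have mA := measurable_on_sph hN bA.1.
rewrite Rintegral_mkcond.
have -> : \int[lam]_x (A \_ (sph N)) x = \int[lam]_x (A x * \1_(sph N) x).
  by apply: eq_Rintegral => x _; rewrite patch_indic.
congr fine; apply: ae_eq_integral => //.
- exact/measurable_EFinP.
- by apply/measurable_EFinP; exact: bA.1.
exists (~` @good R N); split.
- by apply: measurableC; exact: measurable_good.
- have mg := @measurable_good R N.
  have := E_good hN ulam; rewrite E_indic// => e.
  have e1 : lam (@good R N) = 1%E.
    by rewrite -[LHS]fineK ?fin_num_measure// e.
  have := probability_setC lam mg; rewrite e1 subee// => h; exact: h.
- move=> x /= h gx; apply: h => _; congr EFin.
  by rewrite ig_good// indicE mem_set//; have [] := gx.
Qed.

Lemma iint_pw k (G : k.-tuple (N.-tuple R) -> R) : bm (fun s => G s * igs s) ->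
  iint lam G = \int[pw lam k]_s (G s * igs s).
Proof.
elim: k G => [|k ih] G bG; first by rewrite E_pw0 /igs big_nil mulr1.
have e x : iint lam (fun s : k.-tuple (N.-tuple R) => G (cons_tuple x s)) * ig x =
    \int[pw lam k]_s (G (cons_tuple x s) * igs (cons_tuple x s)).
  (* For a pole x the section in s is not known to be measurable; the factor [ig x] removes it on
     both sides. *)
  case: (pselect (good x)) => gx; last first.
    rewrite ig_bad// mulr0 -[LHS](E_cst (pw lam k)); apply: eq_Rintegral => s _.
    by rewrite igs_cons ig_bad// mul0r mulr0.
  rewrite ig_good// mulr1 ih.
    by apply: eq_Rintegral => s _; rewrite igs_cons ig_good// mul1r.
  have := bm_fst x (bm_tcons bG); congr bm; apply/funext => s /=.
  by rewrite igs_cons ig_good// mul1r.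
rewrite /= Rint_sph.
  by rewrite E_pwS//; apply: eq_Rintegral => x _; rewrite e.
under eq_fun do rewrite e.
exact: bm_E2 (bm_tcons bG).
Qed.

End Iint.

(** * Law of the interpolating field *)

Section FieldLaw.
Context (R : realType) d (Om : measurableType d) (P : probability Om R).

Lemma bm_cosY (ph : R) (Y : Om -> R) : measurable_fun setT Y -> bm (fun w => cos (ph + Y w)).
Proof. by move=> mY; exact: bm_comp (bm_cosD ph) mY. Qed.

(** Sines are cosines of phase -pi/2 and average to a multiple of cos(-pi/2) = 0, so of the expanded
    cosine of the sum only the product of the three cosines remains. *)
Lemma cos_indep3 (F1 F2 F3 : set (set Om)) (Y1 Y2 Y3 : Om -> R) (k1 k2 k3 al : R) :
  F1 setT -> F2 setT -> F3 setT -> indep3 P F1 F2 F3 ->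
  rv_in F1 Y1 -> rv_in F2 Y2 -> rv_in F3 Y3 ->
  measurable_fun setT Y1 -> measurable_fun setT Y2 -> measurable_fun setT Y3 ->
  (forall ph, \int[P]_w cos (ph + Y1 w) = k1 * cos ph) ->
  (forall ph, \int[P]_w cos (ph + Y2 w) = k2 * cos ph) ->
  (forall ph, \int[P]_w cos (ph + Y3 w) = k3 * cos ph) ->
  \int[P]_w cos (al + (Y1 w + Y2 w + Y3 w)) = k1 * k2 * k3 * cos al.
Proof.
move=> T1 T2 T3 ind i1 i2 i3 m1 m2 m3 h1 h2 h3.
have E3 p1 p2 p3 : \int[P]_w (cos (p1 + Y1 w) * cos (p2 + Y2 w) * cos (p3 + Y3 w)) =
    k1 * cos p1 * (k2 * cos p2) * (k3 * cos p3).
  rewrite -h1 -h2 -h3.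
  exact: (indep3_E T1 T2 T3 ind i1 i2 i3 m1 m2 m3 (bm_cosD p1) (bm_cosD p2) (bm_cosD p3)).
have sinE (x : R) : sin x = cos (- (pi / 2) + x).
  by rewrite cosD cosN cos_pihalf sinN sin_pihalf; ring.
have cpi : cos (- (pi / 2)) = 0 :> R by rewrite cosN cos_pihalf.
have b3 p1 p2 p3 : bm (fun w => cos (p1 + Y1 w) * cos (p2 + Y2 w) * cos (p3 + Y3 w)).
  by apply: bmM; [apply: bmM|]; exact: bm_cosY.
pose q : R := - (pi / 2).
transitivity (\int[P]_w (cos (al + Y1 w) * cos (0 + Y2 w) * cos (0 + Y3 w)
   - cos (al + Y1 w) * cos (q + Y2 w) * cos (q + Y3 w)
   - cos (q + al + Y1 w) * cos (0 + Y2 w) * cos (q + Y3 w)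
   - cos (q + al + Y1 w) * cos (q + Y2 w) * cos (0 + Y3 w))).
  apply: eq_Rintegral => w _; rewrite -!(addrA q) -!sinE !add0r.
  rewrite 2!addrA; move: (al + Y1 w) (Y2 w) (Y3 w) => A B C.
  by rewrite (cosD (A + B)) (cosD A) (sinD A); ring.
rewrite !EB; do ?[exact: b3|apply: bmB].
by rewrite !E3 /q cpi cos0; ring.
Qed.

Lemma process_cos (M : nat) (X : Om -> M.-tuple R -> R) (xi : R -> R)
    (cs : seq (R * M.-tuple R)) :
  gauss_process P X xi -> (forall p, p \in cs -> sph M p.2) ->
  [/\ measurable_fun setT (fun w => lin (X w) cs),
  rv_in (gen_sigma (sph M) (fun x w => X w x)) (fun w => lin (X w) cs) &
  forall ph, \int[P]_w cos (ph + lin (X w) cs) =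
  expR (- qf (fun x y => M%:R * xi (overlap x y)) cs / 2) * cos ph].
Proof.
move=> gX hcs.
have hj (j : 'I_(size cs)) : sph M (tnth (in_tuple cs) j).2.
  by apply: hcs; exact: mem_tnth.
pose x j := (tnth (in_tuple cs) j).2; pose c j := (tnth (in_tuple cs) j).1.
have linE w : lin (X w) cs = \sum_(j < size cs) c j * X w (x j).
  by rewrite /lin big_tnth.
have qfE : qf (fun x y => M%:R * xi (overlap x y)) cs =
    \sum_(j < size cs) \sum_(j' < size cs) c j * c j' * (M%:R * xi (overlap (x j) (x j'))).
  by rewrite /qf big_tnth; apply: eq_bigr => j _; rewrite big_tnth.
have h1 := gX _ x c hj.
(* Negated coefficients have the same quadratic form, so the sum and its opposite share one law and
   [gauss_law_ge0] applies. *)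
have h2 := gX _ x (fun j => - c j) hj.
have h3 : has_law P (fun w => - \sum_(j < size cs) c j * X w (x j))
   (gauss_law (qf (fun x y => M%:R * xi (overlap x y)) cs)).
  have e1 : (fun w => \sum_(j < size cs) - c j * X w (x j)) =
      (fun w => - \sum_(j < size cs) c j * X w (x j)).
    by apply/funext => w; rewrite -sumrN; apply: eq_bigr => j _; rewrite mulNr.
  have e2 : \sum_(j < size cs) \sum_(j' < size cs)
      - c j * - c j' * (M%:R * xi (overlap (x j) (x j'))) =
      \sum_(j < size cs) \sum_(j' < size cs)
      c j * c j' * (M%:R * xi (overlap (x j) (x j'))).
    by apply: eq_bigr => j _; apply: eq_bigr => j' _; rewrite mulrNN.
  by rewrite e1 e2 in h2; rewrite qfE.
rewrite -qfE in h1.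
have v0 := gauss_law_ge0 h1 h3.
have linE' : (fun w => lin (X w) cs) = (fun w => \sum_(j < size cs) c j * X w (x j)).
  by apply/funext => w.
split; first by rewrite linE'; exact: h1.1.
  rewrite linE'.
  exact: (@rv_in_lin _ _ _ _ (sph M) (fun x w => X w x) _ _ c x hj).
move=> ph; rewrite -[X in expR (- X / 2)]mul1r -[X in X * qf _ _](expr1n _ 2).
rewrite -(gauss_cos ph 1 v0 h1); apply: eq_Rintegral => w _.
by rewrite linE mul1r.
Qed.

End FieldLaw.

Section Model.
Context (R : realType) (xi : R -> R) (beta h q : R) (N : nat).
Context d (Om : measurableType d) (P : probability Om R).
Context (HN : Om -> N.-tuple R -> R) (HM : Om -> N.-1.-tuple R -> R) (z : Om -> R).
Hypothesis hN : (2 <= N)%N.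
Hypothesis xi1_ge0 : 0 <= derive1n 1 xi q.
Hypothesis gN : gauss_process P HN xi.
Hypothesis gM : gauss_process P HM xi.
Hypothesis cN : forall w, cont_on_sph (HN w).
Hypothesis cM : forall w, cont_on_sph (HM w).
Hypothesis gz : has_law P z (gauss_law 1).
Hypothesis ind : indep3 P (gen_sigma (sph N) (fun x w => HN w x))
           (gen_sigma (sph N.-1) (fun x w => HM w x))
           (gen_sigma [set: unit] (fun _ w => z w)).
Let T := N.-tuple R.
Let xi1 := derive1n 1 xi q.
Let b := b_const xi beta h q.

(** Set to 0 at the poles, which makes it jointly measurable, and bounded for each [w], without
    changing any average. *)
Definition fld (t : R) (w : Om) (x : T) : R := Ht xi beta h q HN HM z t w x * ig x.

(** The derivative in t of the mean of [fld]. *)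
Definition drift (x : T) : R :=
  (h * N.-1%:R * Rhat1 x * (scale x - 1) + 2^-1 * eps x ^+ 2 * b) * ig x.

(** Half the derivative in t of the covariance of [fld], the half coming from exp(- Var / 2). *)
Definition kern (x y : T) : R :=
  beta ^+ 2 / 2 * (N%:R * xi (overlap x y) - N.-1%:R * xi (Rhat2 x y)
   - eps x * eps y * xi1) * (ig x * ig y).

Let mean0 (x : T) : R :=
  h * N.-1%:R * Rhat1 x + h * eps x - 2^-1 * eps x ^+ 2 * b.

Let kern0 (x y : T) : R :=
  beta ^+ 2 / 2 * (N.-1%:R * xi (Rhat2 x y) + eps x * eps y * xi1).

Let sum_hat (x : T) : \sum_(i < N.-1) coord (hat x) i = N.-1%:R * Rhat1 x.
Proof. by rewrite /Rhat1 mulrA divff ?mul1r// gt_eqF// N1_gt0. Qed.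

Let HtE t w x : Ht xi beta h q HN HM z t w x =
  Num.sqrt t * beta * HN w x + Num.sqrt (1 - t) * beta * HM w (hat x)
  + Num.sqrt (1 - t) * beta * Num.sqrt xi1 * eps x * z w
  + (mean0 x + t * (h * N.-1%:R * Rhat1 x * (scale x - 1) + 2^-1 * eps x ^+ 2 * b)).
Proof.
rewrite /Ht -/b -/xi1 -/(scale x) -mulr_suml sum_hat /mean0.
by field.
Qed.

Section Lin.
Variables (cs : seq (R * T)) (t : R).
Hypothesis t01 : 0 < t < 1.
(** At the poles [fld], [drift] and [kern] vanish, so a linear form involves only the remaining
    points, to which the Gaussian hypotheses apply. *)
Let ds := [seq p <- cs | p.2 \in @good R N].

Let ds_good p : p \in ds -> good p.2.
Proof. by rewrite mem_filter => /andP[/set_mem]. Qed.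

Let lin_ds (u v : T -> R) : (forall x, u x = v x * ig x) -> lin u cs = lin v ds.
Proof.
move=> e; rewrite /lin /ds big_filter [RHS]big_mkcond /=; apply: eq_bigr => p _.
case: ifP => [/set_mem gp|/negbT np]; first by rewrite e ig_good// mulr1.
rewrite e ig_bad ?mulr0//; move=> gp; move: np; rewrite mem_set//.
Qed.

Let qf_ds (u v : T -> T -> R) : (forall x y, u x y = v x y * (ig x * ig y)) ->
  qf u cs = qf v ds.
Proof.
move=> e; rewrite /qf /ds big_filter [RHS]big_mkcond /=; apply: eq_bigr => p _.
case: ifP => [/set_mem gp|/negbT np].
  rewrite big_filter [RHS]big_mkcond /=; apply: eq_bigr => p' _.
  case: ifP => [/set_mem gp'|/negbT np']; first by rewrite e !ig_good// !mulr1.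
  by rewrite e (ig_bad (x := p'.2)) ?mulr0// => gp'; move: np'; rewrite mem_set.
by apply: big1 => p' _; rewrite e (ig_bad (x := p.2)) ?mul0r ?mulr0// => gp; move: np; rewrite mem_set.
Qed.

Let cN_ := [seq (Num.sqrt t * beta * p.1, p.2) | p <- ds].
Let cM_ := [seq (Num.sqrt (1 - t) * beta * p.1, hat p.2) | p <- ds].
Let cz_ : R := \sum_(p <- ds) Num.sqrt (1 - t) * beta * Num.sqrt xi1 * eps p.2 * p.1.

Let lin_fld w : lin (fld t w) cs =
  lin (HN w) cN_ + lin (HM w) cM_ + cz_ * z w +
  lin (fun x => mean0 x + t * (h * N.-1%:R * Rhat1 x * (scale x - 1) + 2^-1 * eps x ^+ 2 * b)) ds.
Proof.
rewrite (lin_ds (v := Ht xi beta h q HN HM z t w))//.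
rewrite /lin /cN_ /cM_ !big_map /cz_ mulr_suml -!big_split /=.
by apply: eq_bigr => p _; rewrite HtE; ring.
Qed.

Let t0 : 0 <= t. Proof. by case/andP: t01 => /ltW. Qed.
Let t1 : 0 <= 1 - t. Proof. by case/andP: t01 => _ /ltW; rewrite subr_ge0. Qed.

(** Half the variance is affine in t because the two square-root weights square to t and 1 - t. *)
Let var : (qf (fun x y => N%:R * xi (overlap x y)) cN_ / 2) +
  (qf (fun x y => N.-1%:R * xi (overlap x y)) cM_ / 2) + (cz_ ^+ 2 * 1) / 2 =
  qf kern0 ds + t * qf kern cs.
Proof.
rewrite (qf_ds (u := kern) (v := fun x y => beta ^+ 2 / 2 * (N%:R * xi (overlap x y)
   - N.-1%:R * xi (Rhat2 x y) - eps x * eps y * xi1)))//.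
have -> : cz_ ^+ 2 = \sum_(p <- ds) \sum_(p' <- ds) p.1 * p'.1 *
    ((1 - t) * beta ^+ 2 * xi1 * eps p.2 * eps p'.2).
  rewrite /cz_ expr2 big_distrl /=; apply: eq_bigr => p _.
  rewrite big_distrr /=; apply: eq_bigr => p' _.
  by rewrite -[in RHS](sqr_sqrtr t1) -[xi1 in RHS](sqr_sqrtr xi1_ge0); ring.
rewrite mulr1 /qf /cN_ /cM_ !big_map mulr_sumr !mulr_suml -!big_split /=.
apply: eq_bigr => p _; rewrite !big_map mulr_sumr !mulr_suml -!big_split /=.
apply: eq_bigr => p' _; rewrite /kern0 /Rhat2.
have e1 := sqr_sqrtr t0; have e2 := sqr_sqrtr t1.
transitivity (Num.sqrt t ^+ 2 * (beta ^+ 2 * p.1 * p'.1 * (N%:R * xi (overlap p.2 p'.2)) / 2) +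
  Num.sqrt (1 - t) ^+ 2 * (beta ^+ 2 * p.1 * p'.1 * (N.-1%:R * xi (overlap (hat p.2) (hat p'.2))) / 2) +
  p.1 * p'.1 * ((1 - t) * beta ^+ 2 * xi1 * eps p.2 * eps p'.2) / 2); first by ring.
by rewrite e1 e2; field.
Qed.

Lemma fld_cos_at al : \int[P]_w cos (al + lin (fld t w) cs) =
  expR (- (qf kern0 ds + t * qf kern cs)) *
  cos (al + (lin mean0 ds + t * lin drift cs)).
Proof.
have hcN p : p \in cN_ -> sph N p.2.
  by move=> /mapP[p' /ds_good g' ->] /=; have [] := g'.
have hcM p : p \in cM_ -> sph N.-1 p.2.
  by move=> /mapP[p' /ds_good g' ->] /=; exact: hat_sph.
have [mY1 i1 cY1] := process_cos gN hcN; have [mY2 i2 cY2] := process_cos gM hcM.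
have mY3 : measurable_fun setT (fun w => cz_ * z w).
  by apply: measurable_funM; [exact: measurable_cst|exact: gz.1].
have cY3 ph := gauss_cos (P := P) ph cz_ ler01 gz.
have i3 : rv_in (gen_sigma [set: unit] (fun _ w => z w)) (fun w => cz_ * z w).
  have := @rv_in_lin _ _ _ _ [set: unit] (fun _ w => z w) _ [:: tt] (fun _ => cz_) id
    (fun _ => Logic.I).
  rewrite (_ : (fun w => \sum_(j <- [:: tt]) _) = (fun w => cz_ * z w))//.
  by apply/funext => w; rewrite big_seq1.
under eq_Rintegral do rewrite lin_fld addrCA addrA addrC -addrA addrC.
set A := lin _ ds.
transitivity (\int[P]_w cos (al + A + (lin (HN w) cN_ + lin (HM w) cM_ + cz_ * z w))).
  by apply: eq_Rintegral => w _; congr cos; ring.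
rewrite (cos_indep3 _ (@gen_sigmaT R d Om _ _ _) (@gen_sigmaT R d Om _ _ _) (@gen_sigmaT R d Om _ _ _) ind i1 i2 i3
  mY1 mY2 mY3 cY1 cY2 cY3) -!expRD -!mulNr -!mulrDl.
congr (expR _ * cos _).
  by rewrite -var; ring.
congr (_ + _); rewrite (lin_ds (u := drift) (v := fun x => h * N.-1%:R * Rhat1 x * (scale x - 1)
  + 2^-1 * eps x ^+ 2 * b))//.
by rewrite /A /lin mulr_sumr -big_split /=; apply: eq_bigr => p _; ring.
Qed.

End Lin.

End Model.

(** * Functions bounded off the poles, and regularity of the field *)

Section BoundedOn.
Context (R : realType) d (T : measurableType d) (D : set T).
Implicit Types f g : T -> R.

(** Measurable everywhere but bounded only on [D]: this is what holds for overlaps and coordinates,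
    which become [bm] after multiplication by the indicator. *)
Definition bo f := measurable_fun setT f /\ exists C, forall x, D x -> `|f x| <= C.

Lemma bo_cst (c : R) : bo (fun _ => c).
Proof. by split; [exact: measurable_cst|exists `|c|]. Qed.

Lemma boD f g : bo f -> bo g -> bo (fun x => f x + g x).
Proof.
move=> [mf [C hC]] [mg [C' hC']]; split; first exact: measurable_funD.
by exists (C + C') => x Dx; rewrite (le_trans (ler_normD _ _))// lerD ?hC ?hC'.
Qed.

Lemma boM f g : bo f -> bo g -> bo (fun x => f x * g x).
Proof.
move=> [mf [C hC]] [mg [C' hC']]; split; first exact: measurable_funM.
by exists (C * C') => x Dx; rewrite normrM ler_pM ?hC ?hC'.
Qed.

Lemma boZ (c : R) f : bo f -> bo (fun x => c * f x).
Proof. by move=> bf; apply: boM => //; exact: bo_cst. Qed.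

Lemma boN f : bo f -> bo (fun x => - f x).
Proof. by move=> bf; under eq_fun do rewrite -mulN1r; exact: boZ. Qed.

Lemma boB f g : bo f -> bo g -> bo (fun x => f x - g x).
Proof. by move=> bf bg; apply: boD => //; exact: boN. Qed.

Lemma boX f k : bo f -> bo (fun x => f x ^+ k).
Proof.
move=> bf; elim: k => [|k ih]; first by under eq_fun do rewrite expr0; exact: bo_cst.
by under eq_fun do rewrite exprS; exact: boM.
Qed.

Lemma bo_sum (I : Type) (r : seq I) (P : pred I) (F : I -> T -> R) :
  (forall i, P i -> bo (F i)) -> bo (fun x => \sum_(i <- r | P i) F i x).
Proof.
move=> bF; elim: r => [|i r ih]; first by under eq_fun do rewrite big_nil; exact: bo_cst.
under eq_fun do rewrite big_cons.
by case: (boolP (P i)) => // Pi; apply: boD => //; exact: bF.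
Qed.

Lemma bo_mul_indic (g : T -> R) f : bm g -> (forall x, ~ D x -> g x = 0) -> bo f ->
  bm (fun x => f x * g x).
Proof.
move=> [mg [C hC]] g0 [mf [C' hC']]; split; first exact: measurable_funM.
exists (`|C'| * C) => x; case: (pselect (D x)) => Dx; last first.
  by rewrite g0// mulr0 normr0 mulr_ge0// (le_trans _ (hC x)).
by rewrite normrM ler_pM ?hC// (le_trans (hC' x Dx))// ler_norm.
Qed.

End BoundedOn.

Lemma bo_comp (R : realType) d (T : measurableType d) d' (T' : measurableType d')
    (D : set T) (D' : set T') (f : T' -> R) (g : T -> T') :
  bo D' f -> measurable_fun setT g -> (forall x, D x -> D' (g x)) ->
  bo D (fun x => f (g x)).
Proof.
move=> [mf [C hC]] mg gD; split; first exact: measurableT_comp.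
by exists C => x Dx; apply: hC; exact: gD.
Qed.

Section Overlaps.
Context (R : realType).

Lemma measurableT_coord d (T : measurableType d) M (g : T -> M.-tuple R) i :
  measurable_fun setT g -> measurable_fun setT (fun u => coord (g u) i).
Proof.
move=> mg; apply: (measurableT_comp (f := fun x : M.-tuple R => coord x i)) => //.
exact: measurable_coord.
Qed.

Lemma measurable_overlap M :
  measurable_fun setT (fun z : M.-tuple R * M.-tuple R => overlap z.1 z.2).
Proof.
apply: measurable_funM; first exact: measurable_cst.
apply: measurable_sum => i; apply: measurable_funM.
  exact: (measurableT_coord _ measurable_fst).
exact: (measurableT_coord _ measurable_snd).
Qed.

Lemma overlapC M (x y : M.-tuple R) : overlap x y = overlap y x.
Proof. by rewrite /overlap; congr (_ * _); apply: eq_bigr => i _; rewrite mulrC. Qed.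

Lemma overlap_le1 M (x y : M.-tuple R) : sph M x -> sph M y -> `|overlap x y| <= 1.
Proof.
move=> Sx Sy; have [M0|M0] := posnP M.
  by move: x y Sx Sy; rewrite M0 => x y _ _; rewrite /overlap big_ord0 mulr0 normr0.
have M1 : 0 < M%:R :> R by rewrite ltr0n.
rewrite /overlap normrM gtr0_norm ?invr_gt0// mulrC ler_pdivrMr// mul1r.
have -> : M%:R = \sum_(i < M) (coord x i ^+ 2 + coord y i ^+ 2) / 2.
  by rewrite -mulr_suml big_split /= Sx Sy; field.
rewrite (le_trans (ler_norm_sum _ _ _))//; apply: ler_sum => i _.
rewrite ler_norml; have := sqr_ge0 (coord x i - coord y i).
by have := sqr_ge0 (coord x i + coord y i); lra.
Qed.

(** The mean of the coordinates is the overlap with the all-ones vector, which lies on the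
    sphere. *)
Lemma mean_le1 M (x : M.-tuple R) : sph M x -> `|M%:R^-1 * \sum_(i < M) coord x i| <= 1.
Proof.
move=> Sx.
pose y : M.-tuple R := mktuple (fun _ => 1).
have Sy : sph M y.
  rewrite /sph /=; under eq_bigr do rewrite coord_mktuple expr1n.
  by rewrite sumr_const card_ord.
have := overlap_le1 Sx Sy; rewrite /overlap.
by under eq_bigr do rewrite coord_mktuple mulr1.
Qed.

Context (N : nat).
Hypothesis hN : (2 <= N)%N.
Implicit Types x y : N.-tuple R.

Lemma Rhat2C x y : Rhat2 x y = Rhat2 y x. Proof. exact: overlapC. Qed.

Lemma Rhat2_le1 x y : good x -> good y -> `|Rhat2 x y| <= 1.
Proof. by move=> gx gy; apply: overlap_le1; exact: hat_sph. Qed.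

Lemma Rhat1_le1 x : good x -> `|Rhat1 x| <= 1.
Proof. by move=> gx; apply: mean_le1; exact: hat_sph. Qed.

Lemma eps_bound x : good x -> `|eps x| <= N%:R.
Proof.
move=> [Sx gx]; rewrite -(@ler_pXn2r _ 2)// ?nnegrE// real_normK ?num_real//.
rewrite (le_trans (ltW gx))// expr2 ler_peMl// ler1n.
by case: N hN.
Qed.

Lemma scale_le x : good x -> scale x <= 2.
Proof.
move=> gx; rewrite -(@ler_pXn2r _ 2)// ?nnegrE ?(ltW (scale_gt0 hN gx))//.
rewrite scale_sqr// ler_pdivrMr ?N1_gt0// N1E//.
have N2 : 2 <= N%:R :> R by rewrite ler_nat.
by have := sqr_ge0 (eps x); lra.
Qed.

Let G := @good R N.

Lemma bo_eps : bo G (fun x => eps x).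
Proof. by split; [exact: measurable_eps|exists N%:R => x; exact: eps_bound]. Qed.

Lemma bo_scale : bo G (@scale R N).
Proof.
split; first exact: measurable_scale.
by exists 2 => x gx; rewrite ger0_norm ?scale_le// ltW// scale_gt0.
Qed.

Lemma bo_Rhat1 : bo G (fun x => Rhat1 x).
Proof.
split; last by exists 1 => x; exact: Rhat1_le1.
apply: measurable_funM; first exact: measurable_cst.
apply: measurable_sum => i.
exact: (measurableT_coord _ (@measurable_hat R N)).
Qed.

Lemma bo_Rhat2 : bo (G `*` G) (fun z => Rhat2 z.1 z.2).
Proof.
split; last by exists 1 => z [g1 g2]; exact: Rhat2_le1.
apply: (measurableT_comp (f := fun z : N.-1.-tuple R * N.-1.-tuple R => overlap z.1 z.2)
  (g := fun z : N.-tuple R * N.-tuple R => (hat z.1, hat z.2))).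
  exact: measurable_overlap.
apply: measurable_fun_pair.
  exact: (measurableT_comp (@measurable_hat R N) measurable_fst).
exact: (measurableT_comp (@measurable_hat R N) measurable_snd).
Qed.

Lemma bo_overlap : bo (G `*` G) (fun z => overlap z.1 z.2).
Proof.
split; first exact: measurable_overlap.
by exists 1 => z [[g1 _] [g2 _]]; exact: overlap_le1.
Qed.

Lemma bo_continuous_comp d (T : measurableType d) (D : set T) (f : R -> R) (g : T -> R) :
  continuous f -> bo D g -> bo D (fun u => f (g u)).
Proof.
move=> cf [mg [C hC]]; split.
  by apply: measurableT_comp mg; exact: continuous_measurable_fun.
have cK : compact (f @` `[- C, C]).
  apply: continuous_compact; last exact: segment_compact.
  exact: continuous_subspaceT.
have /compact_bounded[M [_ hM]] := cK.
exists (M + 1) => x Dx; apply: (hM (M + 1)); first by rewrite ltrDl.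
by exists (g x) => //=; rewrite in_itv /= -ler_norml hC.
Qed.

End Overlaps.

Section ModelProperties.
Context (R : realType) (xi : R -> R) (beta h q : R) (N : nat).
Hypothesis hN : (2 <= N)%N.
Hypothesis cxi : continuous xi.
Let T := N.-tuple R.
Let G : set T := @good R N.

Lemma bm_drift : bm (drift xi beta h q (N := N)).
Proof.
apply: (bo_mul_indic (D := G)) => [|x|]; [exact: bm_ig|exact: ig_bad|].
have bR := bo_Rhat1 R hN; have bs := bo_scale R hN; have be := bo_eps R hN.
apply: boD.
  apply: boM; first exact: boZ.
  by apply: boB => //; exact: bo_cst.
apply: boM; last exact: bo_cst.
by apply: boZ; exact: boX.
Qed.

Lemma bm_kern : bm (fun z : T * T => kern xi beta q z.1 z.2).
Proof.
have be1 : bo (G `*` G) (fun z : T * T => eps z.1).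
  by apply: (bo_comp (bo_eps R hN)); [exact: measurable_fst|move=> z []].
have be2 : bo (G `*` G) (fun z : T * T => eps z.2).
  by apply: (bo_comp (bo_eps R hN)); [exact: measurable_snd|move=> z []].
have bo1 := bo_continuous_comp cxi (bo_overlap R N).
have bo2 := bo_continuous_comp cxi (bo_Rhat2 R hN).
apply: (bo_mul_indic (D := G `*` G)) => [|z|].
- apply: bmM; first exact: bm_comp (bm_ig _ _) measurable_fst.
  exact: bm_comp (bm_ig _ _) measurable_snd.
- move=> nz; case: (pselect (good z.1)) => [g1|g1]; last by rewrite ig_bad// mul0r.
  by rewrite (ig_bad (x := z.2)) ?mulr0// => g2; apply: nz.
- apply: boZ; apply: boB; first by apply: boB; exact: boZ.
  by apply: boM; [exact: boM|exact: bo_cst].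
Qed.

Lemma kern_sym (x y : T) : kern xi beta q x y = kern xi beta q y x.
Proof.
by rewrite /kern overlapC (Rhat2C x) [eps x * _]mulrC [ig x * _]mulrC.
Qed.

Context d (Om : measurableType d) (P : probability Om R).
Context (HN : Om -> N.-tuple R -> R) (HM : Om -> N.-1.-tuple R -> R) (z : Om -> R).
Hypothesis gN : gauss_process P HN xi.
Hypothesis gM : gauss_process P HM xi.
Hypothesis cN : forall w, cont_on_sph (HN w).
Hypothesis cM : forall w, cont_on_sph (HM w).
Hypothesis gz : has_law P z (gauss_law 1).

Local Notation fld := (fld xi beta h q HN HM z).

Lemma measurable_process (M : nat) (X : Om -> M.-tuple R -> R) :
  gauss_process P X xi -> (forall w, cont_on_sph (X w)) ->
  measurable_fun setT (fun p : Om * M.-tuple R => X p.1 p.2 * \1_(sph M) p.2).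
Proof.
move=> gX cX; apply: caratheodory; first exact: measurable_sph.
- move=> x Sx.
  have [h1 _ _] := process_cos (cs := [:: (1, x)]) gX
    (fun p => fun hp : p \in [:: (1, x)] => ltac:(move: hp; rewrite inE => /eqP ->; exact: Sx)).
  move: h1; congr measurable_fun; apply/funext => w.
  by rewrite /lin big_seq1 /= mul1r.
- by move=> w x Sx; exact: cX.
Qed.

Lemma measurable_fld (t : R) : measurable_fun setT (fun p : Om * T => fld t p.1 p.2).
Proof.
have m1 := measurable_process gN cN.
have m2 : measurable_fun setT
    (fun p : Om * T => HM p.1 (hat p.2) * \1_(sph N.-1) (hat p.2)).
  apply: (measurableT_comp (f := fun p : Om * N.-1.-tuple R => HM p.1 p.2 * \1_(sph N.-1) p.2)
    (g := fun p : Om * T => (p.1, hat p.2))).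
    exact: measurable_process gM cM.
  apply: measurable_fun_pair; first exact: measurable_fst.
  exact: (measurableT_comp (@measurable_hat R N) measurable_snd).
have ms (f : T -> R) : measurable_fun setT f -> measurable_fun setT (fun p : Om * T => f p.2).
  by move=> mf; exact: (measurableT_comp mf measurable_snd).
have me := ms _ (@measurable_eps R N).
have mz : measurable_fun setT (fun p : Om * T => z p.1).
  exact: (measurableT_comp gz.1 measurable_fst).
(* The inserted indicators, needed by [measurable_process], are 1 on good points, and [ig] hides the
   others. *)
rewrite (_ : (fun p => _) = (fun p : Om * T =>
  (Num.sqrt t * beta * (HN p.1 p.2 * \1_(sph N) p.2) +
   Num.sqrt (1 - t) * beta * (HM p.1 (hat p.2) * \1_(sph N.-1) (hat p.2)) +
   h * \sum_(i < N.-1) coord (hat p.2) i * (1 + t * (scale p.2 - 1))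
  + h * eps p.2 + Num.sqrt (1 - t) * eps p.2 * z p.1 * beta * Num.sqrt (derive1n 1 xi q)
  - 2^-1 * (1 - t) * eps p.2 ^+ 2 * b_const xi beta h q) * ig p.2)); last first.
  apply/funext => -[w x]; rewrite /fld /Ht /=.
  case: (pselect (good x)) => gx; last by rewrite ig_bad// !mulr0.
  by rewrite !indicE !mem_set ?mulr1//; [exact: hat_sph|case: gx].
have c c' : measurable_fun setT (fun _ : Om * T => c' : R) by exact: measurable_cst.
apply: measurable_funM; last first.
  by apply: (ms (@ig R N)); exact: (bm_ig R N).1.
apply: measurable_funB; last first.
  by apply: measurable_funM => //; apply: measurable_funM => //; exact: measurable_funX.
apply: measurable_funD; last first.
  by do 2 (apply: measurable_funM => //); apply: measurable_funM => //; exact: measurable_funM.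
apply: measurable_funD; last exact: measurable_funM.
apply: measurable_funD; last first.
  apply: measurable_funM => //; apply: measurable_sum => i; apply: measurable_funM.
    apply: (ms (fun x => coord (hat x) i)).
    exact: (measurableT_coord _ (@measurable_hat R N)).
  apply: measurable_funD => //; apply: measurable_funM => //.
  by apply: (ms (fun x => scale x - 1)); apply: measurable_funB => //; exact: measurable_scale.
by apply: measurable_funD; exact: measurable_funM.
Qed.

Lemma fld_bounded w : exists B, forall (t : R) x, 0 < t < 1 -> `|fld t w x| <= B.
Proof.
have [C1 h1] := cont_on_sph_bounded (cN w).
have [C2 h2] := cont_on_sph_bounded (cM w).
pose D := [set p : R * T | 0 < p.1 < 1 /\ good p.2].
pose bd (f : R * T -> R) := exists C, forall p, D p -> `|f p| <= C.
have bdc c : bd (fun _ => c) by exists `|c|.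
have bdD f g : bd f -> bd g -> bd (fun p => f p + g p).
  move=> [C hC] [C' hC']; exists (C + C') => p Dp.
  by rewrite (le_trans (ler_normD _ _))// lerD ?hC ?hC'.
have bdM f g : bd f -> bd g -> bd (fun p => f p * g p).
  move=> [C hC] [C' hC']; exists (C * C') => p Dp.
  by rewrite normrM ler_pM ?hC ?hC'.
have bdt : bd (fun p => p.1).
  by exists 1 => p [/andP[p0 p1] _]; rewrite ger0_norm ltW.
have bds : bd (fun p => Num.sqrt p.1).
  exists 1 => p [/andP[p0 p1] _]; rewrite ger0_norm ?sqrtr_ge0//.
  by rewrite -[leRHS]sqrtr1 ler_wsqrtr// ltW.
have bds1 : bd (fun p => Num.sqrt (1 - p.1)).
  exists 1 => p [/andP[p0 p1] _]; rewrite ger0_norm ?sqrtr_ge0//.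
  by rewrite -[leRHS]sqrtr1 ler_wsqrtr// lerBlDr lerDl ltW.
have bde : bd (fun p => eps p.2) by exists N%:R => p [_]; exact: eps_bound.
have bdN : bd (fun p => HN w p.2) by exists C1 => p [_ [Sx _]]; exact: h1.
have bdH : bd (fun p => HM w (hat p.2)).
  by exists C2 => p [_ gx]; apply: h2; exact: hat_sph.
have bdr : bd (fun p => \sum_(i < N.-1) coord (hat p.2) i).
  exists N.-1%:R => p [_ gx]; have := Rhat1_le1 hN gx.
  rewrite /Rhat1 normrM gtr0_norm ?invr_gt0 ?N1_gt0//.
  by rewrite mulrC ler_pdivrMr ?N1_gt0// mul1r.
have bdsc : bd (fun p => scale p.2).
  by exists 2 => p [_ gx]; rewrite ger0_norm ?scale_le// ltW// scale_gt0.
have [B hB] : bd (fun p => Ht xi beta h q HN HM z p.1 w p.2).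
  have e2 p : (2^-1 * (1 - p.1) * eps p.2 ^+ 2 * b_const xi beta h q) =
    2^-1 * (1 + -1 * p.1) * (eps p.2 * eps p.2) * b_const xi beta h q :> R.
    by rewrite mulN1r expr2.
  have -> : (fun p => Ht xi beta h q HN HM z p.1 w p.2) = (fun p : R * T =>
     Num.sqrt p.1 * beta * HN w p.2 + Num.sqrt (1 - p.1) * beta * HM w (hat p.2)
     + h * ((\sum_(i < N.-1) coord (hat p.2) i) * (1 + p.1 * (scale p.2 + -1)))
     + h * eps p.2 + Num.sqrt (1 - p.1) * eps p.2 * z w * beta * Num.sqrt (derive1n 1 xi q)
     + -1 * (2^-1 * (1 + -1 * p.1) * (eps p.2 * eps p.2) * b_const xi beta h q)).
    by apply/funext => p; rewrite /Ht -e2 [X in _ = _ + X]mulN1r -mulr_suml.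
  by repeat first [exact: (bdc) | exact: bdt | exact: bds | exact: bds1 | exact: bde | exact: bdN
    | exact: bdH | exact: bdr | exact: bdsc | apply: (bdD) | apply: (bdM)].
exists `|B| => t x t01; rewrite /fld; case: (pselect (good x)) => gx.
  by rewrite ig_good// mulr1 (le_trans (hB (t, x) (conj t01 gx)))// ler_norm.
by rewrite ig_bad// mulr0 normr0.
Qed.

Lemma fld_cont w x (t : R) : 0 < t < 1 -> {for t, continuous (fun s => fld s w x)}.
Proof.
move=> _; rewrite /fld /Ht.
set S := \sum_(i < N.-1) coord (hat x) i.
rewrite (_ : (fun s => _) = (fun s => Num.sqrt s * (beta * HN w x * ig x) +
  Num.sqrt (1 - s) * (beta * HM w (hat x) * ig x + eps x * z w * beta * Num.sqrt (derive1n 1 xi q) * ig x) +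
  ((h * S + h * eps x - 2^-1 * eps x ^+ 2 * b_const xi beta h q) * ig x +
   s * ((h * S * (scale x - 1) + 2^-1 * eps x ^+ 2 * b_const xi beta h q) * ig x)))); last first.
  by apply/funext => s; rewrite -/(scale x) -mulr_suml -/S; ring.
apply: cvgD.
  apply: cvgD; apply: cvgM; try exact: cvg_cst; first exact: sqrt_continuous.
  apply: (cvg_comp (fun s : R => 1 - s) (@Num.sqrt R)); last exact: sqrt_continuous.
  by apply: cvgB; [exact: cvg_cst|exact: cvg_id].
by apply: cvgD; [exact: cvg_cst|apply: cvgM; [exact: cvg_id|exact: cvg_cst]].
Qed.

End ModelProperties.

(** * The derivative as an average over n + 2 replicas *)

Section Snoc.
Context (R : realType) d (T : measurableType d) (lam : probability T R).
Variables (m1 : T -> R) (U : T -> T -> R) (a : T -> R).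
Hypothesis bm1 : bm m1.
Hypothesis bU : bm (fun z : T * T => U z.1 z.2).
Hypothesis ba : bm a.
Let one (y : T) : R := 1.
Let Z := Tq lam a.

Let bone : bm one. Proof. exact: bm_cst. Qed.

Lemma Wt_rcons (s : seq T) y : Wt a (rcons s y) = Wt a s * a y.
Proof. by rewrite /Wt -cats1 big_cat big_seq1. Qed.

(** Integrating out the last two replicas reproduces the terms of [gQ] multiplied by Z^(n+2): a
    fresh replica absent from a term contributes a factor Z. *)
Lemma snoc2_int (n : nat) (f : n.-tuple T -> R) (F : n.+2.-tuple T -> R) :
  bm f -> bm F ->
  (forall (s : n.-tuple T) y1 y2, F (rcons_tuple (rcons_tuple s y1) y2) =
    f s * (dd m1 U one one s - n%:R * (m1 y1 + U y1 y1 + 2 * \sum_(x <- s) U x y1)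
      + n%:R * n.+1%:R * U y1 y2)) ->
  \int[pw lam n.+2]_s (F s * Wt a s) =
  Z ^+ 2 * \int[pw lam n]_s (f s * (Wt a s * dd m1 U one one s))
  - n%:R * (al lam m1 U a one one * Z * \int[pw lam n]_s (f s * Wt a s) +
            2 * Z * \int[pw lam n]_s (f s * (Wt a s * ell lam U a one s)))
  + n%:R * n.+1%:R * (ga lam U a one * \int[pw lam n]_s (f s * Wt a s)).
Proof.
move=> bf bF hF.
have bW k : bm (fun s : k.-tuple T => Wt a s) by exact: bm_Wt.
have bFW : bm (fun s : n.+2.-tuple T => F s * Wt a s) by apply: bmM.
rewrite E_pw_rcons// E_pw_rcons; last exact: bm_E2 (bm_rcons bFW).
have bUr y : bm (U y) := bm_fst y bU.
have bUl y : bm (fun x => U x y) := bm_snd y bU.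
pose V y1 := \int[lam]_y2 (U y1 y2 * a y2).
have bV : bm V by apply: (bm_E2 lam (f := fun z : T * T => U z.1 z.2 * a z.2)); apply: bmM => //; exact: bm_comp ba measurable_snd.
have bUd : bm (fun y => U y y).
  by apply: (bm_comp bU (g := fun y => (y, y))); exact: measurable_fun_pair.
have inner (s : n.-tuple T) y1 :
    \int[lam]_y2 (F (rcons_tuple (rcons_tuple s y1) y2) * Wt a (rcons_tuple (rcons_tuple s y1) y2)) =
    f s * Wt a s * ((dd m1 U one one s - n%:R * (m1 y1 + U y1 y1 + 2 * \sum_(x <- s) U x y1)) * Z * a y1
     + n%:R * n.+1%:R * (V y1 * a y1)).
  set c1 := dd _ _ _ _ _ - _.
  transitivity (\int[lam]_y2 (f s * Wt a s * a y1 * c1 * a y2 +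
      f s * Wt a s * a y1 * (n%:R * n.+1%:R) * (U y1 y2 * a y2))).
    apply: eq_Rintegral => y2 _; rewrite hF !Wt_rcons /c1; ring.
  rewrite ED ?EZl//; [|exact: bmM|exact: bmZ|by apply: bmZ; exact: bmM].
  rewrite -/(Tq lam a) -/Z /V; ring.
have outer (s : n.-tuple T) : \int[lam]_y1 \int[lam]_y2
    (F (rcons_tuple (rcons_tuple s y1) y2) * Wt a (rcons_tuple (rcons_tuple s y1) y2)) =
    Z ^+ 2 * (f s * (Wt a s * dd m1 U one one s))
    - n%:R * (al lam m1 U a one one * Z * (f s * Wt a s) +
            2 * Z * (f s * (Wt a s * ell lam U a one s)))
    + n%:R * n.+1%:R * (ga lam U a one * (f s * Wt a s)).
  have bee : bm (fun y => \sum_(x <- s) U x y) by apply: bm_sum => x; exact: bUr.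
  transitivity (\int[lam]_y1 (f s * Wt a s * dd m1 U one one s * Z * a y1
    + f s * Wt a s * - n%:R * Z * (a y1 * (m1 y1 * one y1 + U y1 y1 * one y1))
    + f s * Wt a s * - n%:R * 2 * Z * (ee U one s y1 * (a y1 * one y1))
    + f s * Wt a s * (n%:R * n.+1%:R) * (a y1 * one y1 * V y1))).
    apply: eq_Rintegral => y1 _; rewrite inner /ee /one.
    by under [in RHS]eq_bigr do rewrite mul1r; ring.
  have b1 : bm (fun y1 => a y1 * (m1 y1 * one y1 + U y1 y1 * one y1)).
    by apply: bmM => //; apply: bmD; apply: bmM.
  have b2 : bm (fun y1 => ee U one s y1 * (a y1 * one y1)).
    by apply: bmM; [exact: bm_ee|exact: bmM].
  have b3 : bm (fun y1 => a y1 * one y1 * V y1) by apply: bmM => //; exact: bmM.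
  rewrite !ED ?EZl//; do ?[exact: bmZ | apply: bmD].
  rewrite -/(Tq lam a) -/Z -/(al lam m1 U a one one) -/(ell lam U a one s).
  have -> : \int[lam]_x (a x * one x * V x) = ga lam U a one.
    apply: eq_Rintegral => x _; congr (_ * _); apply: eq_Rintegral => y _.
    by rewrite /one mulr1.
  ring.
under eq_Rintegral do rewrite outer.
have b1 : bm (fun s : n.-tuple T => f s * (Wt a s * dd m1 U one one s)).
  by apply: bmM => //; apply: bmM => //; exact: bm_dd.
have b2 : bm (fun s : n.-tuple T => f s * Wt a s) by apply: bmM.
have b3 : bm (fun s : n.-tuple T => f s * (Wt a s * ell lam U a one s)).
  by apply: bmM => //; apply: bmM => //; exact: bm_ell.
rewrite ED ?EB ?EZl ?ED ?EZl//; do ?[exact: bmZ | apply: bmN | apply: bmD | apply: bmZ].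
Qed.

End Snoc.

Section GibbsAverage.
Context (R : realType) d (T : measurableType d) (lam : probability T R).
Context d' (Om : measurableType d') (P : probability Om R).
Variables (X : R -> Om -> T -> R).
Hypothesis mX : forall t : R, 0 < t < 1 ->
  measurable_fun setT (fun z : Om * T => X t z.1 z.2).
Hypothesis X_bounded : forall w, exists B, forall (t : R) x, 0 < t < 1 -> `|X t w x| <= B.
Hypothesis X_cont : forall w x (t : R), 0 < t < 1 -> {for t, continuous (fun s => X s w x)}.
Variable t : R.
Hypothesis t01 : 0 < t < 1.

Let a w (x : T) := expR (X t w x).

Lemma bm_weight w : bm (a w).
Proof.
have [B hB] := X_bounded w; split.
  apply: measurableT_comp; first exact: measurable_expR.
  exact: (measurableT_comp (mX t01) (pair1_measurable w)).
exists (expR B) => x; rewrite gtr0_norm ?expR_gt0// ler_expR.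
exact: le_trans (ler_norm _) (hB t x t01).
Qed.

Lemma Z_gt0 w : 0 < gZ lam X t w.
Proof. exact: (gZ_gt0 lam mX X_bounded t01). Qed.

Definition av k (F : k.-tuple T -> R) w := gW lam X F t w / gZ lam X t w ^+ k.

(** The weight exp(X) is not bounded uniformly in [w], so measurability is inherited from the
    bounded approximations as a pointwise limit. *)
Lemma gW_measurable k (F : k.-tuple T -> R) : bm F ->
  measurable_fun setT (gW lam X F t).
Proof.
move=> bF.
have m n : measurable_fun setT (iW lam X (phi n) F t).
  by have [] := bm_iW lam mX (bm_phi R n) bF t01.
apply: (measurable_fun_cvg m) => w _.
exact: (@iW_gW _ _ _ lam _ _ X mX X_bounded X_cont k F bF (fun=> t) id t t01 (fun=> t01)
  (fun n => leqnn n) (cvg_cst t) w).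
Qed.

Lemma gZ_measurable : measurable_fun setT (gZ lam X t).
Proof.
have m n : measurable_fun setT (iT lam X (phi n) t).
  by have [] := bm_iT lam mX (bm_phi R n) t01.
apply: (measurable_fun_cvg m) => w _.
exact: (@iT_gZ _ _ _ lam _ _ X mX X_bounded X_cont (fun=> t) id t t01 (fun=> t01)
  (fun n => leqnn n) (cvg_cst t) w).
Qed.

Lemma bm_av k (F : k.-tuple T -> R) : bm F -> bm (av F).
Proof.
move=> bF; split.
  rewrite /av (_ : (fun w => _) = (fun w => gW lam X F t w * powR (gZ lam X t w ^+ k) (-1))).
    apply: measurable_funM; first exact: gW_measurable.
    apply: (measurableT_comp (measurable_powR _)).
    by apply: measurable_funX; exact: gZ_measurable.
  by apply/funext => w; rewrite powR_inv1// exprn_ge0// ltW// Z_gt0.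
have [_ [C hC]] := bF; exists (C * 1) => w.
have Zk : 0 < gZ lam X t w ^+ k by rewrite exprn_gt0// Z_gt0.
rewrite /av normrM normfV (gtr0_norm Zk) ler_pdivrMr//.
have := iW_bound lam (bm_weight w) (fun y => ltW (expR_gt0 _)) bF hC
  (bm_cst (k.-tuple T) (1 : R)) (fun s => _).
move=> /(_ 1); rewrite normr1 => /(_ (fun=> lexx _)).
by under eq_Rintegral do rewrite mulr1.
Qed.

Definition Nu k (F : k.-tuple T -> R) := \int[P]_w av F w.

Let bFW k (F : k.-tuple T -> R) w : bm F -> bm (fun s : k.-tuple T => F s * Wt (a w) s).
Proof. by move=> bF; apply: bmM => //; apply: bm_Wt; exact: bm_weight. Qed.

Lemma NuZ k c (F : k.-tuple T -> R) : bm F -> Nu (fun s => c * F s) = c * Nu F.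
Proof.
move=> bF; rewrite /Nu -EZl; last exact: bm_av.
apply: eq_Rintegral => w _; rewrite /av mulrA -EZl; last exact: bFW.
by congr (_ / _); apply: eq_Rintegral => s _; rewrite mulrA.
Qed.

Lemma NuD k (F G : k.-tuple T -> R) : bm F -> bm G ->
  Nu (fun s => F s + G s) = Nu F + Nu G.
Proof.
move=> bF bG; rewrite /Nu -ED; [|exact: bm_av..].
apply: eq_Rintegral => w _; rewrite /av -mulrDl -ED; [|exact: bFW..].
by congr (_ / _); apply: eq_Rintegral => s _; rewrite mulrDl.
Qed.

(** Exchanging two replicas preserves weight and measure, so the integral equals its opposite. *)
Lemma Nu_swap n (F : n.+2.-tuple T -> R) : bm F ->
  (forall (s : n.-tuple T) y1 y2, F (rcons_tuple (rcons_tuple s y1) y2) =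
     - F (rcons_tuple (rcons_tuple s y2) y1)) -> Nu F = 0.
Proof.
have z0 (c : R) : c = - c -> c = 0.
  by move/eqP; rewrite -addr_eq0 -mulr2n mulrn_eq0 => /eqP.
move=> bF hF; rewrite /Nu -[RHS](E_cst P); apply: eq_Rintegral => w _.
rewrite /av (_ : gW lam X F t w = 0) ?mul0r//.
have bFw := bFW w bF.
rewrite /gW /iW E_pw_rcons// E_pw_rcons; last exact: bm_E2 (bm_rcons bFw).
rewrite -[RHS](E_cst (pw lam n)); apply: eq_Rintegral => s _.
pose H (p : T * T) := F (rcons_tuple (rcons_tuple s p.1) p.2) *
  Wt (a w) (rcons_tuple (rcons_tuple s p.1) p.2).
have bH : bm H.
  apply: (bm_comp bFw (g := fun p : T * T => rcons_tuple (rcons_tuple s p.1) p.2)).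
  apply: (measurableT_comp (@measurable_rcons _ T n.+1)
    (g := fun p : T * T => (rcons_tuple s p.1, p.2))).
  apply: measurable_fun_pair => //.
  exact: (measurableT_comp (@measurable_rcons _ T n) (g := fun p : T * T => (s, p.1))
    (measurable_fun_pair (measurable_cst _) measurable_fst)).
have HN p : H (p.2, p.1) = - H p.
  rewrite /H hF mulNr; congr (- (_ * _)).
  by rewrite !Wt_rcons /= mulrAC.
have e := E_fubini lam lam bH.
have e2 : \int[lam]_y \int[lam]_x H (x, y) = - \int[lam]_x \int[lam]_y H (x, y).
  rewrite -mulN1r -EZl; last exact: bm_E2 bH.
  apply: eq_Rintegral => x _; rewrite -EZl; last exact: (bm_fst x bH).
  by apply: eq_Rintegral => y _; rewrite (HN (x, y)) mulN1r.
have : \int[lam]_x \int[lam]_y H (x, y) = - \int[lam]_x \int[lam]_y H (x, y).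
  by rewrite -e2; exact: e.
by move/z0.
Qed.

Variables (m1 : T -> R) (U : T -> T -> R).
Hypothesis bm1 : bm m1.
Hypothesis bU : bm (fun z : T * T => U z.1 z.2).

(** The extra powers of Z in the denominators are read as normalisations of the two fresh
    replicas. *)
Lemma gQ_av n (f : n.-tuple T -> R) (F : n.+2.-tuple T -> R) :
  bm f -> bm F ->
  (forall (s : n.-tuple T) y1 y2, F (rcons_tuple (rcons_tuple s y1) y2) =
    f s * (\sum_(x <- s) m1 x + \sum_(x <- s) \sum_(y <- s) U x y
      - n%:R * (m1 y1 + U y1 y1 + 2 * \sum_(x <- s) U x y1)
      + n%:R * n.+1%:R * U y1 y2)) ->
  \int[P]_w gQ lam m1 U X f t w = Nu F.
Proof.
move=> bf bF hF; apply: eq_Rintegral => w _.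
have Z0 : gZ lam X t w != 0 by rewrite gt_eqF// Z_gt0.
rewrite /av /gW /iW (snoc2_int lam bm1 bU (bm_weight w) bf bF); last first.
  move=> s y1 y2; rewrite hF; congr (_ * (_ - _ + _)); rewrite /dd; congr (_ + _).
    by apply: eq_bigr => x _; ring.
  by apply: eq_bigr => x _; apply: eq_bigr => y _; ring.
have -> : Tq lam (a w) = gZ lam X t w by [].
rewrite /gQ.
rewrite -[al _ _ _ _ _ _]/(gA lam m1 U X t w) -[ga _ _ _ _]/(gG lam U X t w).
rewrite -[\int[_]_s (f s * Wt (a w) s)]/(gW lam X f t w).
rewrite -[\int[_]_s (f s * (Wt _ _ * dd _ _ _ _ _))]/(gD lam m1 U X f t w).
rewrite -[\int[_]_s (f s * (Wt _ _ * ell _ _ _ _ _))]/(gL lam U X f t w).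
have Zn : gZ lam X t w ^+ n != 0 by rewrite expf_neq0.
rewrite !exprS; move: (gZ lam X t w ^+ n) Zn => Q Q0.
move: (gA _ _ _ _ _ _) (gG _ _ _ _ _) (gW _ _ _ _ _) (gD _ _ _ _ _ _ _) (gL _ _ _ _ _ _) => A G W D L.
by rewrite expr0 mulr1; field; rewrite Z0 Q0.
Qed.

End GibbsAverage.

(** * Indexing of replicas and restriction to tuples without poles *)

Section Replicas.
Context (R : realType) (N : nat).
Let T := N.-tuple R.

Lemma rep_rcons k (s : k.-tuple T) y l : (l < k)%N -> rep (rcons_tuple s y) l = rep s l.
Proof. by move=> lk; rewrite /rep /= nth_rcons size_tuple lk. Qed.

Lemma rep_rcons_last k (s : k.-tuple T) y : rep (rcons_tuple s y) k = y.
Proof. by rewrite /rep /= nth_rcons size_tuple ltnn eqxx. Qed.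

Lemma firstn_rcons2 n (s : n.-tuple T) y1 y2 :
  firstn n (rcons_tuple (rcons_tuple s y1) y2) = s.
Proof.
apply: eq_from_tnth => i; rewrite tnth_mktuple !rep_rcons ?ltn_ord//.
  by rewrite /rep -tnth_nth.
by rewrite ltnS ltnW.
Qed.

Lemma measurable_rep k l : (l < k)%N -> measurable_fun setT (fun s : k.-tuple T => rep s l).
Proof.
move=> lk; rewrite (_ : (fun _ => _) = (fun s : k.-tuple T => tnth s (Ordinal lk))).
  exact: measurable_tnth.
by apply/funext => s; rewrite (tnth_nth (nseq_tuple N 0)).
Qed.

Lemma measurable_firstn n k : (n <= k)%N ->
  measurable_fun setT (fun s : k.-tuple T => firstn n s).
Proof.
move=> nk; apply/measurable_fun_tnthP => i.
rewrite (_ : _ \o _ = (fun s : k.-tuple T => rep s i)).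
  by apply: measurable_rep; exact: leq_trans (ltn_ord i) nk.
by apply/funext => s /=; rewrite tnth_mktuple.
Qed.

Lemma sum_rep k (s : k.-tuple T) (F : T -> R) : \sum_(y <- s) F y = \sum_(l < k) F (rep s l).
Proof.
by rewrite big_tuple; apply: eq_bigr => i _; rewrite (tnth_nth (nseq_tuple N 0)).
Qed.

Lemma igs_prod k (s : k.-tuple T) : igs s = \prod_(l < k) ig (rep s l).
Proof.
by rewrite /igs big_tuple; apply: eq_bigr => i _; rewrite (tnth_nth (nseq_tuple N 0)).
Qed.

Lemma igs_good k (s : k.-tuple T) : (forall l, (l < k)%N -> good (rep s l)) -> igs s = 1.
Proof.
by move=> h; rewrite igs_prod; apply: big1 => l _; rewrite ig_good//; exact: h.
Qed.

Lemma igs_bad k (s : k.-tuple T) : ~ (forall l, (l < k)%N -> good (rep s l)) -> igs s = 0.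
Proof.
move=> h; rewrite igs_prod.
have /existsNP[l /not_implyP[lk nl]] := h.
by rewrite (bigD1 (Ordinal lk))//= ig_bad// mul0r.
Qed.

Lemma igs_rcons k (s : k.-tuple T) y : igs (rcons_tuple s y) = igs s * ig y.
Proof. by rewrite /igs /= -cats1 big_cat big_seq1. Qed.

Definition goods k := [set s : k.-tuple T | forall l, (l < k)%N -> good (rep s l)].

Lemma bo_igs k (G : k.-tuple T -> R) : bo (@goods k) G -> bm (fun s => G s * igs s).
Proof.
by move=> bG; apply: (bo_mul_indic (D := @goods k)) => [|s|]; [exact: bm_igs|exact: igs_bad|].
Qed.

Lemma bo_rep1 k l (F : T -> R) : (l < k)%N -> bo (@good R N) F ->
  bo (@goods k) (fun s => F (rep s l)).
Proof. by move=> lk bF; apply: (bo_comp bF (measurable_rep lk)) => s; apply. Qed.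

Lemma bo_rep2 k l l' (F : T * T -> R) : (l < k)%N -> (l' < k)%N ->
  bo (@good R N `*` @good R N) F ->
  bo (@goods k) (fun s => F (rep s l, rep s l')).
Proof.
move=> lk lk' bF; apply: (bo_comp bF).
  by apply: measurable_fun_pair; exact: measurable_rep.
by move=> s hs; split; apply: hs.
Qed.

End Replicas.

(** * Gibbs averages of the model and their derivative *)

Section ModelAverages.
Context (R : realType) (xi : R -> R) (beta h q : R) (N : nat).
Context d (Om : measurableType d) (P : probability Om R).
Context (HN : Om -> N.-tuple R -> R) (HM : Om -> N.-1.-tuple R -> R) (z : Om -> R).
Variable lam : probability (N.-tuple R) R.
Hypothesis hN : (2 <= N)%N.
Hypothesis cxi : continuous xi.
Hypothesis xi1_ge0 : 0 <= derive1n 1 xi q.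
Hypothesis ulam : uniform_on_sphere lam.
Hypothesis gN : gauss_process P HN xi.
Hypothesis gM : gauss_process P HM xi.
Hypothesis cN : forall w, cont_on_sph (HN w).
Hypothesis cM : forall w, cont_on_sph (HM w).
Hypothesis gz : has_law P z (gauss_law 1).
Hypothesis ind : indep3 P (gen_sigma (sph N) (fun x w => HN w x))
           (gen_sigma (sph N.-1) (fun x w => HM w x))
           (gen_sigma [set: unit] (fun _ w => z w)).
Let T := N.-tuple R.
Let X := fld xi beta h q HN HM z.
Let H := Ht xi beta h q HN HM z.
Let m1 : T -> R := drift xi beta h q (N := N).
Let U : T -> T -> R := kern xi beta q (N := N).

Let mX (t : R) : 0 < t < 1 -> measurable_fun setT (fun p : Om * T => X t p.1 p.2).
Proof. by move=> _; exact: (measurable_fld beta h q hN gN gM cN cM gz). Qed.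

Let Xb : forall w, exists B, forall (t : R) x, 0 < t < 1 -> `|X t w x| <= B.
Proof. exact: fld_bounded. Qed.

Let Xc : forall w x (t : R), 0 < t < 1 -> {for t, continuous (fun s => X s w x)}.
Proof. exact: fld_cont. Qed.

Section AtTime.
Variable t : R.
Hypothesis t01 : 0 < t < 1.

Let a w (x : T) := expR (X t w x).
Let ba w : bm (a w). Proof. exact: bm_weight mX Xb t t01 w. Qed.

(** The two weights agree off the poles, which are a null set. *)
Lemma Zt_gZ w : Zt lam xi beta h q HN HM z t w = gZ lam X t w.
Proof.
have e x : expR (H t w x) * ig x = a w x * ig x.
  rewrite /a /X /fld; case: (pselect (good x)) => gx.
    by rewrite ig_good// !mulr1.
  by rewrite ig_bad// !mulr0.
have b1 : bm (fun x => a w x * ig x) by apply: bmM => //; exact: bm_ig.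
rewrite /Zt (Rint_sph hN ulam).
  under eq_Rintegral do rewrite e.
  apply: (E_full (g := @ig R N)) => //.
  - exact: bm_ig.
  - exact: ig01.
  - exact: E_ig.
  - by move=> x; rewrite -mulrA; congr (_ * _); case: (pselect (good x)) => gx;
      [rewrite ig_good ?mulr1|rewrite ig_bad ?mulr0].
by under eq_fun do rewrite e.
Qed.

Lemma igs_weight k (s : k.-tuple T) w :
  expR (\sum_(l < k) H t w (rep s l)) * igs s = Wt (a w) s * igs s.
Proof.
rewrite -(sum_rep s (H t w)); elim: (val s) => [|y r ih]; first by rewrite big_nil expR0 /Wt big_nil.
rewrite big_cons expRD Wt_cons igs_cons.
transitivity (expR (H t w y) * ig y * (expR (\sum_(j <- r) H t w j) * igs r)); first by ring.
rewrite ih.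
have -> : expR (H t w y) * ig y = a w y * ig y.
  rewrite /a /X /fld; case: (pselect (good y)) => gy; first by rewrite ig_good// !mulr1.
  by rewrite ig_bad// !mulr0.
by ring.
Qed.

Lemma gibbs_av k (G : k.-tuple T -> R) w : bm (fun s => G s * igs s) ->
  gibbs lam xi beta h q HN HM z t w G = av lam X t (fun s => G s * igs s) w.
Proof.
move=> bG; rewrite /gibbs Zt_gZ mulrC /av; congr (_ / _).
have e s : G s * expR (\sum_(l < k) H t w (rep s l)) * igs s = G s * igs s * Wt (a w) s.
  by rewrite -mulrA igs_weight; ring.
rewrite (iint_pw hN ulam).
  by apply: eq_Rintegral => s _; rewrite e.
by under eq_fun do rewrite e; apply: bmM => //; exact: bm_Wt.
Qed.

Lemma nu_Nu k (G : k.-tuple T -> R) : bm (fun s => G s * igs s) ->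
  nu P lam xi beta h q HN HM z t G = Nu lam P X t (fun s => G s * igs s).
Proof. by move=> bG; apply: eq_Rintegral => w _; exact: gibbs_av. Qed.

Lemma Nu_igs k (F G : k.-tuple T -> R) : bm F -> bm G ->
  (forall s, F s * igs s = G s * igs s) -> Nu lam P X t F = Nu lam P X t G.
Proof.
move=> bF bG e; apply: eq_Rintegral => w _; rewrite /av; congr (_ / _).
apply: (E_igs_eq hN ulam).
- by apply: bmM => //; apply: bm_Wt; exact: ba.
- by apply: bmM => //; apply: bm_Wt; exact: ba.
- by move=> s; rewrite mulrAC e mulrAC.
Qed.

End AtTime.

(** The integrand of the derivative. Replicas are counted from 0, so positions [n] and [n.+1] are
    the two fresh ones; the double sum over the first n includes the diagonal of the kernel. *)
Definition theta n (s : n.+2.-tuple T) : R :=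
  \sum_(l < n) m1 (rep s l) + \sum_(l < n) \sum_(l' < n) U (rep s l) (rep s l')
  - n%:R * (m1 (rep s n) + U (rep s n) (rep s n) + 2 * \sum_(l < n) U (rep s l) (rep s n))
  + n%:R * n.+1%:R * U (rep s n) (rep s n.+1).

Lemma bm_theta n : bm (@theta n).
Proof.
have b1 l : (l < n.+2)%N -> bm (fun s : n.+2.-tuple T => m1 (rep s l)).
  by move=> ln; apply: bm_comp (measurable_rep ln); exact: bm_drift.
have b2 l l' : (l < n.+2)%N -> (l' < n.+2)%N ->
    bm (fun s : n.+2.-tuple T => U (rep s l) (rep s l')).
  move=> ln ln'.
  apply: (bm_comp (bm_kern beta q hN cxi) (g := fun s : n.+2.-tuple T => (rep s l, rep s l'))).
  by apply: measurable_fun_pair; exact: measurable_rep.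
have ln (l : 'I_n) : (l < n.+2)%N by rewrite ltnS ltnW// ltnS ltnW.
have nn : (n < n.+2)%N by rewrite ltnS.
apply: bmD; last by apply: bmZ; exact: b2.
apply: bmB.
  apply: bmD; first by apply: bm_sum => l; exact: b1.
  by apply: bm_sum => l; apply: bm_sum => l'; exact: b2.
apply: bmZ; apply: bmD; first by apply: bmD; [exact: b1|exact: b2].
by apply: bmZ; apply: bm_sum => l; exact: b2.
Qed.

Lemma nu_derive n (f : n.-tuple T -> R) (t : R) : bm f -> 0 < t < 1 ->
  is_derive t 1 (fun u => nu P lam xi beta h q HN HM z u f)
    (Nu lam P X t (fun s : n.+2.-tuple T => f (firstn n s) * theta s * igs s)).
Proof.
move=> bf t01.
have bfi : bm (fun s => f s * igs s) by apply: bmM => //; exact: bm_igs.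
have bU := bm_kern beta q hN cxi.
have b1 := @bm_drift R xi beta h q N hN.
have D : is_derive t 1 (fun u => \int[P]_w (gW lam X (fun s => f s * igs s) u w / gZ lam X u w ^+ n))
   (\int[P]_w gQ lam m1 U X (fun s => f s * igs s) t w).
  have fc cs : exists V0 M0 : R, forall al u : R, 0 < u < 1 ->
      \int[P]_w cos (al + lin (X u w) cs) =
      expR (- (V0 + u * qf U cs)) * cos (al + (M0 + u * lin m1 cs)).
    do 2 eexists; move=> al u u01.
    exact: (fld_cos_at beta h hN xi1_ge0 gN gM gz ind cs u01).
  exact: (@interpolation R _ _ lam _ Om P m1 U X b1 bU (kern_sym xi beta q (N := N)) mX fc
    Xb Xc n _ bfi t t01).
have -> : Nu lam P X t (fun s : n.+2.-tuple T => f (firstn n s) * theta s * igs s) =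
   \int[P]_w gQ lam m1 U X (fun s => f s * igs s) t w.
  pose F (s : n.+2.-tuple T) := f (firstn n s) * igs (firstn n s) * theta s.
  have mfi : measurable_fun setT (fun s : n.+2.-tuple T => firstn n s).
    by apply: measurable_firstn; rewrite -addn2 leq_addr.
  have bF : bm F by apply: bmM; [exact: (bm_comp bfi mfi)|exact: bm_theta].
  rewrite (gQ_av lam P mX Xb t01 b1 bU bfi bF).
    apply: (Nu_igs t01) => //.
      apply: bmM; last exact: bm_igs.
      by apply: bmM; [exact: (bm_comp bf mfi)|exact: bm_theta].
    move=> s; rewrite /F.
    case: (pselect (forall l, (l < n.+2)%N -> good (rep s l))) => gs.
      have e : igs (firstn n s) = 1.
        apply: igs_good => l ln; rewrite /rep -[l]/(val (Ordinal ln)) -tnth_nth tnth_mktuple.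
        by apply: gs; rewrite ltnS ltnW// ltnS ltnW.
      by rewrite e (igs_good gs) !mulr1.
    by rewrite (igs_bad gs) !mulr0.
  move=> s y1 y2; rewrite /F firstn_rcons2 /theta; congr (_ * _).
  have e1 : rep (rcons_tuple (rcons_tuple s y1) y2) n = y1.
    by rewrite rep_rcons// rep_rcons_last.
  have e2 : rep (rcons_tuple (rcons_tuple s y1) y2) n.+1 = y2 by rewrite rep_rcons_last.
  have e3 (l : 'I_n) : rep (rcons_tuple (rcons_tuple s y1) y2) l = rep s l.
    by rewrite !rep_rcons// ltnS ltnW.
  rewrite e1 e2 !sum_rep; congr (_ + _ - _ * (_ + _ * _) + _).
  - by apply: eq_bigr => l _; rewrite e3.
  - by apply: eq_bigr => l _; rewrite sum_rep; apply: eq_bigr => l' _; rewrite !e3.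
  - by apply: eq_bigr => l _; rewrite e3.
apply: (is_d_near_itv t01 _ D) => u u01.
by rewrite (nu_Nu u01 bfi).
Qed.

End ModelAverages.

(** * Taylor expansion of drift and kernel at overlap q *)

Section Taylor.
Context (R : realType).

Lemma lipschitz11 (f df : R -> R) (K x y : R) :
  (forall x : R, is_derive x 1 f (df x)) -> (forall x, `|x| <= 1 -> `|df x| <= K) ->
  `|x| <= 1 -> `|y| <= 1 -> `|f y - f x| <= K * `|y - x|.
Proof.
move=> fdf dfK.
have cf (u v : R) : {within `[u, v], continuous f}.
  apply: continuous_subspaceT => u'.
  by apply: differentiable_continuous; apply/derivable1_diffP; have [] := fdf u'.
have key (u v : R) : u < v -> `|u| <= 1 -> `|v| <= 1 -> `|f v - f u| <= K * `|v - u|.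
  move=> uv u1 v1.
  have [c cI ->] := MVT uv (fun x _ => fdf x) (cf u v).
  rewrite normrM ler_wpM2r//; apply: dfK.
  move: cI u1 v1; rewrite in_itv /= !ler_norml => /andP[uc cv] /andP[a b] /andP[a' b'].
  by apply/andP; split; lra.
move=> x1 y1; have [xy|xy|->] := ltgtP x y; first exact: key.
  by rewrite distrC (distrC y); exact: key.
by rewrite !subrr normr0 mulr0.
Qed.

(** Mean value theorem for [f], then the Lipschitz bound for [df]: this gives the constant K rather
    than K / 2, from bounds on [-1, 1] only. *)
Lemma taylor11 (f df ddf : R -> R) (K x y : R) :
  (forall x : R, is_derive x 1 f (df x)) -> (forall x : R, is_derive x 1 df (ddf x)) ->
  (forall x, `|x| <= 1 -> `|ddf x| <= K) ->
  `|x| <= 1 -> `|y| <= 1 -> `|f y - f x - df x * (y - x)| <= K * (y - x) ^+ 2.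
Proof.
move=> fdf dfddf ddfK x1 y1.
pose a := Num.min x y; pose c := Num.max x y.
have cg (u v : R) : {within `[u, v], continuous f}.
  apply: continuous_subspaceT => u'.
  by apply: differentiable_continuous; apply/derivable1_diffP; have [] := fdf u'.
have [c' [c'1 c'x e]] : exists c' : R, [/\ `|c'| <= 1, `|c' - x| <= `|y - x| &
    f y - f x = df c' * (y - x)].
  have [xy|xy|->] := ltgtP x y.
  - have [k kI e] := MVT xy (fun x _ => fdf x) (cg x y); exists k.
    move: kI x1 y1; rewrite in_itv /= !ler_norml => /andP[h1 h2] /andP[h3 h4] /andP[h5 h6].
    split=> //; first by apply/andP; split; lra.
    by rewrite (gtr0_norm (_ : 0 < y - x)) ?subr_gt0//; lra.
  - have [k kI e] := MVT xy (fun x _ => fdf x) (cg y x); exists k.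
    move: kI x1 y1; rewrite in_itv /= !ler_norml => /andP[h1 h2] /andP[h3 h4] /andP[h5 h6].
    split=> //; first by apply/andP; split; lra.
      by rewrite (ltr0_norm (_ : y - x < 0)) ?subr_lt0//; lra.
    by rewrite -opprB e; ring.
  - by exists y; rewrite !subrr normr0 mulr0; split.
rewrite e -mulrBl normrM -(real_normK (num_real (y - x))) expr2 mulrA ler_wpM2r//.
apply: le_trans (lipschitz11 dfddf ddfK x1 c'1) _.
have K0 : 0 <= K by exact: le_trans (normr_ge0 _) (ddfK _ x1).
by rewrite ler_wpM2l.
Qed.

Lemma bounded11 (f : R -> R) : continuous f -> exists2 K, 0 <= K & forall x, `|x| <= 1 -> `|f x| <= K.
Proof.
move=> cf.
have cK : compact (f @` `[- 1, 1]).
  by apply: continuous_compact; [exact: continuous_subspaceT|exact: segment_compact].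
have /compact_bounded[M [_ hM]] := cK.
exists (`|M| + 1) => [|x x1]; first by rewrite addr_ge0.
apply: (hM (`|M| + 1)); first by rewrite (le_lt_trans (ler_norm M))// ltrDl.
by exists x => //=; rewrite in_itv /= -ler_norml.
Qed.

Variable xi : R -> R.
Hypothesis C3xi : C3 xi.
Let x1 := derive1n 1 xi.
Let x2 := derive1n 2 xi.
Let x3 := derive1n 3 xi.

Let isd (f : R -> R) (x : R) : derivable f x 1 -> is_derive x 1 f (derive1 f x).
Proof. by move=> df; apply: DeriveDef => //; rewrite derive1E. Qed.

Lemma C3_d1 (x : R) : is_derive x 1 xi (x1 x).
Proof. by have [h _] := C3xi; exact: isd. Qed.

Lemma C3_d2 (x : R) : is_derive x 1 x1 (x2 x).
Proof. by have [_ [h _]] := C3xi; exact: isd. Qed.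

Lemma C3_d3 (x : R) : is_derive x 1 x2 (x3 x).
Proof. by have [_ [_ [h _]]] := C3xi; exact: isd. Qed.

Let isc (f df : R -> R) : (forall x : R, is_derive x 1 f (df x)) -> continuous f.
Proof.
by move=> fdf x; apply: differentiable_continuous; apply/derivable1_diffP; have [] := fdf x.
Qed.

Lemma C3_continuous : continuous xi. Proof. exact: isc C3_d1. Qed.

Lemma C3_bounds : exists K : R, [/\ 0 <= K, (forall x, `|x| <= 1 -> `|x1 x| <= K),
  (forall x, `|x| <= 1 -> `|x2 x| <= K) & (forall x, `|x| <= 1 -> `|x3 x| <= K)].
Proof.
have [_ [_ [_ c3]]] := C3xi.
have [K1 p1 h1] := bounded11 (isc C3_d2).
have [K2 p2 h2] := bounded11 (isc C3_d3).
have [K3 p3 h3] := bounded11 c3.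
exists (K1 + K2 + K3); split; first by rewrite !addr_ge0.
- by move=> x /h1 h; rewrite (le_trans h)// -addrA lerDl addr_ge0.
- by move=> x /h2 h; rewrite (le_trans h)// addrAC lerDr addr_ge0.
- by move=> x /h3 h; rewrite (le_trans h)// lerDr addr_ge0.
Qed.

End Taylor.

Section KernelExpansion.
Context (R : realType) (xi : R -> R) (beta h q : R) (N : nat).
Hypothesis C3xi : C3 xi.
Hypothesis hN : (2 <= N)%N.
Hypothesis q01 : 0 <= q < 1.
Variable K : R.
Let x1 := derive1n 1 xi.
Let x2 := derive1n 2 xi.
Let x3 := derive1n 3 xi.
Hypothesis K0 : 0 <= K.
Hypothesis K1 : forall x, `|x| <= 1 -> `|x1 x| <= K.
Hypothesis K2 : forall x, `|x| <= 1 -> `|x2 x| <= K.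
Hypothesis K3 : forall x, `|x| <= 1 -> `|x3 x| <= K.
Let T := N.-tuple R.
Let M : R := N.-1%:R.
Implicit Types x y : T.

Let N0 : 0 < N%:R :> R. Proof. exact: N_gt0. Qed.
Let M0 : 0 < M. Proof. exact: N1_gt0. Qed.
Let ME : M = N%:R - 1. Proof. exact: N1E. Qed.
Let M1 : 1 <= M. Proof. by rewrite /M ler1n; case: N hN => [|[]]. Qed.
Let N2M : N%:R <= 2 * M. Proof. by rewrite ME; have := M1; rewrite ME; lra. Qed.

(** scale^2 = 1 + u exactly, so the expansions of [scale x] and [scale x * scale y] below are
    identities whose error terms are squares. *)
Let u x : R := (1 - eps x ^+ 2) / M.

Let sE x : good x -> scale x ^+ 2 = 1 + u x.
Proof. by move=> gx; rewrite scale_sqr// -/M /u; field: ME; rewrite gt_eqF. Qed.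

Let s1 x : good x -> `|scale x - 1| <= `|u x|.
Proof.
move=> gx; have s0 := scale_gt0 hN gx.
have -> : u x = (scale x - 1) * (scale x + 1) by have := sE gx; lra.
by rewrite normrM ler_peMr// ger0_norm; lra.
Qed.

Let s2 x : good x -> scale x - 1 = u x / 2 - (scale x - 1) ^+ 2 / 2.
Proof. by move=> gx; have := sE gx; lra. Qed.

Let ss x y : good x -> good y ->
  scale x * scale y = 1 + (u x + u y) / 2 - (scale x - scale y) ^+ 2 / 2.
Proof. by move=> gx gy; have := sE gx; have := sE gy; lra. Qed.

Let e4 x : eps x ^+ 4 = (eps x ^+ 2) ^+ 2. Proof. by rewrite -exprM. Qed.

Let MuE x : M * u x ^+ 2 = (1 - eps x ^+ 2) ^+ 2 / M.
Proof. by rewrite /u; field; rewrite gt_eqF. Qed.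

Let invM : M^-1 <= 2 / N%:R.
Proof. by rewrite ler_pdivlMr// mulrC ler_pdivrMr. Qed.

Let Mu1 x : M * u x ^+ 2 <= 2 / N%:R * (1 + eps x ^+ 4).
Proof.
rewrite MuE e4; have := sqr_ge0 (eps x); move: (eps x ^+ 2) => e e0.
have h1 : (1 - e) ^+ 2 <= 1 + e ^+ 2 by nra.
rewrite mulrC; apply: ler_pM => //; [by rewrite invr_ge0 ltW|exact: sqr_ge0].
Qed.

(** Relies on eps^2 < N. There is no factor 1/N, but the bound is linear in eps^2: squared, it stays
    at the fourth power of eps, where [Mu1] would reach the eighth. *)
Let Mu2 x : good x -> M * u x ^+ 2 <= 1 + eps x ^+ 2.
Proof.
move=> [_ gx]; rewrite MuE; have := sqr_ge0 (eps x); move: (eps x ^+ 2) gx => e eN e0.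
rewrite ler_pdivrMr//; have := ME; have := M1; move: M => m; nra.
Qed.

(** Only h M Rhat (scale - 1) needs expansion: its main part is h/2 (1 - eps^2) Rhat, and writing
    Rhat = (Rhat - r) + r produces the constant and an additional eps^2 term. *)
Lemma drift_expand x : good x ->
  `|drift xi beta h q x - (h / 2 * (a1 x * (Rhat1 x - h * (1 - q)))
     + h * (h * (1 - q)) / 2 + 2^-1 * (b_const xi beta h q - h * (h * (1 - q))) * eps x ^+ 2)|
  <= `|h| / N%:R * (1 + eps x ^+ 4).
Proof.
move=> gx; rewrite /drift ig_good// mulr1 s2// /a1 -/M.
set b := b_const _ _ _ _; set r := h * (1 - q).
have Mu : M * u x = 1 - eps x ^+ 2 by rewrite /u mulrC divfK// gt_eqF.
set X := (X in `|X| <= _).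
have -> : X = - (h * Rhat1 x * (M * (scale x - 1) ^+ 2)) / 2.
  have ee : eps x ^+ 2 = 1 - M * u x by rewrite Mu; ring.
  by rewrite /X ee; field.
have R1 := Rhat1_le1 hN gx.
have sq : M * (scale x - 1) ^+ 2 <= 2 / N%:R * (1 + eps x ^+ 4).
  apply: le_trans (Mu1 x); rewrite ler_pM2l// -(real_normK (num_real (scale x - 1))).
  by rewrite -(real_normK (num_real (u x))) lerXn2r ?nnegrE// s1.
have Y0 : 0 <= M * (scale x - 1) ^+ 2 by apply: mulr_ge0; [exact: ltW|exact: sqr_ge0].
move: (Rhat1 x) (M * (scale x - 1) ^+ 2) R1 sq Y0 => r1 Y R1 sq Y0.
rewrite mulNr normrN !normrM (ger0_norm Y0) (ger0_norm (_ : 0 <= 2^-1))// ler_pdivrMr//.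
have -> : `|h| / N%:R * (1 + eps x ^+ 4) * 2 = `|h| * 1 * (2 / N%:R * (1 + eps x ^+ 4)) by ring.
by apply: ler_pM => //; exact: ler_wpM2l.
Qed.

Section Pair.
Variables x y : T.
Hypotheses (gx : good x) (gy : good y).
Let e := eps x ^+ 2.
Let e' := eps y ^+ 2.
Let Rf := overlap x y.
Let Rh := Rhat2 x y.
Let rho := Rh - q.
(** N times the change of overlap caused by the last coordinate; [A] is its leading part. *)
Let D := N%:R * (Rf - Rh).
Let A := - 2^-1 * (e + e') * Rh + eps x * eps y.
Let A4 := 1 + eps x ^+ 4 + eps y ^+ 4.

Let overlapE : N%:R * Rf = scale x * scale y * M * Rh + eps x * eps y.
Proof.
rewrite /Rf /overlap mulrA divff ?mul1r ?gt_eqF//.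
rewrite (sum_last (fun i => coord x i * coord y i)); last by case: N hN.
congr (_ + _); rewrite /Rh /Rhat2 /overlap -/M mulrA mulfK ?gt_eqF//.
rewrite mulr_sumr; apply: eq_bigr => i _.
by rewrite (coord_scale hN i gx) (coord_scale hN i gy); ring.
Qed.

Let e_ge0 : 0 <= e. Proof. exact: sqr_ge0. Qed.
Let e'_ge0 : 0 <= e'. Proof. exact: sqr_ge0. Qed.
Let A4E : A4 = 1 + e ^+ 2 + e' ^+ 2. Proof. by rewrite /A4 !e4. Qed.
Let Rh1 : `|Rh| <= 1. Proof. exact: Rhat2_le1. Qed.
Let Rf1 : `|Rf| <= 1. Proof. by apply: overlap_le1; [case: gx|case: gy]. Qed.
Let q1 : `|q| <= 1. Proof. by rewrite ler_norml; move: q01; lra. Qed.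

(** By [ss] the difference is exactly - M (scale x - scale y)^2 / 2 times [Rh]. *)
Let DA : `|D - A| <= M * u x ^+ 2 + M * u y ^+ 2.
Proof.
have Mux : M * u x = 1 - e by rewrite /u mulrC divfK// gt_eqF.
have Muy : M * u y = 1 - e' by rewrite /u mulrC divfK// gt_eqF.
have -> : D - A = - (M * ((scale x - scale y) ^+ 2 / 2) * Rh).
  rewrite /D mulrBr overlapE ss//.
  have -> : N%:R = M + 1 by rewrite ME subrK.
  have -> : (1 + (u x + u y) / 2 - (scale x - scale y) ^+ 2 / 2) * M * Rh =
    (M + (M * u x + M * u y) / 2 - M * ((scale x - scale y) ^+ 2 / 2)) * Rh by ring.
  by rewrite Mux Muy /A; field.
have sxy : (scale x - scale y) ^+ 2 / 2 <= u x ^+ 2 + u y ^+ 2.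
  have h1 : (scale x - 1) ^+ 2 <= u x ^+ 2.
    rewrite -(real_normK (num_real (scale x - 1))) -(real_normK (num_real (u x))).
    by rewrite lerXn2r ?nnegrE// s1.
  have h2 : (scale y - 1) ^+ 2 <= u y ^+ 2.
    rewrite -(real_normK (num_real (scale y - 1))) -(real_normK (num_real (u y))).
    by rewrite lerXn2r ?nnegrE// s1.
  move: h1 h2; move: (scale x) (scale y) (u x ^+ 2) (u y ^+ 2) => a b c d' h1 h2.
  by have := sqr_ge0 (a + b - 2); nra.
rewrite normrN normrM -mulrDr -[leRHS]mulr1 ler_pM//.
rewrite ger0_norm; first by rewrite ler_pM2l.
by apply: mulr_ge0; [exact: ltW|apply: divr_ge0 => //; exact: sqr_ge0].
Qed.

Let DA1 : `|D - A| <= 4 / N%:R * A4.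
Proof.
rewrite (le_trans DA)// (le_trans (lerD (Mu1 x) (Mu1 y)))// -mulrDr.
have -> : 4 / N%:R * A4 = 2 / N%:R * (2 * A4) by ring.
have n2 : 0 <= 2 / N%:R :> R by apply: divr_ge0 => //; exact: ltW.
rewrite ler_wpM2l// /A4 !e4.
by move: (eps x ^+ 2) (eps y ^+ 2) => a b; have := sqr_ge0 a; have := sqr_ge0 b; lra.
Qed.

Let A_le : `|A| <= e + e'.
Proof.
have h1 : `|eps x * eps y| <= 2^-1 * (e + e').
  rewrite ler_norml /e /e'; have := sqr_ge0 (eps x - eps y).
  by have := sqr_ge0 (eps x + eps y); lra.
have h2 : `|- 2^-1 * (e + e') * Rh| <= 2^-1 * (e + e').
  have e0 : 0 <= 2^-1 * (e + e') by apply: mulr_ge0 => //; exact: addr_ge0.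
  by rewrite !mulNr normrN normrM (ger0_norm e0) ler_piMr.
rewrite /A (le_trans (ler_normD _ _))// (le_trans (lerD h2 h1))//; lra.
Qed.

Let D2 : D ^+ 2 <= 12 * A4.
Proof.
have h1 : `|D| <= 2 * (1 + e + e').
  have -> : D = D - A + A by rewrite subrK.
  have := lerD DA A_le; have := Mu2 gx; have := Mu2 gy; rewrite -/e -/e'.
  have := ler_normD (D - A) A; lra.
rewrite -(real_normK (num_real D)) A4E.
have h2 : `|D| ^+ 2 <= (2 * (1 + e + e')) ^+ 2.
  by rewrite lerXn2r ?nnegrE// mulr_ge0// !addr_ge0.
apply: le_trans h2 _.
(* 12 = 4 * 3, the 3 coming from Cauchy-Schwarz for three terms. *)
have gen (a b : R) : 0 <= a -> 0 <= b -> (2 * (1 + a + b)) ^+ 2 <= 12 * (1 + a ^+ 2 + b ^+ 2).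
  by move=> a0 b0; have := sqr_ge0 (a - b); have := sqr_ge0 (a - 1); have := sqr_ge0 (b - 1); nra.
exact: gen.
Qed.

(** The factor N in front of xi Rf - xi Rh turns the Taylor error into K D^2 / N; 12 from [D2] and 4
    from [DA1] make 16. *)
Let E1 : `|N%:R * xi Rf - M * xi Rh - xi Rh - x1 Rh * A| <= 16 * K / N%:R * A4.
Proof.
have tay := taylor11 (C3_d1 C3xi) (C3_d2 C3xi) K2 Rh1 Rf1.
have -> : N%:R * xi Rf - M * xi Rh - xi Rh - x1 Rh * A =
    N%:R * (xi Rf - xi Rh - x1 Rh * (Rf - Rh)) + x1 Rh * (D - A).
  by rewrite /D ME; ring.
have -> : 16 * K / N%:R * A4 = K / N%:R * (12 * A4) + K * (4 / N%:R * A4) by ring.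
rewrite (le_trans (ler_normD _ _))// lerD//.
  rewrite normrM gtr0_norm//.
  have -> : K / N%:R * (12 * A4) = N%:R * (K * (12 * A4 / N%:R ^+ 2)).
    by field; rewrite gt_eqF.
  rewrite ler_pM2l// (le_trans tay)// ler_wpM2l// ler_pdivlMr ?exprn_gt0//.
  by rewrite -exprMn mulrC -/D.
by rewrite normrM; apply: ler_pM; [exact: normr_ge0|exact: normr_ge0|exact: K1|exact: DA1].
Qed.

(** [Rh] = q + rho also occurs in [A], so three terms are quadratic in rho: two Taylor errors and
    the product of x2 q rho with - (e + e') rho / 2. *)
Let E2 : `|xi Rh + x1 Rh * A - (xi q + x1 q * rho - 2^-1 * (e + e') * (q * x1 q + (x1 q + q * x2 q) * rho)
     + eps x * eps y * (x1 q + x2 q * rho))| <= 2 * K * (1 + e + e') * rho ^+ 2.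
Proof.
have T1 := taylor11 (C3_d1 C3xi) (C3_d2 C3xi) K2 q1 Rh1.
have T2 := taylor11 (C3_d2 C3xi) (C3_d3 C3xi) K3 q1 Rh1.
rewrite -/rho in T1 T2.
set X := (X in `|X| <= _).
have -> : X = (xi Rh - xi q - x1 q * rho) - 2^-1 * (e + e') * (x2 q * rho ^+ 2)
    + (x1 Rh - x1 q - x2 q * rho) * A.
  have -> : A = - 2^-1 * (e + e') * (q + rho) + eps x * eps y.
    by rewrite /A /rho addrC [q + _]addrC subrK addrC.
  by rewrite /X; have -> : A = - 2^-1 * (e + e') * (q + rho) + eps x * eps y;
     [rewrite /A /rho [q + _]addrC subrK|ring].
have r2 := sqr_ge0 rho.
have h2 : `|2^-1 * (e + e') * (x2 q * rho ^+ 2)| <= 2^-1 * (e + e') * (K * rho ^+ 2).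
  rewrite normrM (ger0_norm (_ : 0 <= 2^-1 * (e + e'))); last by rewrite mulr_ge0// addr_ge0.
  rewrite ler_wpM2l//; first by rewrite mulr_ge0// addr_ge0.
  by rewrite normrM (ger0_norm r2) ler_wpM2r// K2.
have h3 : `|(x1 Rh - x1 q - x2 q * rho) * A| <= K * rho ^+ 2 * (e + e').
  by rewrite normrM; apply: ler_pM; [exact: normr_ge0|exact: normr_ge0|exact: T2|exact: A_le].
rewrite (le_trans (ler_normD _ _))// (le_trans (lerD (ler_normB _ _) (lexx _)))//.
rewrite (le_trans (lerD (lerD T1 h2) h3))//.
have k1 : 0 <= K * rho ^+ 2 by rewrite mulr_ge0.
have k2 : 0 <= K * rho ^+ 2 * (e + e') by rewrite mulr_ge0// addr_ge0.
lra.
Qed.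

(** The part eps x eps y xi'(q) cancels against the contribution of the variable z to the
    covariance; what remains at order zero in the overlap involves the last coordinates only through
    their squares. *)
Lemma kern_expand : `|kern xi beta q x y - (beta ^+ 2 / 2 * xi q
    - beta ^+ 2 / 4 * (eps x ^+ 2 + eps y ^+ 2) * (q * derive1n 1 xi q)
    + beta ^+ 2 * (a2 xi q x y * (Rhat2 x y - q)))|
  <= beta ^+ 2 * K * (8 / N%:R * (1 + eps x ^+ 4 + eps y ^+ 4)
       + (1 + eps x ^+ 2 + eps y ^+ 2) * (Rhat2 x y - q) ^+ 2).
Proof.
rewrite /kern !ig_good// !mulr1 -/M -/Rf -/Rh -/rho -/e -/e' -/A4 -/x1.
set X := (X in `|X| <= _).
have -> : X = beta ^+ 2 / 2 * ((N%:R * xi Rf - M * xi Rh - xi Rh - x1 Rh * A) +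
  (xi Rh + x1 Rh * A - (xi q + x1 q * rho - 2^-1 * (e + e') * (q * x1 q + (x1 q + q * x2 q) * rho)
     + eps x * eps y * (x1 q + x2 q * rho)))).
  by rewrite /X /a2 -/x1 -/x2 -/e -/e'; field.
have b0 := sqr_ge0 beta.
rewrite normrM ger0_norm ?divr_ge0//.
have -> : beta ^+ 2 * K * (8 / N%:R * A4 + (1 + e + e') * rho ^+ 2) =
  beta ^+ 2 / 2 * (16 * K / N%:R * A4 + 2 * K * (1 + e + e') * rho ^+ 2) by field; rewrite gt_eqF.
rewrite ler_wpM2l ?divr_ge0//.
by rewrite (le_trans (ler_normD _ _))//; apply: lerD; [exact: E1|exact: E2].
Qed.

End Pair.

(** Both self-overlaps equal 1, which is not close to q, so the diagonal is computed exactly instead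
    of expanded. *)
Lemma kern_diag x : good x ->
  kern xi beta q x x = beta ^+ 2 / 2 * (xi 1 - eps x ^+ 2 * derive1n 1 xi q).
Proof.
move=> gx.
have o1 P (v : P.-tuple R) : (0 < P)%N -> sph P v -> overlap v v = 1.
  move=> P0 Sv; rewrite /overlap; under eq_bigr do rewrite -expr2.
  by rewrite Sv mulVf// pnatr_eq0 -lt0n.
have ox : overlap x x = 1 by apply: o1; [case: N hN|case: gx].
have oh : overlap (hat x) (hat x) = 1 by apply: o1; [case: N hN => [|[]]|exact: hat_sph].
by rewrite /kern !ig_good// !mulr1 /Rhat2 ox oh -/M ME; ring.
Qed.

End KernelExpansion.

(** * Cancellation in the replica sums and the bound on the remainder *)

Section Remainder.
Context (R : realType).

Lemma sum_offdiag (n : nat) (W : nat -> nat -> R) : (forall l l', W l l' = W l' l) ->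
  \sum_(l < n) \sum_(l' < n | l' != l) W l l' = 2 * \sum_(l < n) \sum_(l' < n | (l < l')%N) W l l'.
Proof.
move=> sW.
have -> : \sum_(l < n) \sum_(l' < n | l' != l) W l l' =
    \sum_(l < n) (\sum_(l' < n | (l < l')%N) W l l' + \sum_(l' < n | (l' < l)%N) W l l').
  apply: eq_bigr => l _; rewrite (bigID (fun l' : 'I_n => (l < l')%N)) /=; congr (_ + _).
    by apply: eq_bigl => l'; rewrite -(inj_eq val_inj) /=; case: ltngtP.
  by apply: eq_bigl => l'; rewrite -(inj_eq val_inj) /=; case: ltngtP.
rewrite big_split /= mulr2n mulrDl !mul1r; congr (_ + _).
under eq_bigr do rewrite big_mkcond.
rewrite exchange_big; apply: eq_bigr => l _ /=.
by rewrite -big_mkcond; apply: eq_bigr => l' _; exact: sW.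
Qed.

(** The condition c1 + 2 k1 = k2 makes the coefficient of the sum of e over the first n replicas
    vanish. The constants cancel by counting, and only n(n+1) k1 (e n - e n.+1) is left, which the
    last term on the left-hand side compensates. *)
Lemma theta_expand (n : nat) (m D g e : nat -> R) (U V W : nat -> nat -> R)
    (c0 c1 k0 k1 k2 k3 : R) : c1 + 2 * k1 = k2 ->
  (forall l l', W l l' = W l' l) ->
  (forall l, (l < n.+2)%N -> m l = g l + c0 + c1 * e l + D l) ->
  (forall l, (l < n.+2)%N -> U l l = k3 - k2 * e l) ->
  (forall l l', (l < n.+2)%N -> (l' < n.+2)%N -> l != l' ->
    U l l' = k0 - k1 * (e l + e l') + W l l' + V l l') ->
  \sum_(l < n) m l + \sum_(l < n) \sum_(l' < n) U l l'
    - n%:R * (m n + U n n + 2 * \sum_(l < n) U l n) + n%:R * n.+1%:R * U n n.+1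
    + n%:R * n.+1%:R * k1 * (e n.+1 - e n)
  = \sum_(l < n) g l - n%:R * g n + 2 * (\sum_(l < n) \sum_(l' < n | (l < l')%N) W l l')
    - 2 * n%:R * (\sum_(l < n) W l n) + n%:R * n.+1%:R * W n n.+1
    + (\sum_(l < n) D l - n%:R * D n + \sum_(l < n) \sum_(l' < n | l' != l) V l l'
      - 2 * n%:R * (\sum_(l < n) V l n) + n%:R * n.+1%:R * V n n.+1).
Proof.
move=> ck sW hm hd hU.
have ln (l : 'I_n) : (l < n.+2)%N by rewrite ltnS ltnW// ltnS ltnW.
have nn : (n < n.+2)%N by rewrite ltnS.
have lnn (l : 'I_n) : (l : nat) != n by rewrite ltn_eqF.
have sc (c : R) : \sum_(l < n) c = n%:R * c by rewrite sumr_const card_ord mulr_natl.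
have S1 : \sum_(l < n) m l = \sum_(l < n) g l + n%:R * c0 + c1 * (\sum_(l < n) e l) + \sum_(l < n) D l.
  rewrite mulr_sumr -sc -!big_split /=; apply: eq_bigr => l _.
  by rewrite hm.
have S2 : \sum_(l < n) U l n = n%:R * k0 - k1 * (\sum_(l < n) e l) - k1 * (n%:R * e n)
    + \sum_(l < n) W l n + \sum_(l < n) V l n.
  rewrite mulr_sumr -!sc mulr_sumr -!sumrB -!big_split /=; apply: eq_bigr => l _.
  by rewrite hU//; ring.
have S3 : \sum_(l < n) \sum_(l' < n) U l l' =
   n%:R * (n%:R * k0) - 2 * k1 * (n%:R * \sum_(l < n) e l) + n%:R * (k3 - k0)
   - (k2 - 2 * k1) * (\sum_(l < n) e l)
   + 2 * (\sum_(l < n) \sum_(l' < n | (l < l')%N) W l l')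
   + \sum_(l < n) \sum_(l' < n | l' != l) V l l'.
  rewrite -(sum_offdiag _ sW).
  have -> : \sum_(l < n) \sum_(l' < n) U l l' = \sum_(l < n) (n%:R * k0 - k1 * (n%:R * e l)
     - k1 * (\sum_(l' < n) e l') + (k3 - k0) - (k2 - 2 * k1) * e l
     + \sum_(l' < n | l' != l) W l l' + \sum_(l' < n | l' != l) V l l').
    apply: eq_bigr => l _; rewrite (bigD1 l)//= hd//.
    have -> : \sum_(i < n | i != l) U l i = \sum_(i < n | i != l) (k0 - k1 * e l - k1 * e i)
        + \sum_(i < n | i != l) W l i + \sum_(i < n | i != l) V l i.
      rewrite -!big_split /=; apply: eq_bigr => i il; rewrite hU//; first by ring.
      by rewrite eq_sym.
    have : \sum_(i < n) (k0 - k1 * e l - k1 * e i) = n%:R * (k0 - k1 * e l) - k1 * \sum_(i < n) e i.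
      by rewrite -sc mulr_sumr -sumrB.
    rewrite (bigD1 l)//=.
    move: (\sum_(i < n | i != l) (k0 - _ - _)) => A hA.
    have -> : A = n%:R * (k0 - k1 * e l) - k1 * (\sum_(i < n) e i) - (k0 - k1 * e l - k1 * e l).
      by rewrite -hA; ring.
    by ring.
  rewrite !big_split /= !sumrN -!mulr_sumr !sc.
  move: (\sum_(l < n) e l) => E; ring.
rewrite S1 S2 S3 hm// hd// hU//; last by rewrite neq_ltn ltnSn.
rewrite -ck -natr1; move: (\sum_(l < n) e l) => E; ring.
Qed.

End Remainder.

Lemma remainder_bound (R : realType) (n : nat) (D : nat -> R) (V : nat -> nat -> R) (A B : R) :
  0 <= B -> (forall l, (l < n.+2)%N -> `|D l| <= A) ->
  (forall l l', (l < n.+2)%N -> (l' < n.+2)%N -> l != l' -> `|V l l'| <= B) ->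
  `|\sum_(l < n) D l - n%:R * D n + \sum_(l < n) \sum_(l' < n | l' != l) V l l'
      - 2 * n%:R * (\sum_(l < n) V l n) + n%:R * n.+1%:R * V n n.+1|
  <= 2 * n%:R * A + (n%:R * n%:R + 2 * n%:R * n%:R + n%:R * n.+1%:R) * B.
Proof.
move=> B0 hD hV.
have ln (l : 'I_n) : (l < n.+2)%N by rewrite ltnS ltnW// ltnS ltnW.
have nn : (n < n.+2)%N by rewrite ltnS.
have lnn (l : 'I_n) : (l : nat) != n by rewrite ltn_eqF.
have sc (c : R) : \sum_(l < n) c = n%:R * c by rewrite sumr_const card_ord mulr_natl.
have b1 : `|\sum_(l < n) D l| <= n%:R * A.
  by rewrite -sc (le_trans (ler_norm_sum _ _ _))//; apply: ler_sum => l _; exact: hD.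
have b2 : `|n%:R * D n| <= n%:R * A by rewrite normrM normr_nat ler_wpM2l ?hD.
have b3 : `|\sum_(l < n) \sum_(l' < n | l' != l) V l l'| <= n%:R * n%:R * B.
  rewrite -mulrA -sc (le_trans (ler_norm_sum _ _ _))//; apply: ler_sum => l _.
  rewrite -sc (le_trans (ler_norm_sum _ _ _))// big_mkcond /=; apply: ler_sum => l' _.
  by case: ifP => // ll'; apply: hV => //; rewrite eq_sym.
have b4 : `|2 * n%:R * (\sum_(l < n) V l n)| <= 2 * n%:R * n%:R * B.
  rewrite -!mulrA normrM (ger0_norm (_ : 0 <= 2))// ler_wpM2l// normrM normr_nat ler_wpM2l//.
  by rewrite -sc (le_trans (ler_norm_sum _ _ _))//; apply: ler_sum => l _; exact: hV.
have b5 : `|n%:R * n.+1%:R * V n n.+1| <= n%:R * n.+1%:R * B.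
  rewrite -natrM normrM normr_nat ler_wpM2l// hV//.
  by rewrite neq_ltn ltnSn.
rewrite (le_trans (ler_normD _ _))// (le_trans (lerD (ler_normB _ _) b5))//.
have := ler_normD (\sum_(l < n) D l - n%:R * D n) (\sum_(l < n) \sum_(l' < n | l' != l) V l l').
have := ler_normB (\sum_(l < n) D l) (n%:R * D n).
lra.
Qed.

Section Decomposition.
Context (R : realType) (xi : R -> R) (beta h q : R) (N : nat).
Let T := N.-tuple R.
Let r := h * (1 - q).
Let r1 (x : T) := a1 x * (Rhat1 x - r).
Let r2 (x y : T) := a2 xi q x y * (Rhat2 x y - q).

Definition main_term n (s : n.+2.-tuple T) : R :=
  h / 2 * (\sum_(l < n) r1 (rep s l)) - n%:R * (h / 2) * r1 (rep s n)
  + 2 * beta ^+ 2 * (\sum_(l < n) \sum_(l' < n | (l < l')%N) r2 (rep s l) (rep s l'))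
  - 2 * n%:R * beta ^+ 2 * (\sum_(l < n) r2 (rep s l) (rep s n))
  + n%:R * n.+1%:R * beta ^+ 2 * r2 (rep s n) (rep s n.+1).

(* Antisymmetric in the last two replicas, so its Gibbs average vanishes; it accounts
   for the second moments of the last coordinate left over in [theta]. *)
Definition swap_term n (s : n.+2.-tuple T) : R :=
  n%:R * n.+1%:R * (beta ^+ 2 / 4 * (q * derive1n 1 xi q))
  * (eps (rep s n.+1) ^+ 2 - eps (rep s n) ^+ 2).

(** Defined as whatever is missing, so that the identity for the derivative is immediate and the
    content lies in the bound; the indicator makes that bound hold for every tuple. *)
Definition remainder n (s : n.+2.-tuple T) : R :=
  (theta xi beta h q s + swap_term s - main_term s) * igs s.

Definition quartic k (s : k.-tuple T) : R := 1 + \sum_(l < k) eps (rep s l) ^+ 4.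

Definition fluct k (s : k.-tuple T) : R := \sum_(l < k) \sum_(l' < k | l != l')
  (1 + eps (rep s l) ^+ 2) * (Rhat2 (rep s l) (rep s l') - q) ^+ 2.

Let eps4_ge0 (x : T) : 0 <= eps x ^+ 4. Proof. by rewrite exprn_even_ge0. Qed.

Let fluct_ge0 (x y : T) : 0 <= (1 + eps x ^+ 2) * (Rhat2 x y - q) ^+ 2.
Proof. by rewrite mulr_ge0 ?sqr_ge0// addr_ge0// sqr_ge0. Qed.

Lemma quartic_ge k (s : k.-tuple T) l : (l < k)%N -> 1 + eps (rep s l) ^+ 4 <= quartic s.
Proof.
move=> lk; rewrite /quartic lerD2l (bigD1 (Ordinal lk))//= lerDl.
by apply: sumr_ge0 => i _; exact: eps4_ge0.
Qed.

Lemma fluct_sum_ge0 k (s : k.-tuple T) : 0 <= fluct s.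
Proof. by apply: sumr_ge0 => l _; apply: sumr_ge0 => l' _; exact: fluct_ge0. Qed.

Lemma fluct_ge k (s : k.-tuple T) l l' : (l < k)%N -> (l' < k)%N -> l != l' ->
  (1 + eps (rep s l) ^+ 2) * (Rhat2 (rep s l) (rep s l') - q) ^+ 2 <= fluct s.
Proof.
move=> lk lk' ll'; rewrite /fluct (bigD1 (Ordinal lk))//= (bigD1 (Ordinal lk'))//=.
rewrite -addrA lerDl addr_ge0//; first by apply: sumr_ge0 => i _; exact: fluct_ge0.
by apply: sumr_ge0 => i _; apply: sumr_ge0 => j _; exact: fluct_ge0.
Qed.

Lemma quartic_ge0 k (s : k.-tuple T) : 0 <= quartic s.
Proof. by rewrite addr_ge0// sumr_ge0. Qed.

Lemma a2C (x y : T) : a2 xi q x y = a2 xi q y x.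
Proof. by rewrite /a2; ring. Qed.

Hypothesis C3xi : C3 xi.
Hypothesis hN : (2 <= N)%N.
Hypothesis q01 : 0 <= q < 1.
Variable K : R.
Hypothesis K0 : 0 <= K.
Hypothesis K1 : forall x, `|x| <= 1 -> `|derive1n 1 xi x| <= K.
Hypothesis K2 : forall x, `|x| <= 1 -> `|derive1n 2 xi x| <= K.
Hypothesis K3 : forall x, `|x| <= 1 -> `|derive1n 3 xi x| <= K.

(** 2 n counts the drift errors and the bracket counts the off-diagonal kernel errors with their
    coefficients. The 16 covers the 8 / N of [kern_expand], doubled because two replicas are bounded
    by [quartic]. *)
Definition remainder_cst n : R := 2 * n%:R + 16 * K * (n%:R * n%:R + 2 * n%:R * n%:R + n%:R * n.+1%:R).

Lemma remainder_cst_ge0 n : 0 <= remainder_cst n.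
Proof. by rewrite /remainder_cst -!natrM -!natrD addr_ge0// !mulr_ge0. Qed.

Lemma remainder_le n (s : n.+2.-tuple T) :
  `|remainder s| <= remainder_cst n / N%:R * (beta ^+ 2 + `|h|) * quartic s
    + remainder_cst n * beta ^+ 2 * fluct s.
Proof.
have N0 : 0 < N%:R :> R by exact: N_gt0.
have S0 := quartic_ge0 s; have Q0 := fluct_sum_ge0 s; have L0 := remainder_cst_ge0 n.
have b0 := sqr_ge0 beta.
case: (pselect (forall l, (l < n.+2)%N -> good (rep s l))) => gs; last first.
  rewrite /remainder (igs_bad gs) mulr0 normr0 addr_ge0// mulr_ge0//.
    by rewrite mulr_ge0 ?addr_ge0// divr_ge0// ltW.
  by rewrite mulr_ge0.
pose e l := eps (rep s l) ^+ 2.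
pose k1 := beta ^+ 2 / 4 * (q * derive1n 1 xi q).
pose g l := h / 2 * r1 (rep s l).
pose W l l' := beta ^+ 2 * r2 (rep s l) (rep s l').
pose c0 := h * r / 2.
pose c1 := 2^-1 * (b_const xi beta h q - h * r).
pose k0 := beta ^+ 2 / 2 * xi q.
pose m l := drift xi beta h q (rep s l).
pose U l l' := kern xi beta q (rep s l) (rep s l').
pose D l := m l - (g l + c0 + c1 * e l).
pose V l l' := U l l' - (k0 - k1 * (e l + e l') + W l l').
have -> : remainder s = \sum_(l < n) D l - n%:R * D n + \sum_(l < n) \sum_(l' < n | l' != l) V l l'
      - 2 * n%:R * (\sum_(l < n) V l n) + n%:R * n.+1%:R * V n n.+1.
  rewrite /remainder igs_good// mulr1.
  apply/eqP; rewrite subr_eq addrC; apply/eqP.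
  transitivity (\sum_(l < n) g l - n%:R * g n + 2 * (\sum_(l < n) \sum_(l' < n | (l < l')%N) W l l')
    - 2 * n%:R * (\sum_(l < n) W l n) + n%:R * n.+1%:R * W n n.+1
    + (\sum_(l < n) D l - n%:R * D n + \sum_(l < n) \sum_(l' < n | l' != l) V l l'
      - 2 * n%:R * (\sum_(l < n) V l n) + n%:R * n.+1%:R * V n n.+1)); last first.
    rewrite [RHS]addrC; congr (_ + _); rewrite /main_term /g /W.
    under [X in 2 * X]eq_bigr do rewrite -mulr_sumr.
    by rewrite -!mulr_sumr; ring.
  rewrite -(theta_expand (m := m) (U := U) (e := e) (c0 := c0) (c1 := c1) (k0 := k0) (k1 := k1)
    (k2 := beta ^+ 2 / 2 * derive1n 1 xi q) (k3 := beta ^+ 2 / 2 * xi 1)).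
  - by rewrite addrC.
  (* The value of b matters here: c1 = beta^2 (1 - q) xi'(q) / 2 and 2 k1 = beta^2 q xi'(q) / 2 add
     up to the diagonal coefficient beta^2 xi'(q) / 2. *)
  - by rewrite /c1 /k1 /b_const /r; field.
  - by move=> l l'; rewrite /W /r2 a2C Rhat2C.
  - by move=> l _; rewrite /D; ring.
  - by move=> l ln; rewrite /U (kern_diag xi beta q hN (gs l ln)) /e; ring.
  - by move=> l l' _ _ _; rewrite /V; ring.
have bD l : (l < n.+2)%N -> `|D l| <= `|h| / N%:R * quartic s.
  move=> ln; apply: le_trans (drift_expand xi beta h q hN (gs l ln)) _.
  by rewrite ler_wpM2l ?divr_ge0// ?(ltW N0)// quartic_ge.
have bV l l' : (l < n.+2)%N -> (l' < n.+2)%N -> l != l' ->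
    `|V l l'| <= 16 * K * beta ^+ 2 * (quartic s / N%:R + fluct s).
  move=> ln ln' ll'.
  have -> : V l l' = kern xi beta q (rep s l) (rep s l') - (beta ^+ 2 / 2 * xi q
    - beta ^+ 2 / 4 * (eps (rep s l) ^+ 2 + eps (rep s l') ^+ 2) * (q * derive1n 1 xi q)
    + beta ^+ 2 * (a2 xi q (rep s l) (rep s l') * (Rhat2 (rep s l) (rep s l') - q))).
    by rewrite /V /U /k0 /k1 /W /r2 /e; ring.
  apply: le_trans (kern_expand beta C3xi hN q01 K0 K1 K2 K3 (gs l ln) (gs l' ln')) _.
  have -> : 16 * K * beta ^+ 2 * (quartic s / N%:R + fluct s) =
    beta ^+ 2 * K * (8 / N%:R * (2 * quartic s) + 16 * fluct s) by ring.
  rewrite ler_wpM2l//; first exact: mulr_ge0.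
  apply: lerD.
    rewrite ler_wpM2l ?divr_ge0// ?(ltW N0)//.
    have := quartic_ge s ln; have := quartic_ge s ln'.
    by have := eps4_ge0 (rep s l); have := eps4_ge0 (rep s l'); lra.
  have := fluct_ge s ln ln' ll'; have := fluct_ge s ln' ln (_ : l' != l).
  rewrite eq_sym => /(_ ll'); rewrite (Rhat2C (rep s l')).
  move: Q0; move: (fluct s) (sqr_ge0 (Rhat2 (rep s l) (rep s l') - q)) => F.
  by move: ((_ - _) ^+ 2) (eps _ ^+ 2) (eps _ ^+ 2) => p a b; lra.
have B0 : 0 <= 16 * K * beta ^+ 2 * (quartic s / N%:R + fluct s).
  by apply: mulr_ge0; [rewrite mulr_ge0// mulr_ge0|rewrite addr_ge0// divr_ge0// ltW].
apply: le_trans (remainder_bound B0 bD bV) _.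
rewrite /remainder_cst.
set cn := n%:R * n%:R + _ + _.
have c0' : 0 <= cn by rewrite /cn -!natrM -!natrD.
rewrite [leLHS](_ : _ = (2 * n%:R) * (`|h| * (quartic s / N%:R))
  + 16 * K * cn * (beta ^+ 2 * (quartic s / N%:R) + beta ^+ 2 * fluct s)); last by ring.
rewrite [leRHS](_ : _ = (2 * n%:R + 16 * K * cn) * (`|h| * (quartic s / N%:R))
  + (2 * n%:R + 16 * K * cn) * (beta ^+ 2 * (quartic s / N%:R) + beta ^+ 2 * fluct s)); last by ring.
have p1 : 0 <= 2 * n%:R :> R by rewrite mulr_ge0.
have p2 : 0 <= 16 * K * cn by rewrite !mulr_ge0.
have p3 : 0 <= quartic s / N%:R by rewrite divr_ge0// ltW.
rewrite lerD// ler_wpM2r//; rewrite ?lerDl ?lerDr//.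
  by rewrite mulr_ge0.
by rewrite addr_ge0// mulr_ge0.
Qed.

End Decomposition.

Lemma bm_bo (R : realType) d (S : measurableType d) (D : set S) (f : S -> R) : bm f -> bo D f.
Proof. by move=> [mf [C hC]]; split => //; exists C => x _. Qed.

(** * Linearity of the average, and the final form of the derivative *)

Section MainTerm.
Context (R : realType) (xi : R -> R) (beta h q : R) (N : nat).
Hypothesis hN : (2 <= N)%N.
Let T := N.-tuple R.
Let r := h * (1 - q).
Let r1 (x : T) := a1 x * (Rhat1 x - r).
Let r2 (x y : T) := a2 xi q x y * (Rhat2 x y - q).
Let G := @good R N.

Let bo_r1 : bo G r1.
Proof.
apply: boM; first by apply: boB; [exact: bo_cst|apply: boX; exact: bo_eps].
by apply: boB; [exact: bo_Rhat1|exact: bo_cst].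
Qed.

Let bo_r2 : bo (G `*` G) (fun p => r2 p.1 p.2).
Proof.
have be1 : bo (G `*` G) (fun p : T * T => eps p.1).
  by apply: (bo_comp (bo_eps R hN)); [exact: measurable_fst|move=> p []].
have be2 : bo (G `*` G) (fun p : T * T => eps p.2).
  by apply: (bo_comp (bo_eps R hN)); [exact: measurable_snd|move=> p []].
apply: boM; last by apply: boB; [exact: bo_Rhat2|exact: bo_cst].
apply: boZ; apply: boD.
  apply: boB; first exact: bo_cst.
  apply: boM; last exact: bo_cst.
  by apply: boZ; apply: boD; exact: boX.
by apply: boM; [exact: boM|exact: bo_cst].
Qed.

Variable n : nat.
Let S := n.+2.-tuple T.
Let D := @goods R N n.+2.

Let ln (l : 'I_n) : (l < n.+2)%N. Proof. by rewrite ltnS ltnW// ltnS ltnW. Qed.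
Let nn : (n < n.+2)%N. Proof. by rewrite ltnS. Qed.

Let br1 l : (l < n.+2)%N -> bo D (fun s : S => r1 (rep s l)).
Proof. by move=> lk; exact: bo_rep1. Qed.

Let br2 l l' : (l < n.+2)%N -> (l' < n.+2)%N -> bo D (fun s : S => r2 (rep s l) (rep s l')).
Proof. by move=> lk lk'; exact: (bo_rep2 lk lk' bo_r2). Qed.

Lemma bo_main_term : bo D (@main_term R xi beta h q N n).
Proof.
apply: boD; last by apply: boZ; exact: br2.
apply: boB; last by apply: boZ; apply: bo_sum => l _; exact: br2.
apply: boD; last first.
  by apply: boZ; apply: bo_sum => l _; apply: bo_sum => l' _; exact: br2.
apply: boB; last by apply: boZ; exact: br1.
by apply: boZ; apply: bo_sum => l _; exact: br1.
Qed.

Lemma bo_swap_term : bo D (@swap_term R xi beta q N n).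
Proof.
apply: boZ; apply: boB; apply: boX.
  by apply: bo_rep1 => //; exact: bo_eps.
by apply: bo_rep1 => //; exact: bo_eps.
Qed.

Lemma bm_remainder : continuous xi -> bm (@remainder R xi beta h q N n).
Proof.
move=> cxi; apply: bo_igs; apply: boB; last exact: bo_main_term.
apply: boD; last exact: bo_swap_term.
by apply: bm_bo; exact: bm_theta.
Qed.

Variable E : (S -> R) -> R.
Hypothesis E_add : forall F1 F2, bo D F1 -> bo D F2 -> E (fun s => F1 s + F2 s) = E F1 + E F2.
Hypothesis E_scale : forall c F, bo D F -> E (fun s => c * F s) = c * E F.

Let E_sub F1 F2 : bo D F1 -> bo D F2 -> E (fun s => F1 s - F2 s) = E F1 - E F2.
Proof.
move=> b1 b2; transitivity (E (fun s => F1 s + -1 * F2 s)).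
  by congr E; apply/funext => s; rewrite mulN1r.
by rewrite (E_add b1 (boZ (-1) b2)) (E_scale (-1) b2) mulN1r.
Qed.

Let E_sum (Q : pred 'I_n) (F : 'I_n -> S -> R) : (forall i, bo D (F i)) ->
  E (fun s => \sum_(i < n | Q i) F i s) = \sum_(i < n | Q i) E (F i).
Proof.
move=> bF; elim: (index_enum _) => [|i e ih].
  under eq_fun do rewrite big_nil.
  rewrite big_nil -[RHS](mul0r (E (fun=> 0))) -E_scale; last exact: bo_cst.
  by congr E; apply/funext => s; rewrite mulr0.
under eq_fun do rewrite big_cons.
rewrite big_cons; case: (Q i) => //; rewrite E_add ?ih//.
by apply: bo_sum => j _.
Qed.

(** [E] is any functional linear on functions bounded off the poles, the class on which [nu2D] and
    [nu2Z] establish linearity for the averages of the model. *)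
Lemma linear_main_term : E (@main_term R xi beta h q N n) =
  h / 2 * (\sum_(l < n) E (fun s => r1 (rep s l)))
  - n%:R * (h / 2) * E (fun s => r1 (rep s n))
  + 2 * beta ^+ 2 * (\sum_(l < n) \sum_(l' < n | (l < l')%N)
      E (fun s => r2 (rep s l) (rep s l')))
  - 2 * n%:R * beta ^+ 2 * (\sum_(l < n) E (fun s => r2 (rep s l) (rep s n)))
  + n%:R * n.+1%:R * beta ^+ 2 * E (fun s => r2 (rep s n) (rep s n.+1)).
Proof.
have s1 : bo D (fun s : S => \sum_(l < n) r1 (rep s l)).
  by apply: bo_sum => l _; exact: br1.
have s2 (l : 'I_n) : bo D (fun s : S => \sum_(l' < n | (l < l')%N) r2 (rep s l) (rep s l')).
  by apply: bo_sum => l' _; exact: br2.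
have s3 : bo D (fun s : S => \sum_(l < n) \sum_(l' < n | (l < l')%N) r2 (rep s l) (rep s l')).
  by apply: bo_sum => l _; exact: s2.
have s4 : bo D (fun s : S => \sum_(l < n) r2 (rep s l) (rep s n)).
  by apply: bo_sum => l _; exact: br2.
have s5 : bo D (fun s : S => r1 (rep s n)) by exact: br1.
have s6 : bo D (fun s : S => r2 (rep s n) (rep s n.+1)) by exact: br2.
rewrite /main_term E_add; [|by do ![apply: boD | apply: boN | apply: boZ]|exact: boZ].
rewrite E_sub; [|by do ![apply: boD | apply: boN | apply: boZ]|exact: boZ].
rewrite E_add; [|by do ![apply: boD | apply: boN | apply: boZ]|exact: boZ].
rewrite E_sub; [|exact: boZ|exact: boZ].
rewrite !E_scale// !E_sum; [|by move=> l; exact: br2|exact: s2|by move=> l; exact: br1].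
congr (_ + _ * _ - _ + _); apply: eq_bigr => l _.
by rewrite E_sum// => l'; exact: br2.
Qed.

End MainTerm.

Section GoodAverage.
Context (R : realType) (N : nat) (lam : probability (N.-tuple R) R).
Context d (Om : measurableType d) (P : probability Om R).
Let T := N.-tuple R.
Variables (X : R -> Om -> T -> R).
Hypothesis mX : forall u : R, 0 < u < 1 -> measurable_fun setT (fun p : Om * T => X u p.1 p.2).
Hypothesis Xb : forall w, exists B, forall (u : R) x, 0 < u < 1 -> `|X u w x| <= B.
Hypothesis Xc : forall w x (u : R), 0 < u < 1 -> {for u, continuous (fun s => X s w x)}.
Variables (n : nat) (f : n.-tuple T -> R) (t : R).
Hypotheses (bf : bm f) (t01 : 0 < t < 1).
Let S := n.+2.-tuple T.
Let D := @goods R N n.+2.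

Definition good_av (F : S -> R) := Nu lam P X t (fun s => f (firstn n s) * F s * igs s).

Lemma bm_good_av F : bo D F -> bm (fun s : S => f (firstn n s) * F s * igs s).
Proof.
move=> bF; apply: bo_igs; apply: boM => //; apply: bm_bo; apply: (bm_comp bf).
by apply: measurable_firstn; rewrite -addn2 leq_addr.
Qed.

Lemma good_avD F1 F2 : bo D F1 -> bo D F2 ->
  good_av (fun s => F1 s + F2 s) = good_av F1 + good_av F2.
Proof.
move=> b1 b2; rewrite /good_av -(NuD lam P mX Xb Xc t01 (bm_good_av b1) (bm_good_av b2)).
by congr Nu; apply/funext => s; ring.
Qed.

Lemma good_avZ c F : bo D F -> good_av (fun s => c * F s) = c * good_av F.
Proof.
move=> bF; rewrite /good_av -(NuZ lam P mX Xb Xc t01 c (bm_good_av bF)).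
by congr Nu; apply/funext => s; ring.
Qed.

Lemma good_av_swap xi beta q : (2 <= N)%N -> good_av (@swap_term R xi beta q N n) = 0.
Proof.
move=> hN; apply: (Nu_swap lam P mX Xb t01 (bm_good_av (bo_swap_term xi beta q hN n))).
move=> s y1 y2; rewrite !firstn_rcons2 /swap_term !rep_rcons_last.
rewrite !(rep_rcons (k := n.+1))// !rep_rcons_last.
by rewrite !igs_rcons; ring.
Qed.

End GoodAverage.

Section Derivative.
Context (R : realType) (xi : R -> R) (beta h q : R) (N : nat).
Context d (Om : measurableType d) (P : probability Om R).
Context (HN : Om -> N.-tuple R -> R) (HM : Om -> N.-1.-tuple R -> R) (z : Om -> R).
Variable lam : probability (N.-tuple R) R.
Hypothesis hN : (2 <= N)%N.
Hypothesis cxi : continuous xi.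
Hypothesis xi1_ge0 : 0 <= derive1n 1 xi q.
Hypothesis ulam : uniform_on_sphere lam.
Hypothesis gN : gauss_process P HN xi.
Hypothesis gM : gauss_process P HM xi.
Hypothesis cN : forall w, cont_on_sph (HN w).
Hypothesis cM : forall w, cont_on_sph (HM w).
Hypothesis gz : has_law P z (gauss_law 1).
Hypothesis ind : indep3 P (gen_sigma (sph N) (fun x w => HN w x))
           (gen_sigma (sph N.-1) (fun x w => HM w x))
           (gen_sigma [set: unit] (fun _ w => z w)).
Let T := N.-tuple R.
Let X := fld xi beta h q HN HM z.

Let mX (u : R) : 0 < u < 1 -> measurable_fun setT (fun p : Om * T => X u p.1 p.2).
Proof. by move=> _; exact: (measurable_fld beta h q hN gN gM cN cM gz). Qed.

Let Xb : forall w, exists B, forall (u : R) x, 0 < u < 1 -> `|X u w x| <= B.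
Proof. exact: fld_bounded. Qed.

Let Xc : forall w x (u : R), 0 < u < 1 -> {for u, continuous (fun s => X s w x)}.
Proof. exact: fld_cont. Qed.

Variables (n : nat) (f : n.-tuple T -> R) (t : R).
Hypotheses (bf : bm f) (t01 : 0 < t < 1).
Let S := n.+2.-tuple T.
Let D := @goods R N n.+2.
Let nu2 (F : S -> R) := nu P lam xi beta h q HN HM z t (fun s => f (firstn n s) * F s).
Let av2 : (S -> R) -> R := good_av lam P X f t.

Lemma nu_good_av F : bo D F -> nu2 F = av2 F.
Proof.
move=> bF; exact: (nu_Nu beta h q hN ulam gN gM cN cM gz t01
  (G := fun s => f (firstn n s) * F s) (bm_good_av bf bF)).
Qed.

Lemma nu2D F1 F2 : bo D F1 -> bo D F2 -> nu2 (fun s => F1 s + F2 s) = nu2 F1 + nu2 F2.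
Proof.
move=> b1 b2; rewrite (nu_good_av (boD b1 b2)) (nu_good_av b1) (nu_good_av b2).
exact: (good_avD lam P mX Xb Xc bf t01 b1 b2).
Qed.

Lemma nu2Z c F : bo D F -> nu2 (fun s => c * F s) = c * nu2 F.
Proof.
move=> bF; rewrite (nu_good_av (boZ c bF)) (nu_good_av bF).
exact: (good_avZ lam P mX Xb Xc bf t01 c bF).
Qed.

(** Off the poles theta plus the swap term equals the main term plus the remainder, and the swap
    term averages to zero under exchange of the last two replicas. *)
Lemma nu_derive_main :
  is_derive t 1 (fun u => nu P lam xi beta h q HN HM z u f)
    (nu2 (@main_term R xi beta h q N n) + nu2 (@remainder R xi beta h q N n)).
Proof.
have bmt := bo_main_term xi beta h q hN n; have bst := bo_swap_term xi beta q hN n.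
have bth : bo D (@theta R xi beta h q N n) by apply: bm_bo; exact: bm_theta.
have brm : bo D (@remainder R xi beta h q N n) by apply: bm_bo; exact: bm_remainder.
have := nu_derive beta h hN cxi xi1_ge0 ulam gN gM cN cM gz ind bf t01.
suff -> : Nu lam P X t (fun s : S => f (firstn n s) * theta xi beta h q s * igs s) =
   nu2 (@main_term R xi beta h q N n) + nu2 (@remainder R xi beta h q N n) by [].
rewrite -[LHS]/(av2 (@theta R xi beta h q N n)).
rewrite (nu_good_av bmt) (nu_good_av brm).
have e0 : av2 (@swap_term R xi beta q N n) = 0.
  exact: (good_av_swap lam P mX Xb bf t01 xi beta q hN).
have e1 : av2 (fun s => theta xi beta h q s + swap_term xi beta q s) =
    av2 (@theta R xi beta h q N n) + av2 (@swap_term R xi beta q N n).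
  exact: (good_avD lam P mX Xb Xc bf t01 bth bst).
have e2 : av2 (fun s => main_term xi beta h q s + remainder xi beta h q s) =
    av2 (@main_term R xi beta h q N n) + av2 (@remainder R xi beta h q N n).
  exact: (good_avD lam P mX Xb Xc bf t01 bmt brm).
rewrite -e2 -[LHS]addr0 -e0 -e1.
apply: (Nu_igs beta h q hN ulam gN gM cN cM gz t01 (bm_good_av bf (boD bth bst))
  (bm_good_av bf (boD bmt brm))).
move=> s; rewrite /remainder.
case: (pselect (forall l, (l < n.+2)%N -> good (rep s l))) => gs.
  by rewrite (igs_good gs); ring.
by rewrite (igs_bad gs) !mulr0.
Qed.

End Derivative.

Theorem theorem1 (R : realType) (xi : R -> R) (beta h q : R) :
  C3 xi -> 0 < beta -> h != 0 ->
  0 <= q < 1 -> 0 <= derive1n 1 xi q ->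
  h ^+ 2 + beta ^+ 2 * derive1n 1 xi q = q / (1 - q) ^+ 2 ->
  (forall q' : R, 0 <= q' < 1 -> 0 <= derive1n 1 xi q' ->
     h ^+ 2 + beta ^+ 2 * derive1n 1 xi q' = q' / (1 - q') ^+ 2 -> q' = q) ->
  let r := h * (1 - q) in
  forall n : nat, (1 <= n)%N ->
  exists L : R,
  forall N : nat, (2 <= N)%N ->
  forall lam : probability (N.-tuple R) R, uniform_on_sphere lam ->
  forall (d : measure_display) (Omega : measurableType d)
    (P : probability Omega R)
    (HN : Omega -> N.-tuple R -> R) (HM : Omega -> N.-1.-tuple R -> R)
    (z : Omega -> R),
  gauss_process P HN xi -> gauss_process P HM xi ->
  (forall w, cont_on_sph (HN w)) -> (forall w, cont_on_sph (HM w)) ->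
  has_law P z (gauss_law 1) ->
  indep3 P (gen_sigma (sph N) (fun x w => HN w x))
           (gen_sigma (sph N.-1) (fun x w => HM w x))
           (gen_sigma [set: unit] (fun _ w => z w)) ->
  forall t : R, 0 < t < 1 ->
  exists Rem : n.+2.-tuple (N.-tuple R) -> R,
    measurable_fun setT Rem /\
    (forall s : n.+2.-tuple (N.-tuple R),
       (forall l, (l < n.+2)%N -> sph N (rep s l)) ->
       `|Rem s| <=
         L / N%:R * (beta ^+ 2 + `|h|)
           * (1 + \sum_(l < n.+2) eps (rep s l) ^+ 4)
         + L * beta ^+ 2 *
           \sum_(l < n.+2) \sum_(l' < n.+2 | l != l')
              (1 + eps (rep s l) ^+ 2) * (Rhat2 (rep s l) (rep s l') - q) ^+ 2)
    /\
    forall f : n.-tuple (N.-tuple R) -> R,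
      measurable_fun setT f -> (exists C : R, forall s, `|f s| <= C) ->
      let nu2 := fun G : n.+2.-tuple (N.-tuple R) -> R =>
        nu P lam xi beta h q HN HM z t (fun s => f (firstn n s) * G s) in
      is_derive t 1 (fun u => nu P lam xi beta h q HN HM z u f)
        (h / 2 * \sum_(l < n)
             nu2 (fun s => a1 (rep s l) * (Rhat1 (rep s l) - r))
         - n%:R * (h / 2) *
             nu2 (fun s => a1 (rep s n) * (Rhat1 (rep s n) - r))
         + 2 * beta ^+ 2 * \sum_(l < n) \sum_(l' < n | (l < l')%N)
             nu2 (fun s => a2 xi q (rep s l) (rep s l')
                             * (Rhat2 (rep s l) (rep s l') - q))
         - 2 * n%:R * beta ^+ 2 * \sum_(l < n)
             nu2 (fun s => a2 xi q (rep s l) (rep s n)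
                             * (Rhat2 (rep s l) (rep s n) - q))
         + n%:R * (n.+1)%:R * beta ^+ 2 *
             nu2 (fun s => a2 xi q (rep s n) (rep s n.+1)
                             * (Rhat2 (rep s n) (rep s n.+1) - q))
         + nu2 Rem).

Proof.
move=> C3xi _ _ q01 xi1_ge0 _ _ r n _.
have [K [K0 K1 K2 K3]] := C3_bounds C3xi.
(* The constant involves only n and the bound [K] for the derivatives of xi on [-1, 1], hence
   neither N nor t. *)
exists (remainder_cst K n) => N hN lam ulam d Omega P HN HM z gN gM cN cM gz ind t t01.
have cxi := C3_continuous C3xi.
exists (@remainder R xi beta h q N n); split.
  by have [] := bm_remainder beta h q hN n cxi.
split; first by move=> s _; exact: (remainder_le beta h C3xi hN q01 K0 K1 K2 K3 s).
move=> f mf bdf nu2.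
have bf : bm f by split.
have E_add := nu2D beta h q hN ulam gN gM cN cM gz bf t01.
have E_scale := nu2Z beta h q hN ulam gN gM cN cM gz bf t01.
rewrite -(@linear_main_term R xi beta h q N hN n nu2 E_add E_scale).
exact: (nu_derive_main beta h hN cxi xi1_ge0 ulam gN gM cN cM gz ind bf t01).
Qed.
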